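(* For any permutation $w\in\Sigma$ and Young diagram $\lambda$ we have $G_w\cdot G_\lambda=\sum_\nu c^\nu_{w,\lambda}\,G_\nu$, where the sum is over Young diagrams $\nu$ and $c^\nu_{w,\lambda}$ is the number of increasing tableaux $T$ of shape $\nu/\lambda$ such that $w(T)=w^{-1}$.
   Context: **Permutations.** $\Sigma$ is the group of bijections $w:\mathbb{Z}\to\mathbb{Z}$ with $w(x)=x$ for all but finitely many $x$, viewed as a Coxeter group generated by the simple transpositions $s_i=(i,i+1)$, $i\in\mathbb{Z}$, with length function $\ell$. $S_n\subset\Sigma$ is the subgroup of permutations of $\{1,\dots,n\}$. The Hecke product on $\Sigma$ is the associative monoid product determined by $u\cdot s_i=us_i$ if $\ell(us_i)>\ell(u)$ and $u\cdot s_i=u$ otherwise, and $u\cdot v=u\cdot s_{i_1}\cdot s_{i_2}\cdots s_{i_\ell}$ (multiplied left to right) for any reduced expression $v=s_{i_1}\cdots s_{i_\ell}$. **Stable Grothendieck polynomials.** For $w\in S_n$ define $\mathfrak{G}_w=\mathfrak{G}_w(x_1,\dots,x_{n-1})$ as follows: if $w=w_0$ is the longest element of $S_n$, $\mathfrak{G}_{w_0}=\prod_{i=1}^{n-1}x_i^{n-i}$; otherwise $$\mathfrak{G}_w=\frac{(1+x_{i+1})\,\mathfrak{G}_{ws_i}(x_1,\dots,x_n)-(1+x_i)\,\mathfrak{G}_{ws_i}(x_1,\dots,x_{i+1},x_i,\dots,x_n)}{x_i-x_{i+1}}$$ for any $i$ with $1\le i\le n-1$ and $w(i)<w(i+1)$.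 For $w\in\Sigma$ and $m\in\mathbb{Z}$ let $(1^m\times w)(i)=w(i-m)+m$; for all sufficiently large $m$ we have $1^m\times w\in S_{2m}$. The stable Grothendieck polynomial of $w$ is $G_w=\lim_{m\to\infty}\mathfrak{G}_{1^m\times w}\in\mathbb{Z}[[x_1,x_2,\dots]]$. For a partition $\lambda=(\lambda_1\ge\dots\ge\lambda_\ell>0)$, the Grassmannian permutation $w_\lambda\in\Sigma$ is defined by $w_\lambda(i)=i+\lambda_{\ell+1-i}$ for $1\le i\le\ell$, $w_\lambda(0)=0$, and $w_\lambda(i)<w_\lambda(i+1)$ for $i\ne\ell$; set $G_\lambda=G_{w_\lambda}$. The product $G_w\cdot G_\lambda$ is taken in $\mathbb{Z}[[x_1,x_2,\dots]]$. (Every $G_w$ is a finite integer linear combination of the $G_\lambda$, and the span of the linearly independent elements $G_\lambda$ is a ring, identified with the combinatorial $K$-theory ring $\Gamma(\mathbb{N}^2)$.) **Tableaux.** Young diagrams, identified with partitions, are the finite lower order ideals of $\mathbb{N}^2$ ($\mathbb{N}=\{1,2,\dots\}$) with boxes $[r,c]$ in row $r$ (numbered top to bottom) and column $c$ (numbered left to right). For Young diagrams $\lambda\subset\nu$, an increasing tableau of shape $\nu/\lambda:=\nu\setminus\lambda$ is a filling $T:\nu/\lambda\to\mathbb{Z}$ strictly increasing along rows (left to right) and columns (top to bottom); if $\lambda\not\subset\nu$ there are none. If $(a_1,\dots,a_k)$ is the row word of $T$, obtained by reading the rows from left to right starting with the bottom row, the Hecke permutation of $T$ is $w(T)=s_{a_1}\cdot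 s_{a_2}\cdot\ldots\cdot s_{a_k}$ (Hecke product). *)

(* Defs.v *)
From HB Require Import structures.
From mathcomp Require Import all_boot all_order all_fingroup all_algebra.
From mathcomp Require Import finmap mpoly.
From mathcomp Require Import boolp classical_sets functions cardinality fsbigop.

Set Implicit Arguments.
Unset Strict Implicit.
Unset Printing Implicit Defensive.

Import Order.TTheory GRing.Theory Num.Theory.

Local Open Scope classical_set_scope.
Local Open Scope ring_scope.

(** * The group of finitely supported bijections of the integers *)

Definition finitary_bij (f : int -> int) : Prop :=
  bijective f /\ finite_set [set x | f x <> x].

Record Sigma := MkSigma {
  sigma_fun :> int -> int;
  sigma_subproof : `[< finitary_bij sigma_fun >] }.

HB.instance Definition _ := [isSub for sigma_fun].
HB.instance Definition _ := [Choice of Sigma by <:].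

Lemma sigmaP (w : Sigma) : finitary_bij w.
Proof. exact/asboolP/sigma_subproof. Qed.

Definition mk_sigma (f : int -> int) (fP : finitary_bij f) : Sigma :=
  MkSigma (asboolT fP).

Lemma sigma_eqP (u v : Sigma) : u =1 v -> u = v.
Proof. by move=> uv; apply/val_inj/funext. Qed.

Lemma finitary_id : finitary_bij id.
Proof.
split; first by exists id.
by rewrite (_ : [set _ | _] = set0) // -subset0 => x /=.
Qed.

Lemma finitary_comp (u v : Sigma) : finitary_bij (u \o v).
Proof.
have [bu fu] := sigmaP u; have [bv fv] := sigmaP v.
split; first exact: bij_comp.
apply: (sub_finite_set (B := [set x | u x <> x] `|` [set x | v x <> x])).
  move=> x /= uvx; have [vx|] := pselect (v x = x); last by right.
  by left; move: uvx; rewrite /= vx.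
by rewrite finite_setU.
Qed.

Lemma sigma_inv_subproof (w : Sigma) :
  {g : int -> int | cancel w g & cancel g w}.
Proof.
apply: cid2; have [[g wK gK] _] := sigmaP w; by exists g.
Qed.

Definition sigma_inv_fun (w : Sigma) : int -> int :=
  s2val (sigma_inv_subproof w).

Lemma sigma_funK (w : Sigma) : cancel w (sigma_inv_fun w).
Proof. exact: (s2valP (sigma_inv_subproof w)). Qed.

Lemma sigma_inv_funK (w : Sigma) : cancel (sigma_inv_fun w) w.
Proof. exact: (s2valP' (sigma_inv_subproof w)). Qed.

Lemma finitary_inv (w : Sigma) : finitary_bij (sigma_inv_fun w).
Proof.
split; first by exists w; [exact: sigma_inv_funK | exact: sigma_funK].
apply: sub_finite_set (sigmaP w).2 => x /= wx wxE; apply: wx.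
by rewrite -{1}wxE sigma_funK.
Qed.

Definition sigma_one : Sigma := mk_sigma finitary_id.
Definition sigma_mul (u v : Sigma) : Sigma := mk_sigma (finitary_comp u v).
Definition sigma_inv (w : Sigma) : Sigma := mk_sigma (finitary_inv w).

Lemma sigma_mulA : associative sigma_mul.
Proof. by move=> u v w; apply: sigma_eqP. Qed.
Lemma sigma_mul1 : left_id sigma_one sigma_mul.
Proof. by move=> w; apply: sigma_eqP. Qed.
Lemma sigma_mulr1 : right_id sigma_one sigma_mul.
Proof. by move=> w; apply: sigma_eqP. Qed.
Lemma sigma_mulV : left_inverse sigma_one sigma_inv sigma_mul.
Proof. by move=> w; apply: sigma_eqP => x; exact: sigma_funK. Qed.
Lemma sigma_mulrV : right_inverse sigma_one sigma_inv sigma_mul.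
Proof. by move=> w; apply: sigma_eqP => x; exact: sigma_inv_funK. Qed.

(** [(u * v)%g] is [u \o v], unlike the product of [{perm T}]. *)
HB.instance Definition _ := isGroup.Build Sigma
  sigma_mulA sigma_mul1 sigma_mulr1 sigma_mulV sigma_mulrV.

Definition simple_fun (i x : int) : int :=
  if x == i then i + 1 else if x == i + 1 then i else x.

Lemma simple_funK i : involutive (simple_fun i).
Proof.
move=> x; rewrite /simple_fun.
have i1 : (i + 1 == i) = false by rewrite -subr_eq0 addrAC subrr.
have [->|xi] := eqVneq x i; first by rewrite i1 eqxx.
have [->|xi1] := eqVneq x (i + 1); first by rewrite eqxx.
by rewrite (negPf xi) (negPf xi1).
Qed.

Lemma finitary_simple (i : int) : finitary_bij (simple_fun i).
Proof.
split; first exact: inv_bij (simple_funK i).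
apply: (sub_finite_set (B := [set i; i + 1])); last exact: finite_set2.
move=> x /=; rewrite /simple_fun.
by have [->|xi] := eqVneq x i; [left|have [->|//] := eqVneq x (i + 1); right].
Qed.

Definition simple (i : int) : Sigma := mk_sigma (finitary_simple i).

Definition shift_fun (m : int) (w : int -> int) (x : int) : int := w (x - m) + m.

Lemma finitary_shift (m : int) (w : Sigma) : finitary_bij (shift_fun m w).
Proof.
split.
  exists (shift_fun m (sigma_inv_fun w)) => x; rewrite /shift_fun addrK.
    by rewrite sigma_funK subrK.
  by rewrite sigma_inv_funK subrK.
apply: (sub_finite_set (B := +%R^~ m @` [set x | w x <> x])).
  move=> x /= wx; exists (x - m); last exact: subrK.
  by move=> wE; apply: wx; rewrite /shift_fun wE subrK.
exact/finite_image/(sigmaP w).2.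
Qed.

(** The permutation [1^m x w]. *)
Definition shift (m : int) (w : Sigma) : Sigma := mk_sigma (finitary_shift m w).

Definition is_expression (s : seq int) (w : Sigma) : Prop :=
  w = (\prod_(i <- s) simple i)%g.

Definition is_length (w : Sigma) (k : nat) : Prop :=
  (exists2 s, is_expression s w & size s = k) /\
  (forall s, is_expression s w -> (k <= size s)%N).

Definition cox_length (w : Sigma) : nat := xget 0%N [set k | is_length w k].

Definition hecke_simple (u : Sigma) (i : int) : Sigma :=
  if (cox_length u < cox_length (u * simple i)%g)%N then (u * simple i)%g else u.

(** The Hecke product [s_{a_1} . s_{a_2} . ... . s_{a_k}]. *)
Definition hecke_prod (a : seq int) : Sigma := foldl hecke_simple 1%g a.

(** * Grothendieck polynomials *)

(** [S_n], as a subset of [Sigma]. *)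
Definition sym (n : nat) : set Sigma :=
  [set w | forall x : int, ~ (1 <= x <= n%:Z) -> w x = x].

Definition is_longest (n : nat) (w : Sigma) : Prop :=
  sym n w /\ forall v, sym n v -> (cox_length v <= cox_length w)%N.

(** A family indexed by [S_n] is extended by 0 to [Sigma], so that it is unique.
    The variable [x_k] with [1 <= k <= n] is ['X_i] for [i : 'I_n] of value
    [k.-1].  As the ring of polynomials is an integral domain, the last clause
    says that [P w] is the quotient by [x_k - x_(k+1)], for [k = i.+1]. *)
Definition is_grothendieck (n : nat) (P : Sigma -> {mpoly int[n]}) : Prop :=
  [/\ forall w, ~ sym n w -> P w = 0,
      forall w, is_longest n w -> P w = \prod_(i < n) 'X_i ^+ (n - i.+1)
    & forall (w : Sigma) (i j : 'I_n), sym n w -> j = i.+1 :> nat ->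
        w (i.+1%:Z) < w (i.+2%:Z) ->
        let Q := P (w * simple i.+1%:Z)%g in
        ('X_i - 'X_j) * P w
          = (1 + 'X_j) * Q - (1 + 'X_i) * msym (perm.tperm i j) Q].

Definition grothendieck (n : nat) : Sigma -> {mpoly int[n]} :=
  xget (fun=> 0) [set P | @is_grothendieck n P].

(** Monomials in [x_1, x_2, ...], as exponent functions: [k i] is the exponent
    of [x_(i.+1)]. *)
Definition monomial := {fsfun nat -> nat with 0%N}.

(** Elements of [Z[[x_1, x_2, ...]]], as families of coefficients. *)
Definition pseries := monomial -> int.

(** Product of power series; the product of functions is pointwise. *)
Definition psmul (f g : pseries) : pseries := fun k =>
  \sum_(ab \in [set ab : monomial * monomial | forall i, ab.1 i + ab.2 i = k i]%N)
    f ab.1 * g ab.2.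

Definition poly_series (n : nat) (p : {mpoly int[n]}) : pseries := fun k =>
  if `[< forall i : nat, (n <= i)%N -> k i = 0%N >]
  then p@_[multinom k (i : nat) | i < n] else 0.

(** Coefficientwise convergence, the coefficients being discrete. *)
Definition ps_limit (f : nat -> pseries) (g : pseries) : Prop :=
  forall k, exists N, forall m, (N <= m)%N -> f m k = g k.

Definition ps_lim (f : nat -> pseries) : pseries :=
  xget (fun=> 0) [set g | ps_limit f g].

Definition stable_grothendieck (w : Sigma) : pseries :=
  ps_lim (fun m => poly_series (grothendieck m.*2 (shift m%:Z w))).

(** * Young diagrams and increasing tableaux *)

Definition is_partition (s : seq nat) : bool :=
  sorted geq s && (0%N \notin s).

Record young := MkYoung {
  young_parts :> seq nat;
  young_subproof : is_partition young_parts }.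

HB.instance Definition _ := [isSub for young_parts].
HB.instance Definition _ := [Choice of young by <:].

Definition row_length (la : young) (r : nat) : nat := nth 0%N la r.

(** Rows and columns are numbered from 0: the box [[r, c]] is [(r.-1, c.-1)]. *)
Definition in_diagram (la : young) (b : nat * nat) : bool :=
  (b.2 < row_length la b.1)%N.

Definition diagram_sub (la nu : young) : Prop :=
  forall b, in_diagram la b -> in_diagram nu b.

Definition in_skew (nu la : young) (b : nat * nat) : bool :=
  in_diagram nu b && ~~ in_diagram la b.

Definition is_grassmannian (la : young) (w : Sigma) : Prop :=
  let l := size la in
  [/\ forall i : nat, (1 <= i <= l)%N ->
        w i%:Z = i%:Z + (row_length la (l - i))%:Z,
      w 0 = 0
    & forall x : int, x <> l%:Z -> w x < w (x + 1)].

Definition grassmannian (la : young) : Sigma :=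
  xget 1%g [set w | is_grassmannian la w].

Definition stable_grothendieck_young (la : young) : pseries :=
  stable_grothendieck (grassmannian la).

(** A filling of [nu/la] is encoded by its extension by 0 to all boxes, so
    that distinct [T] are distinct fillings. *)
Definition increasing_tableau (nu la : young) (T : nat * nat -> int) : Prop :=
  [/\ diagram_sub la nu,
      forall b, ~~ in_skew nu la b -> T b = 0,
      forall r c c', in_skew nu la (r, c) -> in_skew nu la (r, c') ->
        (c < c')%N -> T (r, c) < T (r, c')
    & forall r r' c, in_skew nu la (r, c) -> in_skew nu la (r', c) ->
        (r < r')%N -> T (r, c) < T (r', c)].

Definition row_word (nu la : young) (T : nat * nat -> int) : seq int :=
  [seq T (r, c) | r <- rev (iota 0 (size nu)),
                  c <- [seq c <- iota 0 (row_length nu r) | in_skew nu la (r, c)]].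

Definition hecke_perm (nu la : young) (T : nat * nat -> int) : Sigma :=
  hecke_prod (row_word nu la T).

Definition tableaux (w : Sigma) (la nu : young) : set (nat * nat -> int) :=
  [set T | increasing_tableau nu la T /\ hecke_perm nu la T = (w^-1)%g].

(** The constant [c^nu_{w,la}]; [fset_set] is the empty set on infinite sets. *)
Definition structure_constant (w : Sigma) (la nu : young) : nat :=
  #|` fset_set (tableaux w la nu)|%fset.

(* Main.v *)
Require Import Defs.
From HB Require Import structures.
From mathcomp Require Import all_boot all_order all_fingroup all_algebra.
From mathcomp Require Import finmap mpoly zify ring.
From mathcomp Require Import boolp classical_sets functions cardinality fsbigop.
From Stdlib Require Ncring Ncring_tac.

(** In the 0-Hecke algebra with generators [u_j], put [D_t(x) = ... (1 + x
    u_(t+1)) (1 + x u_t)]. For a common range of letters the elements [D(x)]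
    and [D(y)] commute, and [G_w] is the coefficient of [w] in [D(x_1)
    D(x_2) ...] (Fomin-Kirillov). Expanding [D(x_1) ... D(x_n)] into tuples
    of decreasing words and reading the [i]-th word as the [i]-th row of a
    filling added to [la], the fillings that are not increasing tableaux
    cancel under antisymmetrization: sort them by the first letter [t], and
    then by the lowest row [i + 1], at which the shape stops being a
    partition; summing over everything that follows in the rows [i], [i + 1]
    gives an expression which is symmetric in [x_i], [x_(i+1)] once
    multiplied by [x_i (1 + x_(i+1))], because [D_t(x) u_t = (1 + x)
    D_(t+1)(x) u_t]. With [a_nu = sum_s sgn(s) s(x^nu prod_i x_i^(n-i) (1 +
    x_i)^(i-1))] this gives [a_la G_w = sum_nu c^nu_(w,la) a_nu] in [n]
    variables. For [la] empty and [w] Grassmannian of shape [mu] the only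
    tableau on the right has shape [mu], so that [a_0 G_mu = a_mu]; the
    theorem follows on cancelling [a_0]. *)

Set Implicit Arguments.
Unset Strict Implicit.
Unset Printing Implicit Defensive.

Import Order.TTheory GRing.Theory Num.Theory.

Local Open Scope classical_set_scope.
Local Open Scope ring_scope.

(** * Inversions and Hecke products *)

(** The coefficients of the polynomials lie in a noncommutative ring, so products over the rows are
    ordered, and a symmetry in [x_i], [x_(i+1)] has to be shown with the factors of these two rows
    side by side. Rows are met from top to bottom, each with its largest letter first; this is the
    reverse of the row word, and reversal inverts a Hecke product, hence the condition
    [w(T) = w^{-1}]. The exponents in [a_nu] are dictated by the cancellation: at a violation the
    rows [i] and [i + 1] have equal lengths, the new box contributes [x_(i+1)], and absorbing its
    letter leaves a denominator [1 + x_(i+1)]; the powers [x_i^(n-i) (1 + x_i)^(i-1)] compensate for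
    exactly this. For a Grassmannian permutation no tableau is constructed. Tracking positions shows
    that there is at most one, of shape [mu]; if there were none, [a_0 G_mu] would vanish, although
    neither factor does. A tableau for [w] adds only boundedly many rows to [la], so each
    coefficient of the power series is seen in finitely many variables. *)

Lemma sigmaM (u v : Sigma) x : (u * v)%g x = u (v x).
Proof. by []. Qed.

Lemma simpleE i x : simple i x = simple_fun i x.
Proof. by []. Qed.

Lemma sigma_oneE x : (1%g : Sigma) x = x.
Proof. by []. Qed.

Arguments sigma_fun : simpl never.

Lemma simpleK i : involutive (simple i).
Proof. exact: simple_funK. Qed.

Lemma sigma_inj (u : Sigma) : injective u.
Proof. exact: can_inj (sigma_funK u). Qed.

Lemma sigmaVK (u : Sigma) : cancel (u^-1)%g u.
Proof. exact: sigma_inv_funK. Qed.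

Lemma sigmaKV (u : Sigma) : cancel u (u^-1)%g.
Proof. exact: sigma_funK. Qed.

Lemma simpleL i : simple i i = i + 1.
Proof. by rewrite simpleE /simple_fun eqxx. Qed.

Lemma simpleR i : simple i (i + 1) = i.
Proof. by rewrite simpleE /simple_fun eqxx; case: eqP => // h; lia. Qed.

Lemma simpleD i x : x <> i -> x <> i + 1 -> simple i x = x.
Proof. by rewrite simpleE /simple_fun; do 2 case: eqP => //. Qed.

Variant simple_spec i x : int -> Prop :=
| SimpleL of x = i : simple_spec i x (i + 1)
| SimpleR of x = i + 1 : simple_spec i x i
| SimpleD of x <> i & x <> i + 1 : simple_spec i x x.

Lemma simpleP i x : simple_spec i x (simple i x).
Proof.
rewrite simpleE /simple_fun; case: eqP => [->|h1]; first by constructor.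
by case: eqP => [->|h2]; constructor.
Qed.

Lemma simpleKK i : (simple i * simple i = 1)%g.
Proof. by apply: sigma_eqP => x; rewrite sigmaM; exact: simple_funK. Qed.

Lemma simpleV i : ((simple i)^-1 = simple i)%g.
Proof. by apply: (mulgI (simple i)); rewrite mulgV simpleKK. Qed.

Lemma mulg_simpleK (u : Sigma) i : (u * simple i * simple i = u)%g.
Proof. by rewrite -mulgA simpleKK mulg1. Qed.

Lemma sigma_bound (u : Sigma) :
  exists M : nat, forall x : int, (x < - M%:Z) || (M%:Z < x) -> u x = x.
Proof.
have /finite_fsetP[X XE] := (sigmaP u).2.
exists (\max_(x <- X) `|x|%N) => x xM; apply: contrapT => ux.
have xX : x \in X by have : [set` X] x by rewrite -XE.
have : (`|x| <= \max_(x <- X) `|x|)%N by apply: (leq_bigmax_seq (F := fun x : int => `|x|%N)).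
by lia.
Qed.

Definition inversions (u : Sigma) : set (int * int) :=
  [set p | p.1 < p.2 /\ u p.2 < u p.1].

Lemma finite_inversions u : finite_set (inversions u).
Proof.
have [M uM] := sigma_bound u.
have fI : finite_set [set x : int | - M%:Z <= x <= M%:Z].
  apply: (sub_finite_set (B := (fun k : nat => k%:Z - M%:Z) @` `I_(2 * M).+1)).
    by move=> x /= xM; exists (absz (x + M%:Z)) => /=; lia.
  exact/finite_image/finite_II.
apply: sub_finite_set (finite_setX fI fI) => -[x y] [/= xy uxy].
have uxI z : u (u z) = u z -> u z = z by move/sigma_inj.
have dec z : (z < - M%:Z) || (M%:Z < z) \/ - M%:Z <= z <= M%:Z by lia.
have decu z : (- M%:Z <= z <= M%:Z) -> - M%:Z <= u z <= M%:Z.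
  by move=> zI; have [/uM/uxI ->|//] := dec (u z).
split; rewrite /=.
  have [xo|//] := dec x; have ux := uM _ xo; rewrite ux in uxy.
  have [yo|yI] := dec y; first by have := uM _ yo; lia.
  by have := decu _ yI; lia.
have [yo|//] := dec y; have uy := uM _ yo; rewrite uy in uxy.
have [xo|xI] := dec x; first by have := uM _ xo; lia.
by have := decu _ xI; lia.
Qed.

Definition inv_num (u : Sigma) : nat := #|` fset_set (inversions u)|%fset.

(** Applying [simple i] to both entries carries the inversions of [u] to those of [u * simple i]
    other than the new one [(i, i + 1)], the only pair whose order is reversed. *)
Lemma inv_num_simple (u : Sigma) i :
  u i < u (i + 1) -> inv_num (u * simple i)%g = (inv_num u).+1.
Proof.
move=> ui.
pose g (p : int * int) := (simple i p.1, simple i p.2).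
have gi : injective g by move=> [a b] [c d] [h1 h2]; rewrite (@sigma_inj (simple i) _ _ h1) (@sigma_inj (simple i) _ _ h2).
have E : inversions (u * simple i)%g = (i, i + 1) |` g @` inversions u.
  rewrite /inversions; apply/seteqP; split => [[x y] [/= xy]|_ [->|[[x y] [/= xy uxy] <-]]].
  - rewrite !sigmaM => uxy.
    have [[-> ->]|nxy] := pselect (x = i /\ y = i + 1); [by left|right].
    exists (simple i x, simple i y); last by rewrite /g /= !simpleK.
    split => //=; move: uxy; case: (simpleP i x) => ?; case: (simpleP i y) => ? //=; try lia.
  - by rewrite /= !sigmaM simpleL simpleR; split => //; lia.
  - rewrite /g /= !sigmaM !simpleK; split => //.
    have nxy : ~ (x = i /\ y = i + 1) by case=> xi yi; move: uxy; rewrite xi yi; lia.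
    by case: (simpleP i x) => ?; case: (simpleP i y) => ?; lia.
have f1 := finite_inversions u.
rewrite /inv_num E fset_setU1; last exact: finite_image.
rewrite fset_set_image // cardfsU1 card_imfset //.
case: imfsetP => //= -[[x y]]; rewrite in_fset_set // inE => -[/= xy _] [].
by case: (simpleP i x) => ?; case: (simpleP i y) => ?; lia.
Qed.

Lemma inv_num_simple_gt (u : Sigma) i :
  u (i + 1) < u i -> inv_num u = (inv_num (u * simple i)%g).+1.
Proof.
move=> ui; rewrite -{1}(mulg_simpleK u i) inv_num_simple //.
by rewrite !sigmaM simpleL simpleR.
Qed.

Lemma sigma_cmp (u : Sigma) i : u i < u (i + 1) \/ u (i + 1) < u i.
Proof.
have [|//|/sigma_inj] := ltgtP (u i) (u (i + 1)); [by left|by right|lia].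
Qed.

Lemma inv_num1 : inv_num 1%g = 0%N.
Proof.
rewrite /inv_num (_ : inversions _ = set0) ?fset_set0 ?cardfs0 //.
by rewrite -subset0 => -[x y] [/=]; rewrite !sigma_oneE => h1 h2; lia.
Qed.

Lemma inv_num_expr (s : seq int) : (inv_num (\prod_(i <- s) simple i)%g <= size s)%N.
Proof.
elim/last_ind: s => [|s i IH]; first by rewrite big_nil inv_num1.
rewrite -cats1 big_cat big_seq1 cats1 /= size_rcons.
set u := (\prod_(_ <- s) _)%g in IH *.
have [/inv_num_simple ->//|/inv_num_simple_gt h] := sigma_cmp u i.
by apply: leq_trans (leqnSn _) _; rewrite -h leqW.
Qed.

(** An increasing map of the integers does not contract distances; comparison with fixed points far
    to the right and far to the left of [x] bounds [u x] from both sides. *)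
Lemma sigma_ascend (u : Sigma) : (forall i, u i < u (i + 1)) -> u = 1%g.
Proof.
move=> ui; have [M uM] := sigma_bound u.
have mono x (k : nat) : u x + k%:Z <= u (x + k%:Z).
  elim: k => [|k IH]; first by rewrite !addr0.
  by have := ui (x + k%:Z); rewrite (_ : _ + 1 = x + k.+1%:Z); lia.
apply: sigma_eqP => x; rewrite sigma_oneE.
have h1 := mono x (`|x| + M.+1)%N; have h2 := mono (- (`|x| + M.+1)%:Z) (absz (x + (`|x| + M.+1)%:Z)).
have e1 : u (x + (`|x| + M.+1)%:Z) = x + (`|x| + M.+1)%:Z by apply: uM; lia.
have e2 : u (- (`|x| + M.+1)%:Z) = - (`|x| + M.+1)%:Z by apply: uM; lia.
have e3 : - (`|x| + M.+1)%:Z + (absz (x + (`|x| + M.+1)%:Z))%:Z = x by lia.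
by rewrite e1 in h1; rewrite e2 e3 in h2; lia.
Qed.

(** Bubble sort: as long as there is a descent, multiplying by its simple transposition removes one
    inversion. *)
Lemma inv_num_expr_ex (u : Sigma) : exists2 s, is_expression s u & size s = inv_num u.
Proof.
elim: {u}(inv_num u) {-2}u (erefl (inv_num u)) => [|k IH] u uk.
  exists [::] => //; rewrite /is_expression big_nil; apply: sigma_ascend => i.
  by have [//|/inv_num_simple_gt] := sigma_cmp u i; rewrite uk.
have [|nui] := pselect (forall i, u i < u (i + 1)).
  by move/sigma_ascend => u1; rewrite u1 inv_num1 in uk.
have /existsNP[i ui] := nui.
have {}ui : u (i + 1) < u i by case: (sigma_cmp u i) => h; [case: ui|].
have [s sE sk] := IH (u * simple i)%g ltac:(by have := inv_num_simple_gt ui; rewrite uk => -[]).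
exists (rcons s i); last by rewrite size_rcons sk (inv_num_simple_gt ui).
by rewrite /is_expression -cats1 big_cat big_seq1 -sE; exact/esym/mulg_simpleK.
Qed.

Lemma cox_lengthE (u : Sigma) : cox_length u = inv_num u.
Proof.
have H : is_length u (inv_num u).
  have [s sE sk] := inv_num_expr_ex u.
  by split; [exists s|move=> s' ->; exact: inv_num_expr].
rewrite /cox_length; case: xgetP => [k _ [[s sE <-] kmin]|/(_ (inv_num u))//].
case: H => [[t tE <-] tmin]; apply/eqP.
by rewrite eqn_leq tmin // kmin.
Qed.

(** Replaces the comparison of Coxeter lengths by one of two values, the form in which the Hecke
    product is used below. *)
Lemma hecke_simpleE (u : Sigma) i :
  hecke_simple u i = if u i < u (i + 1) then (u * simple i)%g else u.
Proof.
rewrite /hecke_simple !cox_lengthE; have [h|h] := sigma_cmp u i.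
  by rewrite inv_num_simple // ltnSn h.
by rewrite {1}(inv_num_simple_gt h) ltnNge leqnSn ltNge ltW.
Qed.

Lemma hecke_idem u i : hecke_simple (hecke_simple u i) i = hecke_simple u i.
Proof.
rewrite (hecke_simpleE u); case: ifP => h; rewrite hecke_simpleE ?h //.
by rewrite !sigmaM simpleL simpleR ltNge ltW.
Qed.

Lemma simple_comm i j : (`|i - j| >= 2)%N -> (simple i * simple j = simple j * simple i)%g.
Proof.
move=> ij; apply: sigma_eqP => x; rewrite !sigmaM.
by case: (simpleP j x) => *; case: (simpleP i x) => *;
repeat match goal with |- context [sigma_fun (simple ?a) ?b] =>
  case: (simpleP a b) => * end; lia.
Qed.

Lemma hecke_comm u i j : (`|i - j| >= 2)%N ->
  hecke_simple (hecke_simple u i) j = hecke_simple (hecke_simple u j) i.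
Proof.
move=> ij; rewrite !hecke_simpleE.
have E k l : (`|k - l| >= 2)%N -> ((u * simple k)%g l = u l) /\ ((u * simple k)%g (l + 1) = u (l + 1)).
  by move=> kl; rewrite !sigmaM !simpleD //; lia.
have [e1 e2] := E i j ij; have [e3 e4] := E j i ltac:(lia).
case hi: (u i < u (i + 1)); case hj: (u j < u (j + 1));
  rewrite ?e1 ?e2 ?e3 ?e4 ?hi ?hj //.
by rewrite -!mulgA (simple_comm ij).
Qed.

Lemma simple_triple i :
  [/\ simple i i = i + 1, simple i (i + 1) = i & simple i (i + 1 + 1) = i + 1 + 1] *
  [/\ simple (i + 1) i = i, simple (i + 1) (i + 1) = i + 1 + 1
    & simple (i + 1) (i + 1 + 1) = i + 1].
Proof. by rewrite !simpleL !simpleR !simpleD //; lia. Qed.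

Lemma simple_braid i :
  (simple i * simple (i + 1) * simple i = simple (i + 1) * simple i * simple (i + 1))%g.
Proof.
have [[si0 si1 si2] [sj0 sj1 sj2]] := simple_triple i.
apply: sigma_eqP => x; rewrite !sigmaM.
have [->|/eqP h0] := eqVneq x i; first by rewrite !(si0, si1, si2, sj0, sj1, sj2).
have [->|/eqP h1] := eqVneq x (i + 1); first by rewrite !(si0, si1, si2, sj0, sj1, sj2).
have [->|/eqP h2] := eqVneq x (i + 1 + 1); first by rewrite !(si0, si1, si2, sj0, sj1, sj2).
by rewrite !(simpleD h0 h1, simpleD h1 h2).
Qed.

(** Both sides depend only on the relative order of the values at [i], [i + 1] and [i + 2]; when
    these increase, it is the braid relation of the group. *)
Lemma hecke_braid u i :
  hecke_simple (hecke_simple (hecke_simple u i) (i + 1)) i =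
  hecke_simple (hecke_simple (hecke_simple u (i + 1)) i) (i + 1).
Proof.
have [[si0 si1 si2] [sj0 sj1 sj2]] := simple_triple i.
have B := simple_braid i.
have sE := (sigmaM, si0, si1, si2, sj0, sj1, sj2).
rewrite !hecke_simpleE.
have [h1|h1] := sigma_cmp u i; have [h2|h2] := sigma_cmp u (i + 1);
have [h3|h3] : u i < u (i + 1 + 1) \/ u (i + 1 + 1) < u i
  by [have [|//|/sigma_inj] := ltgtP (u i) (u (i + 1 + 1)); [left|right|lia]];
  try lia;
  have lt := (h1, h2, h3, lt_gtF h1, lt_gtF h2, lt_gtF h3).
all: rewrite !(sE, lt) //.
by rewrite -!mulgA; congr (_ * _)%g; rewrite !mulgA.
Qed.

(** * The 0-Hecke relations *)

Section NcRing.

Variable R : nzRingType.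

(** Makes the tactic for noncommutative rings available on [nzRingType]; it finishes the expansion
    in [dfac_yang_baxter]. *)
Definition nc_ring_ops : @Ncring.Ring_ops R 0 1 +%R *%R (fun x y => x - y) -%R eq :=
  @Ncring.Build_Ring_ops _ _ _ _ _ _ _ _.

Lemma nc_ring : @Ncring.Ring R _ _ _ _ _ _ _ nc_ring_ops.
Proof.
constructor.
- exact: RelationClasses.eq_equivalence.
- by move=> ? ? -> ? ? ->.
- by move=> ? ? -> ? ? ->.
- by move=> ? ? -> ? ? ->.
- by move=> ? ? ->.
- exact: add0r.
- exact: addrC.
- exact: addrA.
- exact: mul1r.
- exact: mulr1.
- exact: mulrA.
- exact: mulrDl.
- by move=> x y z; exact: mulrDr.
- by [].
- exact: subrr.
Qed.

End NcRing.

#[local] Existing Instance nc_ring_ops.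
#[local] Existing Instance nc_ring.

Ltac ncring :=
  match goal with |- @eq ?T ?x ?y => change (@Algebra_syntax.equality T eq x y) end;
  Ncring_tac.non_commutative_ring.

Section ZeroHecke.

Variables (R : nzRingType) (u : nat -> R).

Definition zero_hecke : Prop :=
  [/\ forall i, u i * u i = u i,
      forall i, u i * u i.+1 * u i = u i.+1 * u i * u i.+1
    & forall i j, (i.+2 <= j)%N -> u i * u j = u j * u i].

Definition central (x : R) : Prop := forall y, GRing.comm x y.

Lemma centralM x y : central x -> central y -> central (x * y).
Proof. by move=> cx cy z; apply/commr_sym/commrM; apply/commr_sym. Qed.

Definition dfac (x : R) (a : nat) : R := 1 + x * u a.

(** The product [D_a(x)] in the letters [a <= j < b], the largest on the left. *)
Definition dprod (a b : nat) (x : R) : R :=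
  \prod_(j <- rev (iota a (b - a))) dfac x j.

Lemma dprod_nil a b x : (b <= a)%N -> dprod a b x = 1.
Proof. by rewrite /dprod => /eqP ->; rewrite big_nil. Qed.

Lemma dprod_bot a b x : (a < b)%N -> dprod a b x = dprod a.+1 b x * dfac x a.
Proof.
move=> ab; rewrite /dprod (_ : b - a = (b - a.+1).+1)%N; last by lia.
by rewrite /= rev_cons -cats1 big_cat big_seq1.
Qed.

Hypothesis uH : zero_hecke.

Let uu i : u i * u i = u i. Proof. by case: uH. Qed.
Let ubraid i : u i * u i.+1 * u i = u i.+1 * u i * u i.+1. Proof. by case: uH. Qed.
Let ufar i j : (i.+2 <= j)%N -> GRing.comm (u i) (u j). Proof. by case: uH => _ _; apply. Qed.

Lemma dprod_comm_gen a b x z : central x ->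
  (forall j, (a <= j < b)%N -> GRing.comm z (u j)) -> GRing.comm z (dprod a b x).
Proof.
move=> cx zu; rewrite /dprod big_seq; apply: (big_ind (GRing.comm z)).
- exact: commr1.
- by move=> ? ?; exact: commrM.
move=> j; rewrite mem_rev mem_iota => jab; apply: commrD; first exact: commr1.
by apply: commrM; [exact/commr_sym/cx|apply: zu; lia].
Qed.

Lemma dprod_ucomm a b x t : central x -> (t.+2 <= a)%N ->
  GRing.comm (u t) (dprod a b x).
Proof. by move=> cx ta; apply: dprod_comm_gen => // j jab; apply: ufar; lia. Qed.

Lemma central_swap x a b y : central y -> x * a * (y * b) = x * y * (a * b).
Proof. by move=> cy; rewrite -!mulrA [a * _]mulrA -[a * y]cy -!mulrA. Qed.

Lemma dfacM x y a : central y ->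
  dfac x a * dfac y a = 1 + (x + y + x * y) * u a.
Proof.
move=> cy; rewrite /dfac mulrDl mul1r mulrDr mulr1 central_swap // uu !mulrDl.
by rewrite -!addrA; congr (1 + _); rewrite addrCA.
Qed.

Lemma dfac_absorb x a : central x -> dfac x a * u a = (1 + x) * u a.
Proof. by move=> cx; rewrite /dfac mulrDl mul1r -mulrA uu mulrDl mul1r. Qed.

(* Conjugating by [1 + y u_(a+1)] gives a factor symmetric in [x] and [y]. *)
Lemma dfac_yang_baxter x y a : central x -> central y ->
  dfac x a * dfac y a.+1 * dfac y a =
  dfac y a.+1 * (1 + (x + y + x * y) * u a + x * y * (u a * u a.+1 - u a.+1 * u a)).
Proof.
move=> cx cy; rewrite /dfac.
have [] := And3 (uu a) (uu a.+1) (ubraid a).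
set A := u a; set B := u a.+1 => AA BB AB.
have xA z : z * A * x = z * x * A by rewrite -!mulrA cx.
have xB z : z * B * x = z * x * B by rewrite -!mulrA cx.
have yA z : z * A * y = z * y * A by rewrite -!mulrA cy.
have yB z : z * B * y = z * y * B by rewrite -!mulrA cy.
have yx z : z * y * x = z * x * y by rewrite -!mulrA cx.
have zAA z : z * A * A = z * A by rewrite -!mulrA AA.
have zBB z : z * B * B = z * B by rewrite -!mulrA BB.
have zAB z : z * B * A * B = z * A * B * A by rewrite -!mulrA [B * (_ * _)]mulrA -AB !mulrA.
have yx' : y * x = x * y by rewrite cx.
rewrite !(mulrDl, mulrDr, mul1r, mulr1, mulrBl, mulrBr, mulrA, mulrN, mulNr).
rewrite !(xA, xB, yA, yB, yx, yx', zAA, zBB, zAB).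
by ncring.
Qed.

(** Induction on the number of letters. The factor [1 + x u_a] commutes with the letters from
    [a + 2] on, so of the second product it meets only [1 + y u_(a+1)] and [1 + y u_a]. The
    Yang-Baxter identity then splits off an expression symmetric in the two variables, and the
    products starting at [a + 1] remain. *)
Lemma dprod_comm a b x y : central x -> central y ->
  dprod a b x * dprod a b y = dprod a b y * dprod a b x.
Proof.
move=> cx cy; have cyx : y * x = x * y by rewrite cx.
elim: {b}(b - a)%N {-2}a {-2}b (erefl (b - a)%N) => [|k IH] {}a b abk.
  by rewrite !dprod_nil //; lia.
have ab : (a < b)%N by lia.
have [ab1|ab1] := ltnP a.+1 b; last first.
  rewrite !(dprod_bot _ ab) !(@dprod_nil a.+1) // !mul1r !dfacM //.
  by rewrite cyx [y + x]addrC.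
have E z t : central z -> central t -> dprod a b z * dprod a b t =
    dprod a.+1 b z * dprod a.+1 b t *
    (1 + (z + t + z * t) * u a + z * t * (u a * u a.+1 - u a.+1 * u a)).
  move=> cz ct; rewrite !(dprod_bot _ ab) (dprod_bot t ab1) -!mulrA; congr (_ * _).
  rewrite [dfac z a * _]mulrA.
  have -> : dfac z a * dprod a.+2 b t = dprod a.+2 b t * dfac z a.
    apply: dprod_comm_gen => // j jab; apply/commr_sym/commrD; first exact: commr1.
    by apply: commrM; [exact/commr_sym/cz|apply/commr_sym/ufar; lia].
  by rewrite -!mulrA; congr (_ * _); rewrite !mulrA dfac_yang_baxter.
by rewrite !E // IH ?cyx ?[y + x]addrC //; lia.
Qed.

Lemma dprod_absorb t b x : central x -> (t < b)%N ->
  dprod t b x * u t = (1 + x) * (dprod t.+1 b x * u t).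
Proof.
move=> cx tb; rewrite dprod_bot // -mulrA dfac_absorb // !mulrA; congr (_ * _).
by rewrite mulrDr mulr1 mulrDl mul1r cx.
Qed.

(* Rows [i] and [i+1] of a first violation at the letter [t]: [h] is the part of
   row [i] below [t], and [t - 1] does not occur in [h]. *)
Lemma dprod_violation t b x y h h' : central x -> central y -> (t < b)%N ->
  GRing.comm h (u t) -> GRing.comm h (dprod t.+1 b y) ->
  (1 + y) * (dprod t.+1 b x * dfac x t * h * (dprod t.+1 b y * u t * h')) =
  dprod t b x * dprod t b y * (u t * h * h').
Proof.
move=> cx cy tb hu hd; rewrite -(dprod_bot x tb).
have -> : dprod t b x * h * (dprod t.+1 b y * u t * h') =
    dprod t b x * (dprod t.+1 b y * u t) * (h * h').
  by rewrite -!mulrA; congr (_ * _); rewrite !mulrA hd -(mulrA _ h) hu !mulrA.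
have c1y : central (1 + y).
  by move=> z; apply/commr_sym/commrD; [exact: commr1|exact/commr_sym/cy].
have -> : dprod t b x * dprod t b y * (u t * h * h') =
    dprod t b x * (dprod t b y * u t) * (h * h') by rewrite !mulrA.
by rewrite dprod_absorb // !mulrA (c1y (dprod t b x)).
Qed.

End ZeroHecke.

(** * Alternants *)

Section Alternant.

Variables (n : nat) (R : nzRingType).
Implicit Types f g : {mpoly R[n]}.

Definition alternate f : {mpoly R[n]} := \sum_(s : 'S_n) (-1) ^+ s * msym s f.

Lemma alternate_sum (I : Type) (r : seq I) (P : pred I) (F : I -> {mpoly R[n]}) :
  alternate (\sum_(i <- r | P i) F i) = \sum_(i <- r | P i) alternate (F i).
Proof.
rewrite /alternate exchange_big /=; apply: eq_bigr => s _.
by rewrite raddf_sum mulr_sumr.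
Qed.

Lemma alternateD f g : alternate (f + g) = alternate f + alternate g.
Proof.
rewrite /alternate -big_split; apply: eq_bigr => s _ /=.
by rewrite raddfD mulrDr.
Qed.

Lemma alternateM f g : (forall s, msym s g = g) -> alternate (f * g) = alternate f * g.
Proof.
move=> gs; rewrite /alternate mulr_suml; apply: eq_bigr => s _.
by rewrite msymM gs mulrA.
Qed.

(** Each [s] is paired with its product by the transposition and the two terms cancel; antisymmetry
    alone would only show that twice the sum vanishes. *)
Lemma alternate_eq0 f (i j : 'I_n) : i != j -> msym (perm.tperm i j) f = f ->
  alternate f = 0.
Proof.
move=> ij fs; rewrite /alternate (bigID (fun s : 'S_n => s : bool)) /=.
apply/eqP; rewrite addrC addr_eq0 -sumrN; apply/eqP.
rewrite [RHS](reindex_inj (mulgI (perm.tperm i j))) /=.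
apply: eq_big => [s|s ns]; rewrite perm.odd_permM perm.odd_tperm ij //=.
by rewrite (negPf ns) /= msymMm fs expr1 expr0 mulN1r mul1r opprK.
Qed.

Lemma msym_X s (i : 'I_n) : msym s ('X_i : {mpoly R[n]}) = 'X_(s i).
Proof.
rewrite msymX; congr mpolyX; apply/mnmP => k; rewrite !mnmE.
by congr nat_of_bool; apply/eqP/eqP => [->|<-]; rewrite (perm.permKV, perm.permK).
Qed.

Lemma msym_const s (c : R) : msym s (c%:MP : {mpoly R[n]}) = c%:MP.
Proof. by rewrite /msym mmapC. Qed.

Lemma central_X (i : 'I_n) : central ('X_i : {mpoly R[n]}).
Proof. by move=> y; apply/commr_sym/commr_mpolyX. Qed.

Definition gen_mon (a b : 'I_n -> nat) : {mpoly R[n]} :=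
  \prod_i ('X_i ^+ a i * (1 + 'X_i) ^+ b i).

(* The numerators [alternate (shape_mon f)] are those of the bialternant formula
   for Grothendieck polynomials. *)
Definition shape_mon (f : 'I_n -> nat) : {mpoly R[n]} :=
  gen_mon (fun i => n - i.+1 + f i)%N (fun i => i).

End Alternant.

Arguments gen_mon {n R}.
Arguments shape_mon {n R}.

Lemma central_prod (R : nzRingType) (I : Type) (r : seq I) (P : pred I) (F : I -> R) :
  (forall i, central (F i)) -> central (\prod_(i <- r | P i) F i).
Proof.
move=> cF; apply: (big_ind (@central R)) => //; last by move=> *; exact: centralM.
by move=> y; apply/commr_sym/commr1.
Qed.

Lemma prod_centralM (R : nzRingType) (I : Type) (r : seq I) (F G : I -> R) :
  (forall i, central (F i)) ->
  \prod_(i <- r) (F i * G i) = \prod_(i <- r) F i * \prod_(i <- r) G i.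
Proof.
move=> cF; elim: r => [|i r IH]; first by rewrite !big_nil mulr1.
rewrite !big_cons IH -!mulrA; congr (_ * _); rewrite !mulrA; congr (_ * _).
by apply/esym/central_prod.
Qed.

Lemma central_exp (R : nzRingType) (x : R) k : central x -> central (x ^+ k).
Proof. by move=> cx y; apply/commr_sym/commrX/commr_sym. Qed.

Lemma central_1D (R : nzRingType) (x : R) : central x -> central (1 + x).
Proof. by move=> cx y; apply/commr_sym/commrD; [exact: commr1|exact/commr_sym/cx]. Qed.

Lemma prod_comm_perm (R : nzRingType) (I : eqType) (r1 r2 : seq I) (F : I -> R) :
  (forall i j, GRing.comm (F i) (F j)) -> perm_eq r1 r2 ->
  \prod_(i <- r1) F i = \prod_(i <- r2) F i.
Proof.
move=> cF; elim: r1 r2 => [|i r1 IH] r2.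
  by rewrite perm_sym => /perm_nilP ->; rewrite !big_nil.
move=> p12; have ir2 : i \in r2 by rewrite -(perm_mem p12) mem_head.
have [s1 [s2 r2E]] : exists s1 s2, r2 = s1 ++ i :: s2 by case/splitPr: ir2 => a b; exists a, b.
rewrite r2E big_cons big_cat big_cons (IH (s1 ++ s2)); last first.
  by rewrite -(perm_cons i) (perm_trans p12) // r2E -cat1s perm_catCA.
rewrite big_cat /= !mulrA; congr (_ * _).
apply: (big_ind (GRing.comm (F i))); [exact: commr1| |by move=> j _; exact: cF].
by move=> ? ?; exact: commrM.
Qed.

(** Isolates the factors of two adjacent rows in a product whose factors need not commute. *)
Lemma ord_enum_split n (i j : 'I_n) : j = i.+1 :> nat ->
  exists s1 s2, [/\ index_enum 'I_n = s1 ++ i :: j :: s2,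
    forall k, k \in s1 -> (k != i) && (k != j) & forall k, k \in s2 -> (k != i) && (k != j)].
Proof.
move=> ji; have iE : index_enum 'I_n = enum 'I_n by rewrite enumT /index_enum.
have nthE (k : 'I_n) : nth i (enum 'I_n) k = k by rewrite nth_ord_enum.
have E : enum 'I_n = take i (enum 'I_n) ++ i :: j :: drop i.+2 (enum 'I_n).
  rewrite -{1}(cat_take_drop i (enum 'I_n)); congr (_ ++ _).
  rewrite (drop_nth i) ?size_enum_ord // nthE; congr (_ :: _).
  by rewrite (drop_nth i) ?size_enum_ord -?ji // nthE.
exists (take i (enum 'I_n)), (drop i.+2 (enum 'I_n)); split; first by rewrite iE.
  move=> k kt; have := enum_uniq 'I_n; rewrite E cat_uniq /= => /and3P[_ /norP[h1 /norP[h2 _]] _].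
  by rewrite !(contraTneq _ kt) // => ->.
move=> k kt; have := enum_uniq 'I_n; rewrite E cat_uniq /=.
move=> /and3P[_ _ /and3P[]]; rewrite !inE negb_or => /andP[_ h1] h2 _.
by rewrite !(contraTneq _ kt) // => ->.
Qed.

Section GenMon.
Variables (n : nat) (R : nzRingType).

Lemma msym_gen_mon s a b : msym s (gen_mon a b : {mpoly R[n]}) =
  gen_mon (fun i => a (s^-1 i)%g) (fun i => b (s^-1 i)%g).
Proof.
rewrite /gen_mon rmorph_prod /=.
under eq_bigr do rewrite rmorphM !rmorphXn /= rmorphD rmorph1 /= msym_X.
pose F i : {mpoly R[n]} := 'X_i ^+ a (s^-1 i)%g * (1 + 'X_i) ^+ b (s^-1 i)%g.
rewrite (eq_bigr (fun i => F (s i))) => [|i _]; last by rewrite /F perm.permK.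
rewrite -(big_map s xpredT F); apply: prod_comm_perm => [i j|].
  by apply: centralM; apply: central_exp; [exact: central_X|exact/central_1D/central_X].
apply: uniq_perm; rewrite ?index_enum_uniq //.
  by rewrite map_inj_uniq ?index_enum_uniq //; exact: perm.perm_inj.
move=> k; rewrite mem_index_enum; apply/mapP; exists (s^-1 k)%g; rewrite ?mem_index_enum //.
by rewrite perm.permKV.
Qed.

Lemma gen_mon_swap a b (i j : 'I_n) : a i = a j -> b i = b j ->
  msym (perm.tperm i j) (gen_mon a b : {mpoly R[n]}) = gen_mon a b.
Proof.
move=> aij bij; rewrite msym_gen_mon perm.tpermV; apply: eq_bigr => k _.
by case: perm.tpermP => [->|->|//]; rewrite ?aij ?bij.
Qed.

Lemma gen_monM a b a' b' : (gen_mon a b * gen_mon a' b' : {mpoly R[n]}) =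
  gen_mon (fun i => a i + a' i)%N (fun i => b i + b' i)%N.
Proof.
rewrite /gen_mon -prod_centralM => [|i].
  apply: eq_bigr => i _; rewrite !exprD -!mulrA; congr (_ * _).
  by rewrite !mulrA -(central_exp _ (central_X _)).
by apply: centralM; apply: central_exp; [exact: central_X|exact/central_1D/central_X].
Qed.

Lemma gen_mon_exp a b (j : 'I_n) : gen_mon a b * 'X_j =
  gen_mon (fun i => a i + (i == j))%N b :> {mpoly R[n]}.
Proof.
have -> : ('X_j : {mpoly R[n]}) = gen_mon (fun i => (i == j) : nat) (fun=> 0%N).
  rewrite /gen_mon -[RHS](@big_rmcond _ _ _ _ _ (pred1 j)) => [|i /negPf /= ->]; last by rewrite mulr1.
  by rewrite big_pred1_eq /= eqxx mulr1.
by rewrite gen_monM; apply: eq_bigr => i _; rewrite addn0.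
Qed.

Lemma gen_mon_exp1 a b (j : 'I_n) : gen_mon a b * (1 + 'X_j) =
  gen_mon a (fun i => b i + (i == j))%N :> {mpoly R[n]}.
Proof.
have -> : (1 + 'X_j : {mpoly R[n]}) = gen_mon (fun=> 0%N) (fun i => (i == j) : nat).
  rewrite /gen_mon -[RHS](@big_rmcond _ _ _ _ _ (pred1 j)) => [|i /negPf /= ->]; last by rewrite mulr1.
  by rewrite big_pred1_eq /= eqxx mul1r.
by rewrite gen_monM; apply: eq_bigr => i _; rewrite addn0.
Qed.
End GenMon.

(** * Fillings as paths of shapes *)

Section Paths.

Variables (n : nat) (la : 'I_n -> nat).

(** The rows that receive one given letter; as rows are strictly increasing, a letter occurs at most
    once in each. *)
Definition step : Type := {ffun 'I_n -> bool}.
Implicit Types (e : step) (p : seq step).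

(* A path lists the rows receiving the letter [t], for [t] decreasing to 0. *)
Definition path_shape p (i : 'I_n) : nat := (la i + count (fun e : step => e i) p)%N.

(** The lengths are those before the step: a box added to row [i] in the same step has the same
    letter and does not support row [j]. A step without violation thus preserves partitions and
    keeps the columns strict. *)
Definition violation p e (i : 'I_n) : bool :=
  [exists j : 'I_n, [&& j == i.+1 :> nat, e j & (path_shape p i <= path_shape p j)%N]].

Definition path_ok p e : bool := ~~ [exists i, violation p e i].

Fixpoint good_path p : bool :=
  if p is e :: p' then path_ok p' e && good_path p' else true.

Fixpoint paths (t : nat) : seq (seq step) :=
  if t is t'.+1 then [seq e :: p | p <- paths t', e <- [seq e <- enum {: step} | path_ok p e]]
  else [:: [::]].

Fixpoint row_letters (i : 'I_n) p : seq nat :=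
  if p is e :: p' then
    if e i then size p' :: row_letters i p' else row_letters i p'
  else [::].

Lemma mem_paths t p : (p \in paths t) = (size p == t) && good_path p.
Proof.
elim: t p => [|t IH] p /=; first by case: p.
apply/allpairsPdep/idP => [[q [e [qt]]]|].
  by rewrite mem_filter IH in qt * => /andP[ok _] -> /=; case/andP: qt => /eqP-> ->; rewrite eqxx ok.
case: p => [|e p] //=; rewrite eqSS => /andP[pt /andP[ok gp]].
by exists p, e; rewrite IH pt gp mem_filter ok mem_enum.
Qed.

Lemma uniq_paths t : uniq (paths t).
Proof.
elim: t => //= t IH; apply: allpairs_uniq_dep => // [p _|[p e] [q f] _ _ [-> ->]//].
exact/filter_uniq/enum_uniq.
Qed.

Lemma row_letters_lt i p : all (fun j => (j < size p)%N) (row_letters i p).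
Proof.
elim: p => //= e p IH; have IH' : all (fun j => (j < (size p).+1)%N) (row_letters i p).
  by apply: sub_all IH => j /ltnW.
by case: (e i) => //=; rewrite ltnSn.
Qed.

Lemma path_shape_cons e p i : path_shape (e :: p) i = (path_shape p i + e i)%N.
Proof. by rewrite /path_shape /= [(e i + _)%N]addnC addnA. Qed.

Hypothesis la_dec : forall i j : 'I_n, j = i.+1 :> nat -> (la j <= la i)%N.

Lemma path_okP p e (i j : 'I_n) : path_ok p e -> j = i.+1 :> nat -> e j ->
  (path_shape p j < path_shape p i)%N.
Proof.
move=> /existsPn/(_ i)/existsPn/(_ j) + ji ej.
by rewrite ji eqxx ej /= -ltnNge.
Qed.

Lemma path_shape_dec p (i j : 'I_n) : good_path p -> j = i.+1 :> nat ->
  (path_shape p j <= path_shape p i)%N.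
Proof.
move=> + ji; elim: p => [_|e p IH /= /andP[ok /IH]].
  by rewrite /path_shape !addn0 la_dec.
rewrite !path_shape_cons; case ej: (e j); last by lia.
by have := path_okP ok ji ej; lia.
Qed.

(** If the last step had added a box to row [i], then before it row [j] was either equally long and
    grew too, a violation, or longer than row [i]. So the last letter is missing from row [i], and
    the letters that remain there commute with the next one. *)
Lemma violation_letters p (i j : 'I_n) : good_path p -> j = i.+1 :> nat ->
  path_shape p i = path_shape p j ->
  all (fun k => (k.+1 < size p)%N) (row_letters i p).
Proof.
case: p => [|e p] //= /andP[ok gp] ji; rewrite !path_shape_cons.
have := path_shape_dec gp ji; have := path_okP ok ji.
case ei: (e i); last by move=> _ _ _; apply: sub_all (row_letters_lt i p) => k; lia.
by case: (e j) => [/(_ isT)|_]; lia.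
Qed.

End Paths.

Section Core.

Variables (H : nzRingType) (u : nat -> H) (uH : zero_hecke u) (n N : nat).
Variable la : 'I_n -> nat.
Hypothesis la_dec : forall i j : 'I_n, j = i.+1 :> nat -> (la j <= la i)%N.

Local Notation Q := {mpoly H[n]}.
Local Notation U := (fun j => (u j)%:MP_[n] : Q).
Local Notation step := (step n).
Implicit Types (p : seq step) (e : step).

Lemma zero_hecke_mpoly : zero_hecke U.
Proof.
case: uH => h1 h2 h3; split => *; rewrite -!mpolyCM; congr (_%:MP); auto.
Qed.

Definition row_letter_prod (i : 'I_n) p : H := \prod_(j <- row_letters i p) u j.

(** Contribution of all fillings that begin with [p]: the letters below [t] are those of [p], while
    the letters from [t] to [N - 1] are still free in every row. It interpolates between the two
    sides of [cauchy_paths]. *)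
Definition path_term t p : Q :=
  shape_mon (path_shape la p) *
  \prod_i (dprod U t N 'X_i * (row_letter_prod i p)%:MP).

Definition step_term t p e : Q :=
  shape_mon (path_shape la p) *
  \prod_i (dprod U t.+1 N 'X_i * (if e i then 'X_i * U t else 1) * (row_letter_prod i p)%:MP).

Lemma msym_dprod s a b x : msym s (dprod U a b x) = dprod U a b (msym s x).
Proof.
rewrite /dprod rmorph_prod /=; apply: eq_bigr => j _.
by rewrite /dfac rmorphD rmorph1 rmorphM /= msym_const.
Qed.

Lemma path_term_expand t p : (t < N)%N -> path_term t p = \sum_e step_term t p e.
Proof.
move=> tN; rewrite /path_term /step_term -mulr_sumr; congr (_ * _).
pose F (i : 'I_n) (b : bool) : Q :=
  dprod U t.+1 N 'X_i * (if b then 'X_i * U t else 1) * (row_letter_prod i p)%:MP.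
rewrite -(bigA_distr_bigA F); apply: eq_bigr => i _.
rewrite (dprod_bot _ _ tN) /F /dfac big_bool /= mulr1 mulrDr mulr1 mulrDl.
by rewrite addrC.
Qed.

Lemma step_termE t p e : size p = t -> step_term t p e = path_term t.+1 (e :: p).
Proof.
move=> pt; rewrite /step_term /path_term.
pose c (i : 'I_n) : Q := 'X_i ^+ e i.
have cc i : central (c i) by exact/central_exp/central_X.
rewrite (eq_bigr (fun i => c i * (dprod U t.+1 N 'X_i * (row_letter_prod i (e :: p))%:MP))); last first.
  move=> i _; rewrite /c /row_letter_prod /=; case: (e i) => /=; last by rewrite mulr1 expr0 mul1r.
  by rewrite big_cons pt mpolyCM expr1 !mulrA -central_X.
rewrite (prod_centralM _ _ cc) mulrA; congr (_ * _).
have -> : \prod_i c i = gen_mon (fun i => e i : nat) (fun=> 0%N).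
  by rewrite /gen_mon; apply: eq_bigr => i _; rewrite expr0 mulr1.
rewrite gen_monM; apply: eq_bigr => i _.
by rewrite addn0 path_shape_cons addnA.
Qed.

Definition last_violation p e i : bool :=
  violation la p e i && [forall k : 'I_n, (i < k)%N ==> ~~ violation la p e k].

Lemma last_violationP p e : ~~ path_ok la p e ->
  exists i, last_violation p e =1 pred1 i.
Proof.
rewrite negbK => /existsP[i0 i0v].
case: (arg_maxnP (P := violation la p e) (fun i => i : nat) i0v) => i iv imax.
exists i => k; apply/idP/eqP => [/andP[kv /forallP kmax]|->].
  apply/val_inj/eqP; rewrite eqn_leq (imax k kv : (k <= i)%N) /= leqNgt.
  by apply: contraL iv => ik; have := kmax i; rewrite ik.
rewrite /last_violation iv; apply/forallP => l; apply/implyP => il.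
by apply: contraL il => lv; rewrite -leqNgt; exact: imax.
Qed.

Definition toggle (i : 'I_n) e : step := [ffun k => if k == i then ~~ e k else e k].

Lemma toggleK i : involutive (toggle i).
Proof. by move=> e; apply/ffunP => k; rewrite !ffunE; case: eqP; rewrite ?negbK. Qed.

(** A violation at [k] involves [e] only in row [k + 1], so toggling row [i] can create or destroy
    one only at [i - 1]. This is why the lowest violation is singled out. *)
Lemma violation_toggle p e (i k : 'I_n) : (i <= k)%N ->
  violation la p (toggle i e) k = violation la p e k.
Proof.
move=> ik; apply: eq_existsb => j; case: eqP => //= jk.
by rewrite ffunE (_ : (j == i) = false) //; apply/eqP => ji; move: jk; rewrite ji; lia.
Qed.

Lemma last_violation_toggle p e i : last_violation p (toggle i e) i = last_violation p e i.
Proof.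
rewrite /last_violation violation_toggle //; congr (_ && _).
apply: eq_forallb => k; case: ltnP => //= /ltnW ik.
by rewrite violation_toggle.
Qed.

Lemma row_letter_prod_commute t p i (x : Q) : size p = t ->
  all (fun k => (k.+1 < size p)%N) (row_letters i p) ->
  (forall k, (k.+1 < t)%N -> GRing.comm (U k) x) -> GRing.comm (row_letter_prod i p)%:MP x.
Proof.
move=> pt /allP pl xU; rewrite /row_letter_prod big_seq.
have : all (fun k => (k.+1 < t)%N) (row_letters i p) by apply/allP => k /pl; rewrite pt.
rewrite -big_seq; elim: (row_letters i p) => [_|k s IH /= /andP[kt /IH IHs]].
  by rewrite big_nil mpolyC1; exact/commr_sym/commr1.
by rewrite big_cons mpolyCM; apply/commr_sym/commrM; apply/commr_sym; [exact: xU|].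
Qed.

(** The two choices for row [i] add up to the missing factor [1 + x_i u_t], which restores the full
    product [D_t(x_i)] in that row. *)
Lemma violation_pair t p e (i j : 'I_n) : (t < N)%N -> size p = t ->
  good_path la p -> j = i.+1 :> nat -> e i = false -> e j ->
  path_shape la p i = path_shape la p j ->
  let T := step_term t p e + step_term t p (toggle i e) in
  msym (perm.tperm i j) T = T.
Proof.
move=> tN pt gp ji ei ej sij /=.
have [s1 [s2 [sE s1P s2P]]] := ord_enum_split ji.
have ij : (j == i) = false by apply/eqP => ij; move: ji; rewrite ij; lia.
have pl := violation_letters la_dec gp ji sij.
have UH := zero_hecke_mpoly.
pose G e' (k : 'I_n) : Q :=
  dprod U t.+1 N 'X_k * (if e' k then 'X_k * U t else 1) * (row_letter_prod k p)%:MP.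
pose L := \prod_(k <- s1) G e k; pose M := \prod_(k <- s2) G e k.
(* This is [shape_mon] times ['X_j], the weight of the new box, divided by [1 + 'X_j]. Its exponents
   in rows [i] and [j] agree, because the lengths of these rows do and [j = i + 1]. *)
pose c : Q := gen_mon (fun k => (n - k.+1 + path_shape la p k + (k == j))%N)
  (fun k => if k == j then j.-1 else k).
have cE : shape_mon (path_shape la p) * 'X_j = c * (1 + 'X_j).
  rewrite gen_mon_exp1 gen_mon_exp; apply: eq_bigr => k _; congr (_ * _ ^+ _).
  by case: eqP => [->|]; rewrite ?ji ?addn1 ?addn0.
have GE k : k != i -> G (toggle i e) k = G e k.
  by move=> /negPf ki; rewrite /G ffunE ki.
have E : step_term t p e + step_term t p (toggle i e) =
  c * L * (dprod U t N 'X_i * dprod U t N 'X_j * (U t * (row_letter_prod i p)%:MP * (row_letter_prod j p)%:MP)) * M.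
  have stE e' : step_term t p e' = shape_mon (path_shape la p) *
      (\prod_(k <- s1) G e' k * (G e' i * (G e' j * \prod_(k <- s2) G e' k))).
    by rewrite /step_term sE big_cat !big_cons.
  have -> : step_term t p e = shape_mon (path_shape la p) * (L * (G e i * (G e j * M))).
    exact: stE.
  rewrite stE (_ : \prod_(k <- s1) _ = L); last first.
    by apply: eq_big_seq => k /s1P/andP[ki _]; exact: GE.
  rewrite (_ : \prod_(k <- s2) _ = M); last first.
    by apply: eq_big_seq => k /s2P/andP[ki _]; exact: GE.
  rewrite (GE j) ?ij // -mulrDr -mulrDr -mulrDl.
  have -> : G e i + G (toggle i e) i = dprod U t.+1 N 'X_i * dfac U 'X_i t * (row_letter_prod i p)%:MP.
    by rewrite /G ffunE eqxx ei /= /dfac mulr1 mulrDr mulr1 mulrDl.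
  have -> : G e j = 'X_j * (dprod U t.+1 N 'X_j * U t * (row_letter_prod j p)%:MP).
    by rewrite /G ej !mulrA -[dprod _ _ _ _ * 'X_j]central_X.
  rewrite -(dprod_violation UH _ (central_X i) (central_X j) tN); last 2 first.
  - apply: row_letter_prod_commute pt pl _ => k kt.
    by case: UH => _ _; apply; rewrite ?pt in kt *; lia.
  - apply: row_letter_prod_commute pt pl _ => k kt.
    by apply: (dprod_ucomm UH); [exact: central_X|lia].
  set A := _ * dfac _ _ _ * _; set B := _ * (row_letter_prod j p)%:MP.
  have cX : central ('X_j : Q) by exact: central_X.
  have c1X := central_1D cX.
  rewrite !mulrA -[c * L * _]mulrA -[L * (1 + _)]c1X mulrA -cE.
  rewrite -[shape_mon _ * 'X_j * L]mulrA (cX L) !mulrA; congr (_ * _ * _).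
  by rewrite -!mulrA; congr (_ * (_ * _)); rewrite !mulrA -[_ * _ * _ * 'X_j]cX !mulrA.
rewrite E !rmorphM /= !msym_const !msym_dprod !msym_X perm.tpermL perm.tpermR.
have symS (s : seq 'I_n) : (forall k, k \in s -> (k != i) && (k != j)) ->
    msym (perm.tperm i j) (\prod_(k <- s) G e k) = \prod_(k <- s) G e k.
  move=> sP; rewrite rmorph_prod /=; apply: eq_big_seq => k /sP/andP[ki kj].
  rewrite /G !rmorphM /= msym_const msym_dprod msym_X perm.tpermD 1?eq_sym //.
  case: (e k); rewrite ?rmorph1 // rmorphM /= msym_const msym_X.
  by rewrite perm.tpermD 1?eq_sym.
rewrite (symS _ s1P) (symS _ s2P) -/L -/M gen_mon_swap; last 2 first.
- by have := ltn_ord j; rewrite sij (eq_sym i) ij eqxx ji; lia.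
- by rewrite (eq_sym i) ij eqxx ji.
by rewrite (dprod_comm UH t N (central_X j) (central_X i)).
Qed.

Lemma violations_cancel t p : (t < N)%N -> size p = t -> good_path la p ->
  alternate (\sum_(e | ~~ path_ok la p e) step_term t p e) = 0.
Proof.
move=> tN pt gp.
have -> : \sum_(e | ~~ path_ok la p e) step_term t p e =
    \sum_i \sum_(e | last_violation p e i) step_term t p e.
  rewrite [RHS](exchange_big_dep (fun e => ~~ path_ok la p e)) /=; last first.
    by move=> i e _ /andP[iv _]; rewrite negbK; apply/existsP; exists i.
  apply: eq_bigr => e /last_violationP[i ie].
  by rewrite (eq_bigl _ _ ie) big_pred1_eq.
rewrite alternate_sum big1 // => i _.
(* Toggling row [i] matches the steps that contain it with those that do not. *)
rewrite (bigID (fun e : step => e i)) /= (reindex_inj (inv_inj (toggleK i))) /=.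
rewrite [X in alternate (X + _)](eq_bigl (fun e => last_violation p e i && ~~ e i)); last first.
  by move=> e; rewrite last_violation_toggle ffunE eqxx.
rewrite -big_split /= alternate_sum big1 // => e /andP[/andP[/existsP[j]]].
case/and3P => /eqP ji ej sij _ ei; rewrite addrC.
apply: (@alternate_eq0 _ _ _ i j).
  by apply/eqP => ij; move: ji; rewrite -ij; lia.
apply: violation_pair => //; first exact: negbTE.
by apply/eqP; rewrite eqn_leq sij path_shape_dec.
Qed.

(** The left side does not depend on [t]: passing from [t] to [t + 1] expands every term over all
    steps and drops the violating ones, whose sum is killed by the alternation. *)
Lemma alternate_paths t : (t <= N)%N ->
  alternate (\sum_(p <- paths la t) path_term t p) =
  alternate (shape_mon la * \prod_i dprod U 0 N 'X_i).
Proof.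
elim: t => [_|t IH tN].
  rewrite big_seq1 /path_term; congr alternate; congr (_ * _).
    by apply: eq_bigr => i _; rewrite /path_shape addn0.
  by apply: eq_bigr => i _; rewrite /row_letter_prod big_nil mpolyC1 mulr1.
rewrite -IH ?(ltnW tN) //= big_allpairs_dep !alternate_sum.
apply: eq_big_seq => p; rewrite mem_paths => /andP[/eqP pt gp].
rewrite path_term_expand // [in RHS](bigID (path_ok la p)) /=.
rewrite alternateD violations_cancel // addr0.
rewrite big_filter big_enum_cond /=; congr alternate.
by apply: eq_bigr => e _; rewrite step_termE.
Qed.

Lemma dprod_symmetric s : msym s (\prod_i dprod U 0 N 'X_i) = \prod_i dprod U 0 N 'X_i.
Proof.
rewrite rmorph_prod /=; under eq_bigr do rewrite msym_dprod msym_X.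
rewrite -(big_map s xpredT (fun i => dprod U 0 N 'X_i)).
apply: prod_comm_perm => [i j|].
  by apply: (dprod_comm zero_hecke_mpoly); exact: central_X.
apply: uniq_perm; rewrite ?index_enum_uniq //.
  by rewrite map_inj_uniq ?index_enum_uniq //; exact: perm.perm_inj.
move=> k; rewrite mem_index_enum; apply/mapP; exists (s^-1 k)%g; rewrite ?mem_index_enum //.
by rewrite perm.permKV.
Qed.

(** At [t = N] no letter is free and the products [D] are empty. On the other side the product over
    the rows leaves the alternation, being symmetric because its factors commute. *)
Theorem cauchy_paths :
  alternate (shape_mon la) * \prod_i dprod U 0 N 'X_i =
  \sum_(p <- paths la N) alternate (shape_mon (path_shape la p)) *
    (\prod_i row_letter_prod i p)%:MP.
Proof.
rewrite -alternateM; last exact: dprod_symmetric.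
rewrite -(alternate_paths (leqnn N)) alternate_sum; apply: eq_bigr => p _.
rewrite -alternateM => [|s]; last exact: msym_const.
congr (alternate (_ * _)).
rewrite (big_morph (@mpolyC n H) (@mpolyCM n H) (mpolyC1 n H)).
by apply: eq_bigr => i _; rewrite dprod_nil // mul1r.
Qed.
End Core.

(** * Operators on functions of a permutation *)

(** Additive operators on functions of a permutation stand in for the 0-Hecke algebra; its relations
    then follow from those of [hecke_simple]. *)
Record endo := Endo {
  endo_fun :> (Sigma -> int) -> (Sigma -> int);
  endoB : {morph endo_fun : f g / f - g} }.

Lemma endo_eqP (f g : endo) : (forall phi v, f phi v = g phi v) -> f = g.
Proof.
case: f g => f fB [g gB] /= fg.
have E : f = g by apply/funext => phi; apply/funext => v; exact: fg.
by subst g; congr Endo; exact: Prop_irrelevance.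
Qed.

HB.instance Definition _ := gen_eqMixin endo.
HB.instance Definition _ := gen_choiceMixin endo.

Lemma endo0 (f : endo) : f 0 = 0.
Proof. by rewrite -[X in f X](subrr 0) endoB subrr. Qed.

Lemma endoN (f : endo) phi : f (- phi) = - f phi.
Proof. by rewrite -[- phi]add0r endoB endo0 add0r. Qed.

Lemma endoD (f : endo) phi psi : f (phi + psi) = f phi + f psi.
Proof. by rewrite -[psi in LHS]opprK endoB endoN opprK. Qed.

Lemma endo_zero_sub : {morph (fun _ : Sigma -> int => 0 : Sigma -> int) : f g / f - g}.
Proof. by move=> f g; rewrite subrr. Qed.
Definition endo_zero := Endo endo_zero_sub.

Lemma endo_opp_sub (f : endo) : {morph (fun phi => - f phi) : g h / g - h}.
Proof. by move=> g h; rewrite endoB opprB opprK addrC. Qed.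
Definition endo_opp f := Endo (endo_opp_sub f).

Lemma endo_add_sub (f g : endo) : {morph (fun phi => f phi + g phi) : h k / h - k}.
Proof. by move=> h k; rewrite !endoB opprD addrACA. Qed.
Definition endo_add f g := Endo (endo_add_sub f g).

Lemma endo_addA : associative endo_add.
Proof. by move=> f g h; apply: endo_eqP => phi v; rewrite /= addrA. Qed.
Lemma endo_addC : commutative endo_add.
Proof. by move=> f g; apply: endo_eqP => phi v; rewrite /= addrC. Qed.
Lemma endo_add0 : left_id endo_zero endo_add.
Proof. by move=> f; apply: endo_eqP => phi v; rewrite /= add0r. Qed.
Lemma endo_addN : left_inverse endo_zero endo_opp endo_add.
Proof. by move=> f; apply: endo_eqP => phi v; rewrite /= addNr. Qed.

HB.instance Definition _ := GRing.isZmodule.Build endo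
  endo_addA endo_addC endo_add0 endo_addN.

Lemma endo_one_sub : {morph (@id (Sigma -> int)) : f g / f - g}.
Proof. by []. Qed.
Definition endo_one := Endo endo_one_sub.

Lemma endo_mul_sub (f g : endo) : {morph (fun phi => f (g phi)) : h k / h - k}.
Proof. by move=> h k; rewrite !endoB. Qed.
Definition endo_mul f g := Endo (endo_mul_sub f g).

Lemma endo_mulA : associative endo_mul.
Proof. by move=> f g h; apply: endo_eqP. Qed.
Lemma endo_mul1 : left_id endo_one endo_mul.
Proof. by move=> f; apply: endo_eqP. Qed.
Lemma endo_mulr1 : right_id endo_one endo_mul.
Proof. by move=> f; apply: endo_eqP. Qed.
Lemma endo_mulDl : left_distributive endo_mul +%R.
Proof. by move=> f g h; apply: endo_eqP. Qed.
Lemma endo_mulDr : right_distributive endo_mul +%R.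
Proof. by move=> f g h; apply: endo_eqP => phi v /=; rewrite endoD. Qed.
Lemma endo_one_neq0 : endo_one != 0.
Proof.
by apply/eqP => /(congr1 (fun f : endo => f (fun=> 1) 1%g)).
Qed.

HB.instance Definition _ := GRing.Zmodule_isNzRing.Build endo
  endo_mulA endo_mul1 endo_mulr1 endo_mulDl endo_mulDr endo_one_neq0.

Lemma hecke_endo_sub (a : int) :
  {morph (fun (phi : Sigma -> int) v => phi (hecke_simple v a)) : f g / f - g}.
Proof. by []. Qed.
(** The letter acts on the argument, so a product of such operators evaluated at [v] multiplies [v]
    by the letters from left to right. *)
Definition hecke_endo (a : int) : endo := Endo (hecke_endo_sub a).

Lemma zero_hecke_endo (k : int) : zero_hecke (fun j : nat => hecke_endo (j%:Z + k)).
Proof.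
split=> [i|i|i j ij]; apply: endo_eqP => phi v /=; congr phi.
- exact: hecke_idem.
- have -> : i.+1%:Z + k = i%:Z + k + 1 by lia.
  exact: hecke_braid.
- apply: hecke_comm; lia.
Qed.

Definition indicator (w v : Sigma) : int := (v == w)%:R.

(* Evaluating at [indicator w] and [1] extracts the coefficient of [w]. *)
Definition hecke_coef (w : Sigma) (f : endo) : int := f (indicator w) 1%g.

Lemma hecke_coef_is_zmod w : zmod_morphism (hecke_coef w).
Proof. by []. Qed.
HB.instance Definition _ w :=
  GRing.isZmodMorphism.Build endo int (hecke_coef w) (hecke_coef_is_zmod w).

Lemma hecke_endo_prod s phi v :
  (\prod_(a <- s) hecke_endo a : endo) phi v = phi (foldl hecke_simple v s).
Proof. by elim: s v => [|a s IH] v; rewrite ?big_nil // big_cons /= IH. Qed.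

Lemma hecke_coef_word w s :
  hecke_coef w (\prod_(a <- s) hecke_endo a) = (hecke_prod s == w)%:R.
Proof. by rewrite /hecke_coef hecke_endo_prod. Qed.

(** The equation [hecke_simple v i = w] has no solution [v] at an ascent of [w], and the two
    solutions [w] and [w * simple i] at a descent. *)
Lemma hecke_coef_simple w f i :
  hecke_coef w (f * hecke_endo i) =
  if w i < w (i + 1) then 0 else hecke_coef w f + hecke_coef (w * simple i)%g f.
Proof.
rewrite /hecke_coef /= -[X in f X](_ : (if w i < w (i + 1) then 0
   else indicator w + indicator (w * simple i)%g) = _).
  by case: ifP => _; rewrite ?endo0 ?endoD.
apply/funext => v; rewrite /indicator hecke_simpleE.
have [wi|wi] := sigma_cmp w i; have [vi|vi] := sigma_cmp v i;
  rewrite ?vi ?wi ?(lt_gtF vi) ?(lt_gtF wi) /=; rewrite /GRing.zero /=.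
- case: eqP => // vw; move: wi; rewrite -vw !sigmaM simpleL simpleR.
  by move=> /lt_gtF; rewrite vi.
- by case: eqP => // vw; move: wi; rewrite -vw => /lt_gtF; rewrite vi.
- rewrite /GRing.add /=; case: eqP => [vw|_].
    by move: wi; rewrite -vw => /lt_gtF; rewrite vi.
  rewrite add0r; congr (_%:R); congr nat_of_bool.
  by apply/eqP/eqP => [->|<-]; rewrite mulg_simpleK.
- rewrite /GRing.add /= addrC; case: eqP => [vw|_]; last by rewrite add0r.
  move: vi; rewrite vw !sigmaM simpleL simpleR => /lt_gtF.
  by rewrite wi.
Qed.

Section PolyCoef.

Variable n : nat.
Local Notation K := {mpoly int[n]}.
Local Notation Q := {mpoly endo[n]}.

Definition poly_coef (w : Sigma) : Q -> K := map_mpoly (hecke_coef w).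

Lemma poly_coefM w (k : K) (E : Q) :
  poly_coef w (map_mpoly intr k * E) = k * poly_coef w E.
Proof.
apply/mpolyP => m; rewrite mcoeff_map_mpoly !mcoeffM raddf_sum.
apply: eq_bigr => -[k1 k2] _; rewrite !mcoeff_map_mpoly.
set z := mcoeff _ k; set f := mcoeff _ E.
change (hecke_coef w (z%:~R * f) = z * hecke_coef w f).
by rewrite mulrzl raddfMz -mulrzl intz.
Qed.

Lemma poly_coefC w c : poly_coef w (c%:MP : Q) = (hecke_coef w c)%:MP.
Proof. exact: map_mpolyC. Qed.

Lemma poly_coef_sym w s (E : Q) : poly_coef w (msym s E) = msym s (poly_coef w E).
Proof. by apply/mpolyP => m; rewrite mcoeff_map_mpoly !mcoeff_sym mcoeff_map_mpoly. Qed.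

End PolyCoef.

Lemma map_alternate n (R : nzRingType) (f : {mpoly int[n]}) :
  map_mpoly (intr : int -> R) (alternate f) = alternate (map_mpoly intr f).
Proof.
rewrite /alternate rmorph_sum; apply: eq_bigr => s _.
rewrite rmorphM rmorphXn rmorphN rmorph1; congr (_ * _).
by apply/mpolyP => m; rewrite mcoeff_map_mpoly !mcoeff_sym mcoeff_map_mpoly.
Qed.

Lemma map_shape_mon n (R : nzRingType) (f : 'I_n -> nat) :
  map_mpoly (intr : int -> R) (shape_mon f) = shape_mon f.
Proof.
rewrite /shape_mon /gen_mon rmorph_prod; apply: eq_bigr => i _.
by rewrite rmorphM !rmorphXn rmorphD rmorph1 /= map_mpolyX.
Qed.

(** * Inverses, translates and supports of Hecke products *)

Lemma hecke_prod_rcons s i : hecke_prod (rcons s i) = hecke_simple (hecke_prod s) i.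
Proof. by rewrite /hecke_prod -cats1 foldl_cat. Qed.

Lemma simple_lt i x y : ~ (x = i /\ y = i + 1) -> ~ (x = i + 1 /\ y = i) ->
  (simple i x < simple i y) = (x < y).
Proof.
by move=> h1 h2; case: (simpleP i x) => ?; case: (simpleP i y) => ?; lia.
Qed.

Definition hecke_left (i : int) (u : Sigma) : Sigma := (hecke_simple u^-1 i)^-1%g.

Lemma hecke_leftE i (u : Sigma) :
  hecke_left i u = if u^-1%g i < u^-1%g (i + 1) then (simple i * u)%g else u.
Proof.
by rewrite /hecke_left hecke_simpleE; case: ifP => _; rewrite ?invMg ?invgK ?simpleV.
Qed.

Lemma sigmaV_eq (u : Sigma) x y : (u^-1)%g x = y <-> u y = x.
Proof. by split=> [<-|<-]; rewrite (sigmaVK, sigmaKV). Qed.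

(** Associativity of the Hecke product for two letters around [u]. The two tests interact only if
    [u] maps [{j, j + 1}] onto [{i, i + 1}], and then multiplication on either side gives the same
    permutation. *)
Lemma hecke_left_right i j (u : Sigma) :
  hecke_simple (hecke_left i u) j = hecke_left i (hecke_simple u j).
Proof.
rewrite !hecke_simpleE !hecke_leftE.
have [[uj uj1]|n1] := pselect (u j = i /\ u (j + 1) = i + 1).
  have vi : (u^-1)%g i = j by apply/sigmaV_eq.
  have vi1 : (u^-1)%g (i + 1) = j + 1 by apply/sigmaV_eq.
  have jj : (j < j + 1) by lia.
  have ii : (i < i + 1) by lia.
  rewrite vi vi1 uj uj1 jj ii !sigmaM uj uj1 simpleL simpleR (lt_gtF ii).
  rewrite invMg simpleV !sigmaM vi vi1 simpleL simpleR (lt_gtF jj).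
  apply: sigma_eqP => x; rewrite !sigmaM.
  case: (simpleP j x) => [->|->|xj xj1]; rewrite ?uj ?uj1 ?simpleL ?simpleR //.
  by apply: simpleD => E; [apply: xj|apply: xj1]; apply: (@sigma_inj u); rewrite ?uj ?uj1.
have [[uj uj1]|n2] := pselect (u j = i + 1 /\ u (j + 1) = i).
  have vi : (u^-1)%g i = j + 1 by apply/sigmaV_eq.
  have vi1 : (u^-1)%g (i + 1) = j by apply/sigmaV_eq.
  have jj : (j < j + 1) by lia.
  have ii : (i < i + 1) by lia.
  by rewrite vi vi1 uj uj1 (lt_gtF ii) (lt_gtF jj) uj uj1 (lt_gtF ii) vi vi1 (lt_gtF jj).
have n3 : ~ ((u^-1)%g i = j /\ (u^-1)%g (i + 1) = j + 1).
  by rewrite !sigmaV_eq.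
have n4 : ~ ((u^-1)%g i = j + 1 /\ (u^-1)%g (i + 1) = j).
  by rewrite !sigmaV_eq => -[h1 h2]; apply: n2.
have eP : ((simple i * u)%g j < (simple i * u)%g (j + 1)) = (u j < u (j + 1)).
  by rewrite !sigmaM simple_lt.
have eQ : ((u * simple j)^-1%g i < (u * simple j)^-1%g (i + 1)) =
    ((u^-1)%g i < (u^-1)%g (i + 1)).
  by rewrite invMg simpleV !sigmaM simple_lt.
case P : (u j < u (j + 1)); case Q : ((u^-1)%g i < (u^-1)%g (i + 1));
  by rewrite ?eP ?eQ ?P ?Q ?mulgA.
Qed.

Lemma hecke_prod_cons i s : hecke_prod (i :: s) = hecke_left i (hecke_prod s).
Proof.
rewrite {1}/hecke_prod /=.
have -> : hecke_simple 1%g i = hecke_left i 1%g.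
  by rewrite hecke_simpleE hecke_leftE invg1 mul1g mulg1.
rewrite /hecke_prod; elim: s (1%g : Sigma) => //= j s IH u.
by rewrite hecke_left_right IH.
Qed.

Lemma hecke_prod_rev s : hecke_prod (rev s) = (hecke_prod s)^-1%g.
Proof.
elim: s => [|i s IH]; first by rewrite /hecke_prod invg1.
by rewrite rev_cons hecke_prod_rcons IH hecke_prod_cons /hecke_left invgK.
Qed.

Lemma shiftE m (w : Sigma) x : shift m w x = w (x - m) + m.
Proof. by []. Qed.

Lemma shift_simple m i : shift m (simple i) = simple (i + m).
Proof.
apply: sigma_eqP => x; rewrite shiftE.
by case: (simpleP i (x - m)) => *; case: (simpleP (i + m) x) => *; lia.
Qed.

Lemma shiftM m u v : shift m (u * v)%g = (shift m u * shift m v)%g.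
Proof. by apply: sigma_eqP => x; rewrite sigmaM !shiftE sigmaM addrK. Qed.

Lemma shift_inj m : injective (shift m).
Proof.
move=> u v uv; apply: sigma_eqP => x.
have := congr1 (fun w : Sigma => w (x + m)) uv; rewrite /= !shiftE addrK.
by move/addIr.
Qed.

Lemma shift_hecke_simple m u i : shift m (hecke_simple u i) = hecke_simple (shift m u) (i + m).
Proof.
rewrite !hecke_simpleE !shiftE addrK (_ : i + m + 1 - m = i + 1); last by lia.
by rewrite ltrD2r; case: ifP => //; rewrite shiftM shift_simple.
Qed.

Lemma shift_hecke_prod m s : shift m (hecke_prod s) = hecke_prod [seq i + m | i <- s].
Proof.
elim/last_ind: s => [|s i IH]; last by rewrite map_rcons !hecke_prod_rcons shift_hecke_simple IH.
by apply: sigma_eqP => x; rewrite shiftE subrK.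
Qed.

(** The points [lo < x <= hi] are those that can be moved by letters strictly between [lo] and
    [hi]. *)
Definition supported (lo hi : int) (w : Sigma) : Prop :=
  forall x, (x <= lo) || (hi < x) -> w x = x.

Lemma supported_inv lo hi w : supported lo hi w -> supported lo hi w^-1%g.
Proof. by move=> ws x xo; apply/sigmaV_eq/ws. Qed.

Lemma supported_sym n w : sym n w <-> supported 0 n%:Z w.
Proof.
split=> ws x xo; apply: ws; last by lia.
by apply/negP; lia.
Qed.

Lemma supported_ex (w : Sigma) : exists M : nat, forall lo hi : int,
  (lo <= - M%:Z) -> (M%:Z <= hi) -> supported lo hi w.
Proof.
have [M wM] := sigma_bound w; exists M.+1 => lo hi h1 h2 x xo; apply: wM; lia.
Qed.

Lemma hecke_noncrossing a s : a \notin s -> forall x, (hecke_prod s x <= a) = (x <= a).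
Proof.
elim/last_ind: s => [|s i IH] //; rewrite mem_rcons inE negb_or => /andP[/eqP ai /IH {}IH] x.
rewrite hecke_prod_rcons hecke_simpleE; case: ifP => _; rewrite ?sigmaM IH //.
by case: (simpleP i x) => *; lia.
Qed.

(** A crossing of [a] never disappears: [s_i] acts only at an ascent, so at a crossing position [i]
    it puts a larger value, and any other crossing position it sends to a point that is still at
    most [a]. *)
Lemma hecke_crossing a s : a \in s -> exists2 x, x <= a & a < hecke_prod s x.
Proof.
elim/last_ind: s => [|s i IH] //; rewrite mem_rcons inE hecke_prod_rcons hecke_simpleE => ais.
have [/IH[x xa ax]|nas] := boolP (a \in s).
  case: ifP => h; last by exists x.
  have [E|/eqP xi] := eqVneq x i; last first.
    exists (simple i x); last by rewrite sigmaM simpleK.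
    by case: (simpleP i x) => *; lia.
  by exists x; rewrite // sigmaM E simpleL; rewrite E in ax; apply: lt_trans ax h.
have ai : a = i by case/orP: ais => [/eqP//|]; rewrite (negPf nas).
have h1 := hecke_noncrossing nas i; have h2 := hecke_noncrossing nas (i + 1).
case: ifP => h; last by lia.
by exists i; rewrite ?sigmaM ?simpleL; lia.
Qed.

(** Valid for every Hecke word, reduced or not, since each of its letters is crossed by some point.
    This bounds the entries of tableaux and makes coefficients independent of the range of
    letters. *)
Lemma hecke_letters lo hi w s : supported lo hi w -> hecke_prod s = w ->
  all (fun a => lo < a < hi) s.
Proof.
move=> ws sw; apply/allP => a /hecke_crossing[x xa]; rewrite sw => ax.
have [xo|xi] := boolP ((x <= lo) || (hi < x)); first by rewrite ws in ax; lia.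
have [xo|xi'] := boolP ((w x <= lo) || (hi < w x)); last by lia.
by have /sigma_inj := ws _ xo; lia.
Qed.

Lemma hecke_reduced (s : seq int) : inv_num (\prod_(i <- s) simple i)%g = size s ->
  hecke_prod s = (\prod_(i <- s) simple i)%g.
Proof.
elim/last_ind: s => [|s i IH]; first by rewrite big_nil.
rewrite -cats1 big_cat big_seq1 cats1 /= size_rcons hecke_prod_rcons => sE.
have le := inv_num_expr s.
have [h|h] := sigma_cmp (\prod_(i <- s) simple i)%g i.
  by rewrite inv_num_simple // in sE; rewrite IH ?hecke_simpleE ?h //; case: sE.
by have := inv_num_simple_gt h; rewrite sE => E; rewrite E in le; lia.
Qed.

Lemma hecke_word_ex (w : Sigma) : exists s, hecke_prod s = w.
Proof.
have [s sw sk] := inv_num_expr_ex w; exists s.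
by rewrite hecke_reduced; [exact/esym|rewrite -sw].
Qed.

(** * Coefficients as numbers of factorizations *)

Section Subwords.

Variable T : Type.
Implicit Types (s t : seq T) (ks : seq (nat * seq T)).

Fixpoint subwords (k : nat) s : seq (seq T) :=
  match k, s with
  | 0%N, _ => [:: [::]]
  | k'.+1, [::] => [::]
  | k'.+1, a :: s' => [seq a :: t | t <- subwords k' s'] ++ subwords k s'
  end.

(** For decreasing [s] the [subwords k s] are decreasing words of length [k]; here one such word is
    taken for each variable and the words are concatenated. Repetitions are kept, as they count in
    the coefficient. *)
Fixpoint factorizations ks : seq (seq T) :=
  if ks is (k, s) :: ks' then [seq t ++ t' | t <- subwords k s, t' <- factorizations ks']
  else [:: [::]].

Lemma subwords0 s : subwords 0 s = [:: [::]].
Proof. by case: s. Qed.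

Lemma subwords_filter (P : pred T) k s :
  [seq t <- subwords k s | all P t] = subwords k (filter P s).
Proof.
elim: s k => [|a s IH] [|k]; rewrite ?subwords0 //= filter_cat IH filter_map /=.
case Pa: (P a) => /=.
  by rewrite -!IH; congr (map _ _ ++ _); apply: eq_filter => t; rewrite /= Pa.
by rewrite (eq_filter (a2 := pred0)) ?filter_pred0 ?IH // => t; rewrite /= Pa.
Qed.

Lemma factorizations_filter (P : pred T) ks :
  [seq t <- factorizations ks | all P t] = factorizations [seq (p.1, filter P p.2) | p <- ks].
Proof.
elim: ks => //= -[k s] ks IH /=; rewrite -subwords_filter -IH.
elim: (subwords k s) => //= t l IHl; rewrite filter_cat IHl filter_map.
case tP: (all P t) => /=; first by congr (_ ++ _); congr map; apply: eq_filter => x; rewrite /= all_cat tP.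
by rewrite (eq_filter (a2 := pred0)) ?filter_pred0 // => x; rewrite /= all_cat tP.
Qed.

Lemma factorizations0 ks s : factorizations (rcons ks (0%N, s)) = factorizations ks.
Proof. by elim: ks => [|[k s'] ks /= ->] //=; rewrite subwords0. Qed.

End Subwords.

Lemma subwords_map (T T' : Type) (f : T -> T') k s :
  subwords k (map f s) = map (map f) (subwords k s).
Proof. by elim: s k => [|a s IH] [|k]; rewrite ?subwords0 //= !IH map_cat -!map_comp. Qed.

Lemma factorizations_map (T T' : Type) (f : T -> T') ks :
  factorizations [seq (p.1, map f p.2) | p <- ks] = map (map f) (factorizations ks).
Proof.
elim: ks => //= -[k s] ks IH /=; rewrite subwords_map IH.
elim: (subwords k s) => //= t l ->; rewrite map_cat -!map_comp; congr (_ ++ _).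
by apply: eq_map => x /=; rewrite map_cat.
Qed.

Definition factor_count (w : Sigma) (ks : seq (nat * seq int)) : int :=
  (count (fun t => hecke_prod t == w) (factorizations ks))%:Z.

Lemma factor_count_filter lo hi w ks : supported lo hi w ->
  factor_count w ks = factor_count w [seq (p.1, [seq a <- p.2 | lo < a < hi]) | p <- ks].
Proof.
move=> ws; rewrite /factor_count -factorizations_filter count_filter.
congr (_%:Z); apply: eq_count => t /=.
by case: eqP => // tw; rewrite (hecke_letters ws tw).
Qed.

Lemma factor_count_shift m w ks :
  factor_count (shift m w) [seq (p.1, [seq a + m | a <- p.2]) | p <- ks] = factor_count w ks.
Proof.
rewrite /factor_count factorizations_map count_map; congr (_%:Z).
by apply: eq_count => t /=; rewrite -shift_hecke_prod (inj_eq (@shift_inj m)).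
Qed.

Section Coefficients.

Variables (H : nzRingType) (T : Type) (u : T -> H).

Definition subword_sum k s : H := \sum_(t <- subwords k s) \prod_(a <- t) u a.

Lemma subword_sum0 s : subword_sum 0 s = 1.
Proof. by rewrite /subword_sum subwords0 big_seq1 big_nil. Qed.

Lemma subword_sum_nil k : subword_sum k.+1 [::] = 0.
Proof. by rewrite /subword_sum big_nil. Qed.

Lemma subword_sum_cons k a s :
  subword_sum k.+1 (a :: s) = u a * subword_sum k s + subword_sum k.+1 s.
Proof.
rewrite /subword_sum /= big_cat big_map mulr_sumr; congr (_ + _).
by apply: eq_bigr => t _; rewrite big_cons.
Qed.

Lemma subword_sum_gt k s : (size s < k)%N -> subword_sum k s = 0.
Proof.
elim: s k => [|a s IH] [|k] //= sk; first exact: subword_sum_nil.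
by rewrite subword_sum_cons !IH ?mulr0 ?addr0 //; lia.
Qed.

Lemma subword_expand n (i : 'I_n) s N : (size s < N)%N ->
  \prod_(a <- s) (1 + 'X_i * (u a)%:MP) =
  \sum_(k < N) (subword_sum k s)%:MP * 'X_i ^+ k :> {mpoly H[n]}.
Proof.
have cX : central ('X_i : {mpoly H[n]}) by exact: central_X.
elim: s N => [|a s IH] [//|N] sN.
  rewrite big_nil big_ord_recl subword_sum0 expr0 mulr1 mpolyC1 big1 ?addr0 // => k _.
  by rewrite subword_sum_nil mpolyC0 mul0r.
rewrite big_cons mulrDl mul1r {1}(IH N.+1 (ltnW sN)).
rewrite (IH N) // big_ord_recl mulr_sumr [RHS]big_ord_recl !subword_sum0 -addrA -big_split.
congr (_ + _); apply: eq_bigr => k _; rewrite subword_sum_cons.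
rewrite mpolyCD mulrDl addrC mpolyCM exprS; congr (_ + _).
by rewrite -!mulrA (cX (_ * _)) (cX ('X_i ^+ k)) !mulrA.
Qed.

(** Each factor has its own variable, so a monomial selects one term from each of them, and the
    order of the coefficients is kept. *)
Lemma coef_prod_expand n N (e : 'I_n -> nat -> H) (m : 'X_{1..n}) :
  (forall i k, (N <= k)%N -> e i k = 0) ->
  (\prod_(i < n) \sum_(k < N) (e i k)%:MP * 'X_i ^+ k : {mpoly H[n]})@_m =
  \prod_(i < n) e i (m i).
Proof.
move=> e0; rewrite bigA_distr_bigA /= raddf_sum /=.
have E (f : {ffun 'I_n -> 'I_N}) :
    \prod_i ((e i (f i))%:MP * 'X_i ^+ f i) =
    (\prod_i e i (f i))%:MP * 'X_[[multinom (f i : nat) | i < n]] :> {mpoly H[n]}.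
  rewrite mpolyXE_id (big_morph (@mpolyC n H) (@mpolyCM n H) (mpolyC1 n H)).
  under [X in _ = _ * X]eq_bigr do rewrite mnmE.
  rewrite -(central_prod _ _ (fun i => central_exp (f i) (central_X i))).
  rewrite -(prod_centralM _ _ (fun i => central_exp (f i) (central_X i))).
  by apply: eq_bigr => i _; rewrite central_exp //; exact: central_X.
under eq_bigr do rewrite E mcoeffCM mcoeffX.
have [mN|/forallPn[i0 mi0]] := boolP [forall i, m i < N]%N; last first.
  have [s1 [s2 sE]] : exists s1 s2, index_enum 'I_n = s1 ++ i0 :: s2.
    by have /splitPr[a b] : i0 \in index_enum 'I_n; [rewrite mem_index_enum|exists a, b].
  rewrite [in RHS]sE big_cat big_cons /= [e i0 _]e0 1?leqNgt // mul0r mulr0 big1 // => f _.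
  case: eqP => [fm|]; last by rewrite mulr0.
  by move: mi0; rewrite -fm mnmE ltn_ord.
have {}mN i : (m i < N)%N by exact: (forallP mN).
pose f0 : {ffun 'I_n -> 'I_N} := [ffun i => Ordinal (mN i)].
rewrite (bigD1 f0) //= [X in _ + X]big1 ?addr0 => [|f ff0]; last first.
  have [fm|_] := eqVneq [multinom (f i : nat) | i < n] m; last by rewrite mulr0.
  case/eqP: ff0; apply/ffunP => i; apply/val_inj; rewrite /= ffunE /= -fm mnmE //.
rewrite (_ : _ == m) ?mulr1; last by apply/eqP/mnmP => i; rewrite mnmE ffunE.
by apply: eq_bigr => i _; rewrite ffunE.
Qed.

Lemma subword_sum_prod (J : Type) (r : seq J) (k : J -> nat) (s : J -> seq T) :
  \prod_(i <- r) subword_sum (k i) (s i) =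
  \sum_(t <- factorizations [seq (k i, s i) | i <- r]) \prod_(a <- t) u a.
Proof.
elim: r => [|i r IH]; first by rewrite big_nil big_seq1 big_nil.
rewrite big_cons IH /= big_allpairs_dep /= mulr_suml; apply: eq_bigr => t _.
by rewrite mulr_sumr; apply: eq_bigr => t' _; rewrite big_cat.
Qed.

End Coefficients.

Definition letters (off : int) (a b : nat) : seq int :=
  [seq j%:Z + off | j <- rev (iota a (b - a))].

Definition upoly n (off : int) : nat -> {mpoly endo[n]} :=
  fun j => (hecke_endo (j%:Z + off))%:MP.

(** The lower ends [a i] cover both the triangular ranges of letters of Grothendieck polynomials and
    the constant ones of the stable limit. *)
Lemma coef_dprod n off w (a : 'I_n -> nat) b (m : 'X_{1..n}) :
  (poly_coef w (\prod_(i < n) dprod (upoly n off) (a i) b 'X_i))@_m =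
  factor_count w [seq (m i, letters off (a i) b) | i <- enum 'I_n].
Proof.
rewrite mcoeff_map_mpoly.
have -> : \prod_(i < n) dprod (upoly n off) (a i) b 'X_i =
  \prod_(i < n) \sum_(k < b.+1) (subword_sum hecke_endo k (letters off (a i) b))%:MP * 'X_i ^+ k.
  apply: eq_bigr => i _; rewrite -subword_expand; last by rewrite /letters size_map size_rev size_iota; lia.
  by rewrite /letters big_map.
rewrite (@coef_prod_expand _ n b.+1
  (fun i k => subword_sum hecke_endo k (letters off (a i) b))) => [|i k bk]; last first.
  by apply: subword_sum_gt; rewrite size_map size_rev size_iota; lia.
have -> : index_enum 'I_n = enum 'I_n by rewrite enumT /index_enum.
rewrite (subword_sum_prod _ _ m) raddf_sum /factor_count -sum1_count.
rewrite (big_morph Posz PoszD (erefl 0%:Z)) [RHS]big_mkcond /=.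
by apply: eq_bigr => t _; rewrite hecke_coef_word; case: eqP.
Qed.

(** * Grothendieck polynomials *)

Lemma ord_enum_tail n (j : 'I_n) s1 s2 : index_enum 'I_n = s1 ++ j :: s2 ->
  forall k, k \in s2 -> (j < k)%N.
Proof.
move=> sE k ks2; have : sorted ltn (map val (enum 'I_n)).
  by rewrite val_enum_ord iota_ltn_sorted.
have -> : enum 'I_n = index_enum 'I_n by rewrite enumT /index_enum.
rewrite sE map_cat /= => /cat_sorted2[_] /=.
rewrite (path_sortedE ltn_trans) => /andP[/allP h _].
by apply: h; apply: map_f.
Qed.

Lemma mcoeffMC n (R : nzRingType) (p : {mpoly R[n]}) c m : (p * c%:MP)@_m = p@_m * c.
Proof.
rewrite [p]mpolyE mulr_suml !raddf_sum mulr_suml; apply: eq_bigr => k _ /=.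
rewrite -scalerAl !mcoeffZ -mulrA -(commr_mpolyX k c%:MP) mcoeffCM mcoeffX.
by rewrite commr_nat.
Qed.

Lemma poly_coef_simple n w (F : {mpoly endo[n]}) a :
  poly_coef w (F * (hecke_endo a)%:MP) =
  if w a < w (a + 1) then 0 else poly_coef w F + poly_coef (w * simple a)%g F.
Proof.
apply/mpolyP => m; rewrite mcoeff_map_mpoly mcoeffMC.
rewrite [LHS]hecke_coef_simple; case: ifP => _; first by rewrite mcoeff0.
by rewrite mcoeffD !mcoeff_map_mpoly.
Qed.

Lemma poly_coefX n w i (E : {mpoly endo[n]}) : poly_coef w ('X_i * E) = 'X_i * poly_coef w E.
Proof. by rewrite -poly_coefM map_mpolyX. Qed.

Lemma poly_coefD n w (E F : {mpoly endo[n]}) :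
  poly_coef w (E + F) = poly_coef w E + poly_coef w F.
Proof. exact: raddfD. Qed.

Section FominKirillov.

Variable n : nat.
Local Notation K := {mpoly int[n]}.
Local Notation Q := {mpoly endo[n]}.
Local Notation U := (upoly n 1).

(** With the offset 1 in [U], the variable of index [i] carries the letters from [n - 1] down to
    [i + 1]. *)
Definition fk_prod : Q := \prod_(i < n) dprod U i n.-1 'X_i.

(** The extra factor commutes with all rows after [j] and completes the letters of row [j] to those
    of row [i]; the two products then commute. *)
Lemma fk_prod_sym (i j : 'I_n) : j = i.+1 :> nat ->
  msym (perm.tperm i j) (fk_prod * dfac U 'X_j i) = fk_prod * dfac U 'X_j i.
Proof.
move=> ji; have UH : zero_hecke U by apply: zero_hecke_mpoly; exact: zero_hecke_endo.
have [s1 [s2 [sE s1P s2P]]] := ord_enum_split ji.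
have s2gt : forall k, k \in s2 -> (j < k)%N.
  by apply: (@ord_enum_tail _ _ (rcons s1 i)); rewrite sE cat_rcons.
have ltn1 : (i < n.-1)%N by have := ltn_ord j; lia.
pose G (k : 'I_n) : Q := dprod U k n.-1 'X_k.
pose L := \prod_(k <- s1) G k; pose M := \prod_(k <- s2) G k.
have E : fk_prod * dfac U 'X_j i = L * (dprod U i n.-1 'X_i * dprod U i n.-1 'X_j) * M.
  rewrite /fk_prod sE big_cat !big_cons -/L -/M /=.
  rewrite (dprod_bot _ _ ltn1) [dprod U i _ 'X_j](dprod_bot _ _ ltn1) -ji.
  have MD : M * dfac U 'X_j i = dfac U 'X_j i * M.
    apply/esym; rewrite /M big_seq; apply: (big_ind (GRing.comm _)).
    - exact: commr1.
    - by move=> ? ?; exact: commrM.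
    move=> k /s2gt jk; apply/commr_sym/commrD; first exact: commr1.
    apply: commrM; first exact/commr_sym/central_X.
    by apply/commr_sym/(dprod_ucomm UH); [exact: central_X|lia].
  by rewrite -!mulrA MD.
have msD s a b x : msym s (dprod U a b x) = dprod U a b (msym s x).
  exact: (msym_dprod (fun j => hecke_endo (j%:Z + 1))).
have symS (s : seq 'I_n) : (forall k, k \in s -> (k != i) && (k != j)) ->
    msym (perm.tperm i j) (\prod_(k <- s) G k) = \prod_(k <- s) G k.
  move=> sP; rewrite rmorph_prod /=; apply: eq_big_seq => k /sP/andP[ki kj].
  by rewrite /G msD msym_X perm.tpermD 1?eq_sym.
rewrite E !rmorphM /= (symS _ s1P) (symS _ s2P) !msD !msym_X perm.tpermL perm.tpermR.
by rewrite (dprod_comm UH) //; exact: central_X.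
Qed.

Definition fk_poly (w : Sigma) : K := poly_coef w fk_prod.

(** Read off from [fk_prod_sym]: the coefficient of [w], which has an ascent, shows that [fk_poly w]
    is symmetric in the two variables, and the coefficient of [w s_(i+1)] then becomes the
    recursion. *)
Lemma fk_poly_rec (w : Sigma) (i j : 'I_n) : j = i.+1 :> nat -> w i.+1%:Z < w i.+2%:Z ->
  ('X_i - 'X_j) * fk_poly w = (1 + 'X_j) * fk_poly (w * simple i.+1%:Z)%g
    - (1 + 'X_i) * msym (perm.tperm i j) (fk_poly (w * simple i.+1%:Z)%g).
Proof.
move=> ji wi; set a := i.+1%:Z; set s := perm.tperm i j.
have a1 : a + 1 = i.+2%:Z by rewrite /a; lia.
have UE : U i = (hecke_endo a)%:MP.
  by rewrite /upoly; congr ((hecke_endo _)%:MP); rewrite /a; lia.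
have FE v : poly_coef v (fk_prod * dfac U 'X_j i) =
    fk_poly v + 'X_j * poly_coef v (fk_prod * (hecke_endo a)%:MP).
  rewrite /dfac UE mulrDr mulr1 mulrA -(central_X j fk_prod) -mulrA poly_coefD.
  by rewrite poly_coefX.
have sym v := congr1 (poly_coef v) (fk_prod_sym ji).
have {}sym v : msym s (fk_poly v + 'X_j * poly_coef v (fk_prod * (hecke_endo a)%:MP)) =
    fk_poly v + 'X_j * poly_coef v (fk_prod * (hecke_endo a)%:MP).
  by rewrite -FE -poly_coef_sym fk_prod_sym.
have := sym w; have := sym (w * simple a)%g; rewrite !poly_coef_simple !sigmaM.
rewrite simpleL simpleR a1 wi (lt_gtF wi) mulg_simpleK -/(fk_poly _) -/(fk_poly _).
rewrite mulr0 addr0; set f := fk_poly w; set g := fk_poly _.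
rewrite rmorphD rmorphM rmorphD /= msym_X perm.tpermR => e1 e2.
rewrite e2 in e1; apply/eqP; rewrite -subr_eq0.
set x : K := 'X_i in e1 *; set y : K := 'X_j in e1 *; set h := msym s g in e1 *.
have -> : (x - y) * f - ((1 + y) * g - (1 + x) * h) =
   (h + x * (h + f)) - (g + y * (g + f)) by ring.
by rewrite e1 subrr.
Qed.

End FominKirillov.

(** * The longest element of [S_n] and uniqueness in the recursion *)

Definition int_pairs (n : nat) : set (int * int) :=
  [set p | [/\ 1 <= p.1, p.1 < p.2 & p.2 <= n%:Z]].

Lemma finite_int_pairs n : finite_set (int_pairs n).
Proof.
have fI : finite_set [set x : int | 0 <= x <= n%:Z].
  apply: (sub_finite_set (B := (fun k : nat => k%:Z) @` `I_n.+1)).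
    by move=> x /= xM; exists (absz x) => /=; lia.
  exact/finite_image/finite_II.
by apply: sub_finite_set (finite_setX fI fI) => -[x y] [/=] *; split=> /=; lia.
Qed.

Definition pairs_num n := #|` fset_set (int_pairs n)|%fset.

Lemma card_fset_set_sub (T : choiceType) (A B : set T) : finite_set B -> A `<=` B ->
  (#|` fset_set A| <= #|` fset_set B|)%fset%N.
Proof.
move=> fB AB; have fA := sub_finite_set AB fB.
by apply: fsubset_leq_card; rewrite -fset_set_sub.
Qed.

Lemma inversions_sym n v : sym n v -> inversions v `<=` int_pairs n.
Proof.
move=> /supported_sym vs [x y] [/= xy vxy].
have dec z : (z <= 0) || (n%:Z < z) \/ 1 <= z <= n%:Z by lia.
have decv z : 1 <= z <= n%:Z -> 1 <= v z <= n%:Z.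
  by move=> zI; have [/vs/sigma_inj E|//] := dec (v z); rewrite E.
split=> //=.
  have [xo|] := dec x; last by lia.
  have [yo|yI] := dec y; first by move: vxy; rewrite !vs //; lia.
  by have := decv _ yI; move: vxy; rewrite (vs x) //; lia.
have [yo|] := dec y; last by lia.
have [xo|xI] := dec x; first by move: vxy; rewrite !vs //; lia.
by have := decv _ xI; move: vxy; rewrite (vs y) //; lia.
Qed.

Lemma inv_num_sym n v : sym n v -> (inv_num v <= pairs_num n)%N.
Proof.
by move=> vn; apply: card_fset_set_sub; [exact: finite_int_pairs|exact: inversions_sym].
Qed.

Definition descending (n : nat) (w : Sigma) : Prop :=
  forall a : int, 0 < a < n%:Z -> w (a + 1) < w a.

Lemma descending_lt n w (a b : int) : descending n w -> 1 <= a -> a < b -> b <= n%:Z ->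
  w b < w a.
Proof.
move=> wd a1 ab bn; have [k bk] : exists k : nat, b = a + 1 + k%:Z.
  by exists (absz (b - a - 1)%R); lia.
move: bn ab; rewrite bk {b bk}; elim: k => [|k IH] bn _.
  by rewrite addr0; apply: wd; lia.
apply: lt_trans (IH _ _); [|lia|lia].
rewrite (_ : a + 1 + k.+1%:Z = a + 1 + k%:Z + 1); last by lia.
by apply: wd; lia.
Qed.

Lemma descending_inv_num n w : sym n w -> descending n w -> inv_num w = pairs_num n.
Proof.
move=> wn wd; apply/eqP; rewrite eqn_leq inv_num_sym //=.
apply: card_fset_set_sub; first exact: finite_inversions.
by move=> [a b] [/= a1 ab bn]; split=> //=; exact: descending_lt wd _ _ _.
Qed.

Lemma sym_mul_simple n w (a : int) : sym n w -> 0 < a < n%:Z -> sym n (w * simple a)%g.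
Proof.
move=> /supported_sym wn an; apply/supported_sym => x xo.
by rewrite sigmaM simpleD ?wn //; lia.
Qed.

Lemma is_longestP n w : is_longest n w <-> sym n w /\ descending n w.
Proof.
split=> [[wn wmax]|[wn wd]]; split=> //.
  move=> a an; have [wa|//] := sigma_cmp w a.
  have := wmax _ (sym_mul_simple wn an).
  by rewrite !cox_lengthE inv_num_simple // ltnn.
move=> v vn; rewrite !cox_lengthE (descending_inv_num wn wd).
exact: inv_num_sym.
Qed.

Lemma descending_formula n w (a : int) : sym n w -> descending n w ->
  1 <= a -> a <= n%:Z -> w a = n%:Z + 1 - a.
Proof.
move=> /supported_sym wn wd a1 an.
have wI z : 1 <= z <= n%:Z -> 1 <= w z <= n%:Z.
  move=> zI; have [/wn/sigma_inj E|] := boolP ((w z <= 0) || (n%:Z < w z)); last by lia.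
  by rewrite E.
have up (k : nat) : (k < n)%N -> w (k.+1%:Z) <= n%:Z - k%:Z.
  elim: k => [|k IH] kn; first by have := wI 1%N%:Z; lia.
  have := IH ltac:(lia); have := wd k.+1%:Z ltac:(lia).
  by rewrite (_ : k.+1%:Z + 1 = k.+2%:Z); lia.
have down (k : nat) : (k < n)%N -> k.+1%:Z <= w (n%:Z - k%:Z).
  elim: k => [|k IH] kn; first by rewrite (_ : n%:Z - 0%:Z = n%:Z); [have := wI n%:Z|]; lia.
  have := IH ltac:(lia); have := wd (n%:Z - k.+1%:Z) ltac:(lia).
  by rewrite (_ : n%:Z - k.+1%:Z + 1 = n%:Z - k%:Z); lia.
have := up (absz (a - 1)%R) ltac:(lia); have := down (absz (n%:Z - a)%R) ltac:(lia).
rewrite (_ : n%:Z - (absz (n%:Z - a)%R)%:Z = a); last by lia.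
by rewrite (_ : (absz (a - 1)%R).+1%:Z = a); lia.
Qed.

Lemma descending_unique n v w : sym n v -> descending n v -> sym n w -> descending n w -> v = w.
Proof.
move=> vn vd wn wd; apply: sigma_eqP => x.
have [xo|] := boolP ((x <= 0) || (n%:Z < x)).
  by rewrite (supported_sym n v).1 ?(supported_sym n w).1.
by move=> xi; rewrite !(descending_formula (n := n)) //; lia.
Qed.

Lemma pairs_num_ge n : (\sum_(i < n) (n - i.+1) <= pairs_num n)%N.
Proof.
pose s := [seq (i.+1%:Z, k.+1%:Z) | i <- iota 0 n, k <- iota i.+1 (n - i.+1)] : seq (int * int).
have us : uniq s.
  apply: allpairs_uniq_dep; [exact: iota_uniq|by move=> i _; exact: iota_uniq|].
  move=> [i k] [i' k'] _ _ /= E; have [ei ek] : i = i' /\ k = k' by case: E; lia.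
  by rewrite ei ek.
have -> : (\sum_(i < n) (n - i.+1) = size s)%N.
  rewrite size_allpairs_dep sumnE big_map -[n in RHS]subn0 -/(index_iota 0 n) big_mkord.
  by apply: eq_bigr => i _; rewrite size_iota; lia.
rewrite /pairs_num; apply: uniq_leq_size => // p /allpairsPdep[i [k [iI kI ->]]].
rewrite in_fset_set; last exact: finite_int_pairs.
move: iI kI; rewrite !mem_iota inE => iI kI; split=> /=; lia.
Qed.

Lemma inv_num_hecke t : (inv_num (hecke_prod t) <= size t)%N.
Proof.
elim/last_ind: t => [|t i IH]; first by rewrite inv_num1.
rewrite hecke_prod_rcons hecke_simpleE size_rcons.
by case: ifP => [/inv_num_simple ->//|_]; exact: leqW.
Qed.

Lemma size_subwords (T : Type) k (s : seq T) : all (fun t => size t == k) (subwords k s).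
Proof.
elim: s k => [|a s IH] [|k]; rewrite ?subwords0 //= all_cat IH andbT all_map.
exact: IH.
Qed.

Lemma size_factorizations (T : Type) (ks : seq (nat * seq T)) :
  all (fun t => size t == sumn (map fst ks)) (factorizations ks).
Proof.
elim: ks => //= -[k s] ks IH /=; move: (size_subwords k s).
elim: (subwords k s) => //= t l IHl /andP[/eqP tk /IHl]; rewrite all_cat => ->.
rewrite andbT all_map; apply: sub_all IH => t' /eqP t'k /=.
by rewrite size_cat tk t'k.
Qed.

Lemma factor_count_lt w ks : (sumn (map fst ks) < inv_num w)%N -> factor_count w ks = 0.
Proof.
move=> kw; rewrite /factor_count; congr (_%:Z); apply/eqP; rewrite -leqn0 leqNgt -has_count.
apply/hasPn => t; move/allP: (size_factorizations ks) => /[apply] /eqP st.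
by apply: contraTN kw => /eqP <-; rewrite -leqNgt -st inv_num_hecke.
Qed.

Lemma subwords_gt (T : Type) k (s : seq T) : (size s < k)%N -> subwords k s = [::].
Proof. by elim: s k => [|a s IH] [|k] //= sk; rewrite !IH //; lia. Qed.

Lemma subwords_size (T : Type) (s : seq T) : subwords (size s) s = [:: s].
Proof. by elim: s => //= a s ->; rewrite subwords_gt. Qed.

Lemma factorizations_gt (T : Type) (ks : seq (nat * seq T)) :
  has (fun p => (size p.2 < p.1)%N) ks -> factorizations ks = [::].
Proof.
elim: ks => //= -[k s] ks IH /= /orP[/subwords_gt ->//|/IH ->].
by elim: (subwords k s).
Qed.

Lemma factorizations_size (T : Type) (l : seq (seq T)) :
  factorizations [seq (size s, s) | s <- l] = [:: flatten l].
Proof. by elim: l => //= s l ->; rewrite subwords_size. Qed.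

Section Longest.

Variable n : nat.
Local Notation K := {mpoly int[n]}.

Lemma fk_coef w (m : 'X_{1..n}) :
  (fk_poly n w)@_m = factor_count w [seq (m i, letters 1 i n.-1) | i : 'I_n <- enum 'I_n].
Proof. exact: coef_dprod. Qed.

Definition divided_rec (D : Sigma -> K) : Prop :=
  forall (w : Sigma) (i j : 'I_n), sym n w -> j = i.+1 :> nat ->
    w i.+1%:Z < w i.+2%:Z ->
    ('X_i - 'X_j) * D w = (1 + 'X_j) * D (w * simple i.+1%:Z)%g
      - (1 + 'X_i) * msym (perm.tperm i j) (D (w * simple i.+1%:Z)%g).

(** Induction from the longest element down: at an ascent the recursion gives [('X_i - 'X_j) * D w]
    in terms of a longer permutation, and the linear factor cancels. On a difference of two
    solutions this is uniqueness. *)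
Lemma divided_rec_eq0 D : divided_rec D -> (forall w, is_longest n w -> D w = 0) ->
  forall w, sym n w -> D w = 0.
Proof.
move=> Drec D0 w; have [k] := ubnP (pairs_num n - inv_num w)%N.
elim: k w => // k IH w wk wn.
have [wd|] := pselect (descending n w); first by apply/D0/is_longestP.
move=> /existsNP[a /not_implyP[an nwa]].
have wa : w a < w (a + 1) by case: (sigma_cmp w a).
have i_n : ((absz a).-1 < n)%N by lia.
have j_n : (absz a < n)%N by lia.
pose i := Ordinal i_n; pose j := Ordinal j_n.
have aE : i.+1%:Z = a by rewrite /=; lia.
have a1E : i.+2%:Z = a + 1 by rewrite /=; lia.
have ji : j = i.+1 :> nat by rewrite /=; lia.
have := Drec w i j wn ji; rewrite aE a1E => /(_ wa).
have wsn := sym_mul_simple wn an.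
rewrite (IH (w * simple a)%g) //; last first.
  have := inv_num_sym wsn; rewrite inv_num_simple //; lia.
rewrite msym0 !mulr0 subr0 => /eqP; rewrite mulf_eq0 => /orP[|/eqP//].
move=> /eqP/(congr1 (mcoeff U_(i))); rewrite mcoeffB !mcoeffXU mcoeff0 eqxx.
by have -> : (j == i) = false by apply/eqP => E; move: ji; rewrite E; lia.
Qed.

Lemma fk_rec : divided_rec (fk_poly n).
Proof. by move=> w i j _; exact: fk_poly_rec. Qed.

Let full : seq int := flatten [seq letters 1 i n.-1 | i : 'I_n <- enum 'I_n].

(** The exponent of a variable is at most its number of letters [n - i.+1], while a Hecke word of
    [w] has at least as many letters as [w] has inversions, which is no less than the sum of these
    bounds. Only the staircase monomial is left, with the single word [full]. *)
Lemma fk_longest_coef w : is_longest n w ->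
  fk_poly n w = (hecke_prod full == w)%:R * \prod_(i < n) 'X_i ^+ (n - i.+1).
Proof.
move=> /is_longestP[wn wd].
pose delta : 'X_{1..n} := [multinom (n - i.+1)%N | i < n].
have -> : \prod_(i < n) 'X_i ^+ (n - i.+1) = 'X_[delta] :> K.
  by rewrite mpolyXE_id; apply: eq_bigr => i _; rewrite mnmE.
have szl (i : 'I_n) : size (letters 1 i n.-1) = (n - i.+1)%N.
  by rewrite size_map size_rev size_iota; lia.
apply/mpolyP => m; rewrite fk_coef -mpolyC_nat mcoeffCM mcoeffX.
have [<-|md] := eqVneq delta m.
  rewrite mulr1 /factor_count (eq_map (g := fun i : 'I_n => (size (letters 1 i n.-1), letters 1 i n.-1))).
    rewrite (map_comp (fun s => (size s, s))) factorizations_size /= addn0.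
    by rewrite -/full; case: eqP.
  by move=> i; rewrite szl mnmE.
rewrite mulr0; have [/existsP[i mi]|/existsPn mle] := boolP [exists i : 'I_n, n - i.+1 < m i]%N.
  rewrite /factor_count factorizations_gt //; apply/hasP.
  exists (m i, letters 1 i n.-1); last by rewrite szl.
  by apply/mapP; exists i; rewrite ?mem_enum.
apply: factor_count_lt; rewrite (descending_inv_num wn wd).
apply: leq_trans (pairs_num_ge n).
rewrite -map_comp sumnE big_map big_enum /=.
have [i0 mi0] : exists i0 : 'I_n, (m i0 < n - i0.+1)%N.
  apply: contrapT => nex; case/eqP: md; apply/mnmP => i; rewrite mnmE.
  apply/eqP; rewrite eqn_leq; have := mle i; rewrite -leqNgt => ->; rewrite andbT leqNgt.
  by apply/negP => mi; apply: nex; exists i.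
rewrite (bigD1 i0) //= [X in (_ < X)%N](bigD1 i0) //= -addSn leq_add //.
by apply: leq_sum => i _; have := mle i; rewrite -leqNgt.
Qed.

(* If this coefficient vanished, the recursion would make all of them vanish,
   including that of [1], whose constant term is 1. *)
Lemma fk_longest w : is_longest n w -> fk_poly n w = \prod_(i < n) 'X_i ^+ (n - i.+1).
Proof.
move=> wl; rewrite fk_longest_coef //; case: eqP => [_|nw]; first by rewrite mul1r.
have /(_ 1%g) : forall v, sym n v -> fk_poly n v = 0.
  apply: divided_rec_eq0; first exact: fk_rec.
  move=> v vl; have /is_longestP[vn vd] := vl; have /is_longestP[wn wd] := wl.
  rewrite fk_longest_coef // (descending_unique vn vd wn wd).
  by case: eqP nw => // _ _; rewrite mul0r.
move=> /(_ ltac:(by [])) /(congr1 (mcoeff 0%MM)); rewrite fk_coef mcoeff0.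
rewrite (_ : factor_count _ _ = 1) // /factor_count.
rewrite (_ : factorizations _ = [:: [::]]) /= ?eqxx //.
by elim: (enum 'I_n) => //= i s ->; rewrite mnm0E subwords0.
Qed.

(** The polynomials are chosen by their characterization, so [fk_poly] supplies existence, and the
    difference of two solutions uniqueness. *)
Lemma grothendieckE w : sym n w -> grothendieck n w = fk_poly n w.
Proof.
move=> wn; pose P v := if `[< sym n v >] then fk_poly n v else 0.
have PE v : sym n v -> P v = fk_poly n v by move=> vn; rewrite /P asboolT.
have PG : is_grothendieck P.
  split=> [v vn|v vl|v i j vn ji vi /=]; first by rewrite /P asboolF.
    by rewrite PE ?fk_longest //; case: vl.
  by rewrite !PE ?(fk_rec vn ji vi) //; apply: sym_mul_simple => //; have := ltn_ord j; lia.
rewrite /grothendieck; case: xgetP => [G _ [G0 Gl Gr]|/(_ P PG) //].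
apply/eqP; rewrite -subr_eq0 -(PE w wn); apply/eqP.
apply: (@divided_rec_eq0 (fun v => G v - P v)) wn => [v i j vn ji vi|v vl]; last first.
  by rewrite Gl // PE ?fk_longest ?subrr //; case: vl.
have := Gr v i j vn ji vi; have [_ _ Pr] := PG; have := Pr v i j vn ji vi => /= e1 e2.
by rewrite raddfB /= mulrBr e1 e2; ring.
Qed.

End Longest.

(** * The stable limit *)

Lemma supported_shift m lo hi w : supported lo hi w -> supported (lo + m) (hi + m) (shift m w).
Proof. by move=> ws x xo; rewrite shiftE ws ?subrK //; lia. Qed.

Lemma supported_le lo hi lo' hi' w : supported lo hi w -> lo' <= lo -> hi <= hi' ->
  supported lo' hi' w.
Proof. by move=> ws l h x xo; apply: ws; lia. Qed.

Lemma letters_sorted off a b : sorted >%R (letters off a b).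
Proof.
rewrite /letters map_rev rev_sorted sorted_map.
apply: sub_sorted (iota_ltn_sorted a (b - a)) => x y /=; lia.
Qed.

Lemma mem_letters off a b x :
  (x \in letters off a b) = (off + a%:Z <= x < off + b%:Z).
Proof.
apply/mapP/idP => [[j]|xab]; first by rewrite mem_rev mem_iota => jab ->; lia.
by exists (absz (x - off)%R); rewrite ?mem_rev ?mem_iota; lia.
Qed.

Lemma filter_letters off N off' a b : off' + a%:Z <= off -> off + N%:Z <= off' + b%:Z ->
  [seq x <- letters off' a b | off - 1 < x < off + N%:Z] = letters off 0 N.
Proof.
move=> h1 h2; have trgt : transitive (>%R : rel int) by move=> y x z; rewrite /= => h /lt_trans; apply.
apply: (irr_sorted_eq trgt); first by move=> x /=; rewrite ltxx.
- by apply: sorted_filter => //; exact: letters_sorted.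
- exact: letters_sorted.
by move=> x; rewrite mem_filter !mem_letters; lia.
Qed.

Lemma letters_shift off N m : [seq a + m | a <- letters off 0 N] = letters (off + m) 0 N.
Proof. by rewrite /letters -map_comp; apply: eq_map => j /=; lia. Qed.

Lemma factor_count_tail w (k : nat -> nat) (s : nat -> seq int) n n' :
  (n <= n')%N -> (forall i, (n <= i)%N -> k i = 0%N) ->
  factor_count w [seq (k i, s i) | i <- iota 0 n'] = factor_count w [seq (k i, s i) | i <- iota 0 n].
Proof.
move=> nn' k0; rewrite -(subnKC nn'); elim: (n' - n)%N => [|d IH]; first by rewrite addn0.
rewrite addnS -addn1 iotaD /= cats1 map_rcons /= k0 ?leq_addr //.
by rewrite -IH /factor_count factorizations0.
Qed.

(** For large [m] the letters of [1^m x w] lie within the triangular ranges of the first [n]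
    variables: none is below [i + 1] for [i < n], and all are below [2 m]. The ranges are therefore
    cut down to one common window, and translating back removes [m]. *)
Lemma stable_eventually w off N (k : monomial) n :
  supported (off - 1) (off + N%:Z) w -> (forall i, (n <= i)%N -> k i = 0%N) ->
  exists m0, forall m, (m0 <= m)%N ->
    poly_series (grothendieck m.*2 (shift m%:Z w)) k =
    factor_count w [seq (k i, letters off 0 N) | i <- iota 0 n].
Proof.
move=> ws k0; exists (`|off| + N + n + 1)%N => m mm0.
have ws' := supported_shift (m := m%:Z) ws.
rewrite /poly_series asboolT => [|i im]; last by apply: k0; lia.
rewrite grothendieckE; last first.
  by apply/supported_sym; apply: supported_le ws' _ _; lia.
rewrite fk_coef.
pose F i := (k i, letters 1 i (m.*2).-1).
rewrite (_ : [seq _ | i <- enum 'I_(m.*2)] = [seq F i | i <- iota 0 m.*2]); last first.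
  by rewrite -val_enum_ord -[RHS]map_comp; apply: eq_map => i /=; rewrite /F mnmE.
rewrite (@factor_count_tail _ _ _ n) //; last by lia.
rewrite (factor_count_filter _ ws') -(factor_count_shift m%:Z w) -!map_comp.
congr factor_count; apply/eq_in_map => i; rewrite mem_iota => iI /=; congr (_, _).
rewrite letters_shift -(@filter_letters (off + m%:Z) N 1 i (m.*2).-1); [|lia|lia].
by apply: eq_filter => x; congr (_ && _); congr (_ < _); lia.
Qed.

Lemma monomial_bound (k : monomial) : exists n, forall i, (n <= i)%N -> k i = 0%N.
Proof.
exists (\max_(i <- finsupp k) i.+1) => i ni; apply: contraTeq ni.
rewrite -mem_finsupp -ltnNge => ik.
exact: (leq_bigmax_seq (F := fun i : nat => i.+1)).
Qed.

Lemma stable_coef w off N (k : monomial) n :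
  supported (off - 1) (off + N%:Z) w -> (forall i, (n <= i)%N -> k i = 0%N) ->
  stable_grothendieck w k = factor_count w [seq (k i, letters off 0 N) | i <- iota 0 n].
Proof.
move=> ws k0; rewrite /stable_grothendieck /ps_lim.
case: xgetP => [g _ gl|ng].
  have [m1 h1] := gl k; have [m2 h2] := stable_eventually ws k0.
  by rewrite -(h1 (maxn m1 m2)) ?leq_maxl // h2 ?leq_maxr.
(* The limit exists: its coefficient at a monomial is the eventual value, computed with any bound on
   the variables of that monomial. *)
pose g0 (k : monomial) := factor_count w
  [seq (k i, letters off 0 N) | i <- iota 0 (projT1 (cid (monomial_bound k)))].
case: (ng g0) => k'; rewrite /g0; case: cid => n' /= k'0.
exact: stable_eventually.
Qed.

(** * Paths and tableaux *)

Section PathExpansion.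

Variables (n : nat) (off : int) (N : nat).
Local Notation K := {mpoly int[n]}.

(** [G_w] in [n] variables, as soon as the letters of [w] lie in the window [off <= a < off + N]. *)
Definition stable_poly (w : Sigma) : K :=
  poly_coef w (\prod_(i < n) dprod (upoly n off) 0 N 'X_i).

Definition bialternant (f : 'I_n -> nat) : K := alternate (shape_mon f).

(** Rows from top to bottom, each from its largest letter down: the reverse of the row word. *)
Definition path_word (p : seq (step n)) : seq int :=
  flatten [seq [seq j%:Z + off | j <- row_letters i p] | i : 'I_n <- enum 'I_n].

Lemma stable_poly_coef w (k : monomial) :
  supported (off - 1) (off + N%:Z) w -> (forall i, (n <= i)%N -> k i = 0%N) ->
  (stable_poly w)@_[multinom k (i : nat) | i < n] = stable_grothendieck w k.
Proof.
move=> ws k0; rewrite coef_dprod (stable_coef ws k0) -val_enum_ord -[in RHS]map_comp.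
by congr factor_count; apply: eq_map => i /=; rewrite mnmE.
Qed.

Lemma path_expansion w (la : 'I_n -> nat) :
  (forall i j : 'I_n, j = i.+1 :> nat -> (la j <= la i)%N) ->
  bialternant la * stable_poly w =
  \sum_(p <- paths la N | hecke_prod (path_word p) == w) bialternant (path_shape la p).
Proof.
move=> la_dec; have aE f : alternate (shape_mon f : {mpoly endo[n]}) =
    map_mpoly intr (bialternant f) by rewrite map_alternate map_shape_mon.
have := congr1 (poly_coef w) (cauchy_paths (zero_hecke_endo off) N la_dec).
rewrite aE poly_coefM => ->; rewrite /poly_coef raddf_sum [RHS]big_mkcond /=.
apply: eq_bigr => p _; rewrite -/(poly_coef w _) aE poly_coefM poly_coefC.
have -> : \prod_i row_letter_prod (fun j : nat => hecke_endo (j%:Z + off)) i p =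
    \prod_(a <- path_word p) hecke_endo a.
  have -> : index_enum 'I_n = enum 'I_n by rewrite enumT /index_enum.
  rewrite /path_word big_flatten [RHS]big_map; apply: eq_bigr => i _.
  by rewrite /row_letter_prod big_map.
by rewrite hecke_coef_word; case: eqP; rewrite ?mpolyC1 ?mulr1 ?mpolyC0 ?mulr0.
Qed.

End PathExpansion.

Section PathTableau.

Variables (n : nat) (off : int) (la : 'I_n -> nat).
Hypothesis la_dec : forall i j : 'I_n, j = i.+1 :> nat -> (la j <= la i)%N.
Implicit Types (p : seq (step n)) (e : step n).
Local Notation shape := (path_shape la).

Fixpoint path_tableau p (i : 'I_n) (c : nat) : int :=
  if p is e :: p' then
    if (c < shape p' i)%N then path_tableau p' i c
    else if e i && (c == shape p' i) then (size p')%:Z + off else 0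
  else 0.

(** Strictness between adjacent rows suffices, because a column of a skew shape has no gaps. *)
Record row_tableau (N : nat) (nu : 'I_n -> nat) (T : 'I_n -> nat -> int) : Prop := RowTableau {
  rt_sub : forall i, (la i <= nu i)%N;
  rt_dec : forall i j : 'I_n, j = i.+1 :> nat -> (nu j <= nu i)%N;
  rt_range : forall i c, (la i <= c < nu i)%N -> off <= T i c < off + N%:Z;
  rt_row : forall i c c', (la i <= c)%N -> (c < c')%N -> (c' < nu i)%N -> T i c < T i c';
  rt_col : forall (i j : 'I_n) c, j = i.+1 :> nat -> (la i <= c < nu j)%N -> T i c < T j c;
  rt_out : forall i c, ~~ (la i <= c < nu i)%N -> T i c = 0 }.

Lemma path_shape_ge p i : (la i <= shape p i)%N.
Proof. exact: leq_addr. Qed.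

Lemma path_row_tableau p : good_path la p -> row_tableau (size p) (shape p) (path_tableau p).
Proof.
elim: p => [_|e p IH gp].
  have sE i : shape [::] i = la i by rewrite /path_shape addn0.
  by split=> // [i|i j ji|i c|i c c'|i j c ji]; rewrite ?sE //; try lia; have := la_dec ji; lia.
case/andP: (gp : path_ok la p e && good_path la p) => ok gp'.
have [_ dec range row col out] := IH gp'.
have shE i : shape (e :: p) i = (shape p i + e i)%N by rewrite path_shape_cons.
have new i c : (shape p i <= c < shape p i + e i)%N -> path_tableau (e :: p) i c = (size p)%:Z + off.
  move=> ci /=; rewrite ltnNge (_ : shape p i <= c)%N /=; last by lia.
  by move: ci; case: (e i) => /=; [case: eqP|]; lia.
have old i c : (c < shape p i)%N -> path_tableau (e :: p) i c = path_tableau p i c by move=> /= ->.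
have zero i c : (shape p i + e i <= c)%N -> path_tableau (e :: p) i c = 0.
  move=> ci /=; rewrite ltnNge (_ : shape p i <= c)%N /=; last by lia.
  by move: ci; case: (e i) => //=; case: eqP => //; lia.
move: (path_tableau (e :: p)) new old zero => T new old zero.
have dec' i c : (la i <= c < shape p i + e i)%N -> (la i <= c < shape p i)%N \/
   (shape p i <= c < shape p i + e i)%N by lia.
split=> [i|i j ji|i c|i c c' lc cc'|i j c ji|i c].
- exact: path_shape_ge.
- exact: path_shape_dec gp ji.
- rewrite shE [size _]/= => ci; have [co|cn] := dec' i c ci; last by rewrite new //; lia.
  by have := range i c co; rewrite old; lia.
- rewrite shE => ci; rewrite (old i c); last by lia.
  have [co|cn] : (c' < shape p i)%N \/ (shape p i <= c' < shape p i + e i)%N by lia.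
    by rewrite old // row.
  by rewrite new //; have := range i c; lia.
- rewrite shE => ci; have := path_okP ok ji; have dji := dec _ _ ji => okj.
  have cs : (c < shape p i)%N by move: ci okj; case: (e j) => /= ci; [move=> /(_ isT)|]; lia.
  rewrite (old i) //.
  have [co|cn] : (c < shape p j)%N \/ (shape p j <= c < shape p j + e j)%N by lia.
    by rewrite old //; apply: col => //; lia.
  by rewrite new //; have := range i c; lia.
rewrite shE => nc; have [cs|cs] := ltnP c (shape p i); first by rewrite old // out //; lia.
by apply: zero; have := path_shape_ge p i; lia.
Qed.

(** The boxes with the largest letter end their rows and have nothing below them. Removing them
    leaves a tableau with one letter less, and their rows form the head of the path. *)
Lemma row_tableau_path N nu T : row_tableau N nu T ->
  exists p, [/\ size p = N, good_path la p, shape p =1 nu & forall i c, path_tableau p i c = T i c].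
Proof.
elim: N nu T => [|N IH] nu T [sub dec range row col out].
  have nuE i : nu i = la i by have := sub i; have := range i (la i); lia.
  exists [::]; split=> // [i|i c]; first by rewrite /path_shape nuE addn0.
  by rewrite out //= nuE; lia.
pose e : step n := [ffun i => (la i < nu i)%N && (T i (nu i).-1 == off + N%:Z)].
pose nu' i := (nu i - e i)%N.
pose T' i c := if (c < nu' i)%N then T i c else 0.
have eP i : e i -> (la i < nu i)%N /\ T i (nu i).-1 = off + N%:Z.
  by rewrite ffunE => /andP[-> /eqP].
have nuE i : nu i = (nu' i + e i)%N.
  by rewrite /nu'; case ei: (e i) => /=; [have [] := eP i ei|]; lia.
have range' i c : (la i <= c < nu' i)%N -> off <= T i c < off + N%:Z.
  move=> ci; have := range i c; have := nuE i; case ei: (e i) => nui.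
    by have [_ <-] := eP i ei; have := @row i c (nu i).-1; lia.
  have [cl|cl] := ltnP c (nu i).-1.
    by have := @row i c (nu i).-1; have := range i (nu i).-1; lia.
  move: ei; rewrite ffunE (_ : (la i < nu i)%N) /=; last by lia.
  by rewrite (_ : (nu i).-1 = c); [case: eqP => //|]; lia.
(* The box above the last box of row [j] does not carry the largest letter, so it survives the
   removal; this is what makes the step a good one. *)
have coltop (i j : 'I_n) : j = i.+1 :> nat -> e j -> (nu' j < nu' i)%N.
  move=> ji ej; have [l1 tj] := eP j ej; have := nuE j; rewrite ej => nuj.
  have dij := dec i j ji; have := nuE i; case ei: (e i) => /= nui; last by lia.
  rewrite ltnNge; apply/negP => le; have [l2 ti] := eP i ei.
  have E : (nu i).-1 = (nu j).-1 by lia.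
  by have := @col i j (nu j).-1 ji; rewrite -E ti E tj; lia.
have rowend (i j : 'I_n) : j = i.+1 :> nat -> e i -> (nu j < nu i)%N.
  move=> ji ei; have [l2 ti] := eP i ei; have dij := dec i j ji.
  rewrite ltnNge; apply/negP => le; have := @col i j (nu i).-1 ji ltac:(lia).
  have := la_dec ji => lij; have := range j (nu i).-1 ltac:(lia).
  by rewrite ti; lia.
have RT : row_tableau N nu' T'.
  split=> [i|i j ji|i c ci|i c c' lc cc' c'l|i j c ji ci|i c nc].
  - by have := nuE i; have := sub i; case ei: (e i) => /=; [have [] := eP i ei|]; lia.
  - by have := nuE i; have := nuE j; have := dec i j ji; have := rowend i j ji; have := coltop i j ji;
    case: (e j) => /= [/(_ isT) + |_]; case: (e i) => /= [|]; lia.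
  - by rewrite /T' (_ : c < nu' i)%N; [exact: range'|lia].
  - by rewrite /T' c'l (ltn_trans cc' c'l); apply: row => //; have := nuE i; lia.
  - have cl : (c < nu' i)%N.
      have := nuE i; have := nuE j; have := dec i j ji; have := rowend i j ji; have := coltop i j ji.
      by case: (e j) => /= [/(_ isT) + |_]; case: (e i) => /= [|]; lia.
    rewrite /T' cl (_ : c < nu' j)%N; last by lia.
    by apply: col => //; have := nuE j; lia.
  - rewrite /T'; case: ifP => // cl; apply: out; have := nuE i; lia.
have [p [sp gp shp Tp]] := IH _ _ RT; exists (e :: p); split=> //=.
- by rewrite sp.
- rewrite gp andbT; apply/negP => /existsP[i /existsP[j /and3P[/eqP ji ej]]].
  by rewrite !shp => le; have := coltop i j ji ej; lia.
- by move=> i; rewrite path_shape_cons shp nuE.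
move=> i c; rewrite shp Tp sp; have [cl|cl] := ltnP c (nu' i); first by rewrite /T' cl.
case ei: (e i) => /=; last by rewrite out //; have := nuE i; rewrite ei addn0; lia.
have [l1 ti] := eP i ei; have := nuE i; rewrite ei addn1 => nui.
case: eqP => [->|ne]; last by rewrite out //; lia.
by rewrite (_ : nu' i = (nu i).-1) ?ti 1?addrC //; lia.
Qed.

(** The heads agree, because both consist of the rows in which the largest possible letter
    occurs. *)
Lemma path_tableau_inj p q : good_path la p -> good_path la q -> size p = size q ->
  shape p =1 shape q -> (forall i c, path_tableau p i c = path_tableau q i c) -> p = q.
Proof.
elim: p q => [|e p IH] [|f q] //= /andP[okp gp] /andP[okq gq] [spq] shpq Tpq.
have lt r i c : good_path la r -> (la i <= c < shape r i)%N -> path_tableau r i c < off + (size r)%:Z.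
  by move=> gr cr; have [_ _ /(_ i c cr)/andP[]] := path_row_tableau gr.
have ef : e = f.
  apply/ffunP => i; have := shpq i; rewrite !path_shape_cons.
  have := path_shape_ge p i; have := path_shape_ge q i => h1 h2.
  case ei: (e i); case fi: (f i) => //= sh.
    have := Tpq i (shape p i); rewrite /= ltnn ei eqxx fi /= (_ : shape p i < shape q i)%N; last by lia.
    by have := lt q i (shape p i) gq; lia.
  have := Tpq i (shape q i); rewrite /= ltnn fi eqxx ei /= (_ : shape q i < shape p i)%N; last by lia.
  by have := lt p i (shape q i) gp; lia.
subst f; congr cons.
have sh' : shape p =1 shape q by move=> i; have := shpq i; rewrite !path_shape_cons => /addIn.
apply: IH => // i c; have := Tpq i c; rewrite /= sh'; case: ifP => // cs _.
have [_ _ _ _ _ outp] := path_row_tableau gp; have [_ _ _ _ _ outq] := path_row_tableau gq.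
by rewrite outp ?outq // ?sh'; lia.
Qed.

Lemma path_row_letters p i : good_path la p ->
  [seq j%:Z + off | j <- row_letters i p] =
  rev [seq path_tableau p i c | c <- iota (la i) (shape p i - la i)].
Proof.
elim: p => [_|e p IH /= /andP[_ gp]]; first by rewrite /path_shape addn0 subnn.
have lesh := path_shape_ge p i.
have E : [seq path_tableau (e :: p) i c | c <- iota (la i) (shape p i - la i)] =
    [seq path_tableau p i c | c <- iota (la i) (shape p i - la i)].
  apply/eq_in_map => c; rewrite mem_iota => ci /=.
  by rewrite (_ : (c < shape p i)%N); last by lia.
rewrite path_shape_cons; case ei: (e i) => /=; last first.
  by rewrite addn0 IH // -E /= ?ei.
rewrite (_ : shape p i + 1 - la i = (shape p i - la i) + 1)%N; last by lia.
rewrite iotaD map_cat rev_cat /= subnKC // ltnn ?ei eqxx /=.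
by congr cons; rewrite IH // -E /= ?ei.
Qed.

End PathTableau.

(** * Young diagrams and their row lengths *)

Lemma geq_trans : transitive geq.
Proof. by move=> y x z /= yx zy; exact: leq_trans zy yx. Qed.

Lemma row_length_le (la : young) r r' : (r <= r')%N -> (row_length la r' <= row_length la r)%N.
Proof.
move=> rr'; have /andP[las _] := young_subproof la; rewrite /row_length.
have [r'l|lr'] := ltnP r' (size la); last by rewrite (nth_default _ lr').
have := sorted_leq_nth geq_trans (fun x => leqnn x) 0%N las.
by move=> /(_ r r'); rewrite !inE; apply => //; exact: leq_ltn_trans rr' r'l.
Qed.

Lemma row_length_gt0 (la : young) r : (0 < row_length la r)%N = (r < size la)%N.
Proof.
have /andP[_ la0] := young_subproof la; rewrite /row_length.
have [rl|lr] := ltnP r (size la); last by rewrite nth_default.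
by rewrite lt0n; apply: contraNneq la0 => <-; exact: mem_nth.
Qed.

Lemma row_length_out (la : young) r : (size la <= r)%N -> row_length la r = 0%N.
Proof. by move=> lr; rewrite /row_length nth_default. Qed.

Lemma young_eq (la nu : young) : row_length la =1 row_length nu -> la = nu.
Proof.
move=> E; have szE : size la = size nu.
  by apply/eqP; rewrite eqn_leq leqNgt -row_length_gt0 E row_length_gt0 ltnn /=
    leqNgt -row_length_gt0 -E row_length_gt0 ltnn.
by apply/val_inj/(@eq_from_nth _ 0%N) => // r _; exact: E.
Qed.

Lemma diagram_subP (la nu : young) :
  diagram_sub la nu <-> forall r, (row_length la r <= row_length nu r)%N.
Proof.
split=> [h r|h [r c]]; last by rewrite /in_diagram /= => /leq_trans; apply.
case E : (row_length la r) => [//|k].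
by have := h (r, k); rewrite /in_diagram /= E ltnSn => /(_ isT).
Qed.

Lemma in_skewE (nu la : young) r c :
  in_skew nu la (r, c) = (row_length la r <= c < row_length nu r)%N.
Proof. by rewrite /in_skew /in_diagram /= -leqNgt andbC. Qed.

Lemma nth_filter_pos (s : seq nat) i : sorted geq s ->
  nth 0%N [seq x <- s | 0 < x]%N i = nth 0%N s i.
Proof.
elim: s i => //= a s IH i; rewrite (path_sortedE geq_trans) => /andP[/allP sa ss].
case: ltnP => [a0|a0]; first by case: i => //= i; exact: IH.
have -> : [seq x <- s | 0 < x]%N = [::].
  by apply/eqP; rewrite -(negbK (_ == _)) -has_filter; apply/hasPn => x /sa /=; lia.
rewrite nth_nil; case: i => [|i] /=; first by lia.
have [il|il] := ltnP i (size s); last by rewrite nth_default.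
by have := sa _ (mem_nth 0%N il) => /=; lia.
Qed.

Lemma young_ex n (f : 'I_n -> nat) : (forall i j : 'I_n, j = i.+1 :> nat -> (f j <= f i)%N) ->
  exists nu : young, (size nu <= n)%N /\ forall i : 'I_n, row_length nu i = f i.
Proof.
move=> fd; pose s := [seq f i | i : 'I_n <- enum 'I_n].
have szs : size s = n by rewrite size_map size_enum_ord.
have nths (i : 'I_n) : nth 0%N s i = f i.
  by rewrite (nth_map i) ?size_enum_ord // nth_ord_enum.
have ss : sorted geq s.
  apply/(sortedP 0%N) => i; rewrite szs => i1n.
  by rewrite (nths (Ordinal (ltnW i1n))) (nths (Ordinal i1n)); exact: fd.
have nuP : is_partition [seq x <- s | 0 < x]%N.
  by rewrite /is_partition sorted_filter ?mem_filter //; exact: geq_trans.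
exists (MkYoung nuP); split=> [|i] /=; last by rewrite /row_length /= nth_filter_pos.
by rewrite -szs size_filter count_size.
Qed.

Lemma filter_iota_range a b : (a <= b)%N ->
  [seq c <- iota 0 b | (a <= c < b)%N] = iota a (b - a).
Proof.
move=> ab; apply: (irr_sorted_eq ltn_trans ltnn).
- by apply: sorted_filter; [exact: ltn_trans|exact: iota_ltn_sorted].
- exact: iota_ltn_sorted.
by move=> c; rewrite mem_filter !mem_iota; lia.
Qed.

Lemma mem_row_word (nu la : young) T r c : in_skew nu la (r, c) -> T (r, c) \in row_word nu la T.
Proof.
move=> rc; apply/allpairsPdep; exists r, c; split=> //.
  rewrite mem_rev mem_iota add0n /= -row_length_gt0.
  by move: rc; rewrite in_skewE; lia.
by rewrite mem_filter rc mem_iota; move: rc; rewrite in_skewE; lia.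
Qed.

Lemma tableau_range off N w (la nu : young) T r c : supported (off - 1) (off + N%:Z) w ->
  tableaux w la nu T -> in_skew nu la (r, c) -> off <= T (r, c) < off + N%:Z.
Proof.
move=> ws [_ Tw] rc; have /allP := hecke_letters (supported_inv ws) Tw.
by move=> /(_ _ (mem_row_word T rc)); lia.
Qed.

(** Below [la] the first column is strictly increasing with at most [N] possible entries. Hence a
    fixed number of variables serves all tableaux for [w]. *)
Lemma tableau_size off N w (la nu : young) T : supported (off - 1) (off + N%:Z) w ->
  tableaux w la nu T -> (size nu <= size la + N)%N.
Proof.
move=> ws Tt; rewrite leqNgt; apply/negP => nn.
have box k : (size la + k < size nu)%N -> in_skew nu la (size la + k, 0)%N.
  by move=> kn; rewrite in_skewE row_length_out ?leq_addr // row_length_gt0.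
have lb k : (size la + k < size nu)%N -> off + k%:Z <= T (size la + k, 0)%N.
  elim: k => [|k IH] kn; first by have := tableau_range ws Tt (box _ kn); lia.
  have kn' : (size la + k < size nu)%N by lia.
  have [[_ _ _ col] _] := Tt.
  by have := col _ _ _ (box _ kn') (box _ kn) ltac:(lia); have := IH kn'; lia.
by have := lb _ nn; have := tableau_range ws Tt (box _ nn); lia.
Qed.

(** * The tableaux for [w] as paths *)

Section TableauPaths.

Variables (n : nat) (off : int) (N : nat) (w : Sigma) (la : young).
Hypothesis ws : supported (off - 1) (off + N%:Z) w.
Hypothesis lan : (size la <= n)%N.
Hypothesis small : forall nu T, tableaux w la nu T -> (size nu <= n)%N.

Local Notation rl nu := (fun i : 'I_n => row_length nu i).
Local Notation lf := (rl la).
Implicit Types (nu : young) (p : seq (step n)) (T : nat * nat -> int).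

Lemma rl_dec nu (i j : 'I_n) : j = i.+1 :> nat -> (rl nu j <= rl nu i)%N.
Proof. by move=> ji /=; rewrite ji; apply: row_length_le. Qed.

Definition tableau_of_path p : nat * nat -> int :=
  fun b => if insub b.1 is Some i then path_tableau off lf p i b.2 else 0.

Lemma tableau_of_pathE p (i : 'I_n) c : tableau_of_path p (i : nat, c) = path_tableau off lf p i c.
Proof. by rewrite /tableau_of_path /= valK. Qed.

Lemma tableau_of_path_out p r c : (n <= r)%N -> tableau_of_path p (r, c) = 0.
Proof. by move=> nr; rewrite /tableau_of_path /= insubF // ltnNge nr. Qed.

Lemma row_word_path nu T p : good_path lf p -> (size nu <= n)%N ->
  path_shape lf p =1 rl nu ->
  (forall (i : 'I_n) c, T (i : nat, c) = path_tableau off lf p i c) ->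
  rev (row_word nu la T) = path_word off p.
Proof.
move=> gp nun shp Tp; pose rowT r := [seq T (r, c) | c <- iota 0 (row_length nu r) & in_skew nu la (r, c)].
have -> : rev (row_word nu la T) = flatten [seq rev (rowT r) | r <- iota 0 (size nu)].
  by rewrite /row_word -/(rowT _) rev_flatten -map_comp -map_rev revK.
have -> : flatten [seq rev (rowT r) | r <- iota 0 (size nu)] = flatten [seq rev (rowT r) | r <- iota 0 n].
  rewrite -(subnKC nun) iotaD map_cat flatten_cat add0n -[LHS]cats0; congr (_ ++ _).
  apply/esym/nilP; rewrite /nilp size_flatten /shape -map_comp sumnE big_map big1_seq // => r.
  rewrite mem_iota => /andP[_ /andP[nr _]]; rewrite /= /rowT row_length_out //.
rewrite /path_word -val_enum_ord -map_comp; congr flatten; apply: eq_map => i /=.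
rewrite (path_row_letters off i gp); congr rev; rewrite /rowT shp.
rewrite (eq_filter (a2 := fun c => (row_length la i <= c < row_length nu i)%N)); last first.
  by move=> c; rewrite in_skewE.
rewrite filter_iota_range; last by rewrite -shp path_shape_ge.
by apply: eq_map => c; exact: Tp.
Qed.

Lemma path_of_tableau nu T : tableaux w la nu T ->
  exists p, [/\ p \in paths lf N, path_shape lf p =1 rl nu, tableau_of_path p = T
    & hecke_prod (path_word off p) = w].
Proof.
move=> Tt; have nun := small Tt; have [[sub out row col] Tw] := Tt.
have /diagram_subP le := sub.
have RT : row_tableau off lf N (rl nu) (fun i c => T (i : nat, c)).
  split=> [i|i j ji|i c ci|i c c' lc cc' c'n|i j c ji ci|i c nc].
  - exact: le.
  - exact: rl_dec.
  - by apply: (tableau_range ws Tt); rewrite in_skewE.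
  - by apply: row; rewrite ?in_skewE //; lia.
  - have lij := rl_dec la ji; have nij := rl_dec nu ji.
    by apply: col; rewrite ?in_skewE ?ji //; rewrite ?ji /= in lij nij ci *; lia.
  - by apply: out; rewrite in_skewE.
have [p [sp gp shp Tp]] := row_tableau_path (rl_dec la) RT.
have TE : tableau_of_path p = T.
  apply/funext => -[r c]; have [rn|nr] := ltnP r n.
    by rewrite -[r]/(Ordinal rn : nat) tableau_of_pathE Tp.
  by rewrite tableau_of_path_out // out // in_skewE [row_length nu r]row_length_out ?(leq_trans nun) ?ltn0 ?andbF.
exists p; split=> //; first by rewrite mem_paths sp eqxx.
rewrite -(row_word_path (T := T) gp nun shp) => [|i c]; last by rewrite Tp.
by rewrite hecke_prod_rev -/(hecke_perm nu la T) Tw invgK.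
Qed.

Lemma tableau_of_pathP nu p : (size nu <= n)%N -> p \in paths lf N ->
  path_shape lf p =1 rl nu -> hecke_prod (path_word off p) = w ->
  tableaux w la nu (tableau_of_path p).
Proof.
move=> nun; rewrite mem_paths => /andP[/eqP sp gp] shp pw.
have [sub dec range row col out] := path_row_tableau off (rl_dec la) gp.
have out' r c : (n <= r)%N -> in_skew nu la (r, c) = false.
  by move=> nr; rewrite in_skewE [row_length nu r]row_length_out ?ltn0 ?andbF ?(leq_trans nun).
split; last first.
  rewrite /hecke_perm -[row_word _ _ _]revK hecke_prod_rev.
  by rewrite (row_word_path gp nun shp) ?pw // => i c; rewrite tableau_of_pathE.
have sk (i : 'I_n) c : in_skew nu la (i : nat, c) = (lf i <= c < path_shape lf p i)%N.
  by rewrite in_skewE shp.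
split.
- apply/diagram_subP => r; have [rn|nr] := ltnP r n.
    by rewrite -[r]/(Ordinal rn : nat) -(shp (Ordinal rn)).
  by rewrite row_length_out //; lia.
- move=> [r c]; have [rn|nr] := ltnP r n; last by rewrite tableau_of_path_out.
  by rewrite -[r]/(Ordinal rn : nat) tableau_of_pathE sk; exact: out.
- move=> r c c'; have [rn|nr] := ltnP r n; last by rewrite out'.
  rewrite -[r]/(Ordinal rn : nat) !tableau_of_pathE !sk => /andP[h1 _] /andP[_ h2] cc'.
  exact: row.
move=> r r' c; have [rn|nr] := ltnP r' n; last by rewrite (out' r') // andbF.
(* So far only adjacent rows can be compared; the boxes in between belong to the skew shape because
   row lengths decrease. *)
move=> + + rr'; have [k r'E] : exists k, r' = (r + k.+1)%N by exists (r' - r.+1)%N; lia.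
rewrite {r' rr'}r'E in rn *; elim: k rn => [|k IH] rn rc r'c.
  have rn' : (r < n)%N by lia.
  rewrite addn1 in rn r'c *.
  have := @col (Ordinal rn') (Ordinal rn) c (erefl _).
  rewrite -!tableau_of_pathE /=; apply.
  by move: rc r'c; rewrite !in_skewE shp /=; lia.
have rn' : (r + k.+1 < n)%N by lia.
have mid : in_skew nu la (r + k.+1, c)%N.
  move: rc r'c; rewrite !in_skewE => /andP[h1 _] /andP[_ h2].
  have := @row_length_le la r (r + k.+1) ltac:(lia).
  by have := @row_length_le nu (r + k.+1) (r + k.+2) ltac:(lia); lia.
apply: lt_trans (IH rn' rc mid) _; rewrite addnS in rn r'c *.
have := @col (Ordinal rn') (Ordinal rn) c (erefl _).
rewrite -!tableau_of_pathE /=; apply.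
by move: mid r'c; rewrite !in_skewE shp /=; lia.
Qed.

Definition tableau_paths nu : seq (seq (step n)) :=
  [seq p <- paths lf N | (hecke_prod (path_word off p) == w) &&
     [forall i, path_shape lf p i == rl nu i]].

Lemma mem_tableau_paths nu p : (p \in tableau_paths nu) <->
  [/\ p \in paths lf N, hecke_prod (path_word off p) = w & path_shape lf p =1 rl nu].
Proof.
rewrite mem_filter; split=> [/andP[/andP[/eqP h1 /forallP h2] h3]|[-> -> h]].
  by split=> // i; apply/eqP.
by rewrite eqxx andbT /=; apply/forallP => i; apply/eqP.
Qed.

Lemma tableaux_image nu : (size nu <= n)%N ->
  tableaux w la nu = tableau_of_path @` [set` tableau_paths nu].
Proof.
move=> nun; apply/seteqP; split=> [T Tt|_ [p /mem_tableau_paths[pp pw shp] <-]].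
  by have [p [pp shp TE pw]] := path_of_tableau Tt; exists p => //; apply/mem_tableau_paths.
exact: tableau_of_pathP.
Qed.

Lemma finite_tableaux nu : finite_set (tableaux w la nu).
Proof.
have [nun|nun] := leqP (size nu) n.
  by rewrite tableaux_image //; apply: finite_image; exact: finite_seq.
rewrite (_ : tableaux _ _ _ = set0) //; apply/seteqP; split=> // T /small.
by rewrite leqNgt nun.
Qed.

Lemma structure_constantE nu : (size nu <= n)%N ->
  structure_constant w la nu = size (tableau_paths nu).
Proof.
move=> nun; rewrite /structure_constant tableaux_image //.
have -> : [set` tableau_paths nu] = [set` [fset p in tableau_paths nu]%fset].
  by apply/seteqP; split=> p /=; rewrite !inE.
rewrite fset_set_image; last exact: finite_fset.
rewrite set_fsetK card_in_imfset /=; last first.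
  move=> p q; rewrite !inE => /mem_tableau_paths[pp _ shp] /mem_tableau_paths[qq _ shq] Tpq.
  move: pp qq; rewrite !mem_paths => /andP[/eqP sp gp] /andP[/eqP sq gq].
  apply: (path_tableau_inj (off := off) (rl_dec la)) => //; first by rewrite sp sq.
    by move=> i; rewrite shp shq.
  by move=> i c; rewrite -!tableau_of_pathE Tpq.
by rewrite card_fseq undup_id // filter_uniq // uniq_paths.
Qed.

Lemma structure_constant_size nu : structure_constant w la nu <> 0%N -> (size nu <= n)%N.
Proof.
move=> c0; apply: contrapT => nun; apply: c0; rewrite /structure_constant.
rewrite (_ : tableaux _ _ _ = set0) ?fset_set0 ?cardfs0 //.
by apply/seteqP; split=> // T /small.
Qed.

(** Groups the paths by their final shape. [Y] collects the shapes of all good paths, before the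
    condition on [w], so some structure constants in the sum may vanish. *)
Lemma tableau_expansion : exists Y : seq young,
  [/\ uniq Y, forall nu, nu \in Y -> (size nu <= n)%N,
      forall nu, structure_constant w la nu <> 0%N -> nu \in Y
    & bialternant lf * stable_poly n off N w =
      \sum_(nu <- Y) bialternant (rl nu) *+ structure_constant w la nu].
Proof.
(* Shapes are turned into diagrams by choice; outside [paths] the value [la] is a dummy. *)
have pex p : exists nu, p \in paths lf N ->
    (size nu <= n)%N /\ forall i : 'I_n, row_length nu i = path_shape lf p i.
  have [|] := boolP (p \in paths lf N); last by exists la.
  rewrite mem_paths => /andP[_ gp].
  have [|nu nuP] := @young_ex n (path_shape lf p); last by exists nu.
  by move=> i j ji; exact: (@path_shape_dec n lf (@rl_dec la) p i j gp ji).
have {pex} [yo yoP] := choice pex.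
pose Y := undup [seq yo p | p <- paths lf N].
have Yn nu : nu \in Y -> (size nu <= n)%N.
  by rewrite mem_undup => /mapP[p /yoP[yn _] ->].
have yoE p nu : p \in paths lf N -> (size nu <= n)%N ->
    (yo p == nu) = [forall i, path_shape lf p i == rl nu i].
  move=> pp nun; have [yn yi] := yoP _ pp; apply/eqP/forallP => [<- i|h].
    by rewrite yi.
  apply: young_eq => r; have [rn|nr] := ltnP r n.
    by rewrite -[r]/(Ordinal rn : nat) yi; exact/eqP/h.
  by rewrite !row_length_out ?(leq_trans yn) ?(leq_trans nun).
exists Y; split=> // [|nu nu0|]; first exact: undup_uniq.
  have nun := structure_constant_size nu0.
  rewrite (structure_constantE nun) in nu0.
  case E : (tableau_paths nu) nu0 => [//|p s] _.
  have /mem_tableau_paths[pp _ shp] : p \in tableau_paths nu by rewrite E mem_head.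
  have <- : yo p = nu by apply/eqP; rewrite yoE //; apply/forallP => i; rewrite shp.
  by rewrite mem_undup map_f.
rewrite (path_expansion _ _ _ (rl_dec la)).
transitivity (\sum_(nu <- Y) \sum_(p <- paths lf N | (hecke_prod (path_word off p) == w) && (yo p == nu))
    bialternant (path_shape lf p)).
  rewrite (exchange_big_dep (fun p => hecke_prod (path_word off p) == w)) /=; last first.
    by move=> nu p _ /andP[].
  rewrite big_seq_cond [RHS]big_seq_cond; apply: eq_bigr => p /andP[pp pw].
  rewrite pw /= -big_filter (_ : [seq nu <- Y | yo p == nu] = [:: yo p]) ?big_seq1 //.
  have := filter_pred1_uniq (undup_uniq [seq yo p | p <- paths lf N]).
  move=> /(_ (yo p)); rewrite mem_undup map_f // => /(_ isT) <-.
  by apply: eq_filter => nu; rewrite /= eq_sym.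
apply: eq_big_seq => nu /Yn nun; rewrite structure_constantE //.
rewrite /tableau_paths size_filter -iter_addr_0 -big_const_seq.
rewrite big_seq_cond [RHS]big_seq_cond; apply: eq_big => [p|p /andP[pp /andP[_]]].
  by case pp: (p \in _) => //=; rewrite yoE.
rewrite yoE // => /forallP h; congr bialternant; apply/funext => i; exact/eqP.
Qed.

End TableauPaths.

(** * Tableaux of Grassmannian permutations *)

(* That is, [v^-1] is increasing up to [l] and after [l]. *)
Definition straddling (l : int) (v : Sigma) : Prop :=
  forall x y, x < y -> v y < v x -> (v y <= l) && (l < v x).

(** An inversion of [v] persists after an ascending multiplication, with the same two values at
    moved positions, so the condition passes from a product to its prefixes. *)
Lemma straddling_back l v a : straddling l (hecke_simple v a) -> straddling l v.
Proof.
rewrite hecke_simpleE; case: ifP => // va sv x y xy vyx.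
have := sv (simple a x) (simple a y); rewrite !sigmaM !simpleK; apply=> //.
rewrite simple_lt // => -[xa ya]; move: xy vyx; rewrite xa ya.
  by rewrite (lt_gtF va).
by move=> aa; exfalso; lia.
Qed.

Lemma straddling_prefix l v s : straddling l (foldl hecke_simple v s) -> straddling l v.
Proof. by elim: s v => //= a s IH v /IH/straddling_back. Qed.

Lemma straddling_step l v a : straddling l (hecke_simple v a) ->
  [/\ v a <= l, l < v (a + 1) & forall x, hecke_simple v a x = v (simple a x)] \/
  [/\ l < v a, v (a + 1) <= l & hecke_simple v a = v].
Proof.
rewrite hecke_simpleE; case: ifP => va sv; [left|right].
  have := sv a (a + 1); rewrite !sigmaM simpleL simpleR => /(_ ltac:(lia) va)/andP[h1 h2].
  by split.
have va' : v (a + 1) < v a by case: (sigma_cmp v a) => //; rewrite va.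
by have /andP[] := sv a (a + 1) ltac:(lia) va'.
Qed.

(** The positions of the values above [l], listed by [h]. By [straddling_step] a letter [a] that
    acts moves one of them from [a + 1] to [a]. *)
Definition holes (l : int) (v : Sigma) (h : nat -> int) : Prop :=
  forall x, l < v x <-> exists c, x = h c.

(* A row with [b] boxes moves each of the first [b] holes down by one; [b'] is the
   length of the next lower row, whose entries are the first [b'] holes. *)
Lemma holes_row l v (h t : nat -> int) b b' :
  {homo h : c c' / (c < c')%N >-> c < c'} -> holes l v h ->
  (forall c, (b' <= c)%N -> h c = l + c.+1%:Z) ->
  (forall c c', (c < c' < b)%N -> t c < t c') ->
  (forall c, (c < b')%N -> (c < b)%N -> t c < h c) ->
  straddling l (foldl hecke_simple v [seq t c | c <- iota 0 b]) ->
  (forall c, (c < b)%N -> t c = h c - 1) /\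
  holes l (foldl hecke_simple v [seq t c | c <- iota 0 b]) (fun c => h c - (c < b)%N%:Z).
Proof.
move=> hmono vh hout tmono th sv.
suff : forall k, (k <= b)%N -> (forall c, (c < k)%N -> t c = h c - 1) /\
    holes l (foldl hecke_simple v [seq t c | c <- iota 0 k]) (fun c => h c - (c < k)%N%:Z).
  by apply.
elim=> [|k IH] kb.
  split=> // x; rewrite vh /=; split=> -[c ->]; exists c; first by rewrite subr0.
  by rewrite subr0.
have [tk hk] := IH (ltnW kb); set vk := foldl _ _ _ in hk.
have fE : foldl hecke_simple v [seq t c | c <- iota 0 k.+1] = hecke_simple vk (t k).
  by rewrite -addn1 iotaD map_cat foldl_cat.
have sk : straddling l (hecke_simple vk (t k)).
  rewrite -fE; move: sv; rewrite -(subnKC kb) iotaD map_cat foldl_cat.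
  exact: straddling_prefix.
have hle c c' : (c <= c')%N -> h c <= h c'.
  by rewrite leq_eqVlt => /orP[/eqP->//|/hmono/ltW].
have [[a1 a2 vE]|[a1 a2 vE]] := straddling_step sk.
  have [c tc] := (hk _).1 a2.
  have kc : (k <= c)%N.
    rewrite leqNgt; apply/negP => ck; move: tc; rewrite ck -tk //.
    by have := tmono c k; rewrite ck kb => /(_ isT); lia.
  have {tc} tc : t k + 1 = h c by rewrite tc ltnNge kc subr0.
  (* A later hole cannot be the one that moves: for [k < b'] one has [t k < h k], and from [b'] on
     the holes are consecutive, so [t k] would itself be a hole. *)
  have ck : c = k.
    apply/eqP; rewrite eqn_leq kc andbT leqNgt; apply/negP => kltc.
    have [kb'|b'k] := ltnP k b'.
      by have := th k kb' kb; have := hmono _ _ kltc; lia.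
    have E : t k = h c.-1.
      have := hout c ltac:(lia); have := hout c.-1 ltac:(lia); lia.
    have /hk : exists c', t k = h c' - (c' < k)%N%:Z.
      by exists c.-1; rewrite E (_ : (c.-1 < k)%N = false) ?subr0 //; lia.
    by rewrite ltNge a1.
  have tkE : t k = h k - 1 by rewrite ck in tc; lia.
  split=> [c'|x].
    by rewrite ltnS leq_eqVlt => /orP[/eqP->//|]; exact: tk.
  rewrite fE vE hk; split=> -[c' xE].
    exists c'; have [c'k|kc'|c'k] := ltngtP c' k.
    - rewrite ltnS (ltnW c'k); move: xE; rewrite c'k => xE.
      have lt : simple (t k) x < t k by rewrite xE tkE; have := hmono _ _ c'k; lia.
      by move: lt xE; case: (simpleP (t k) x) => *; lia.
    - rewrite ltnS leqNgt kc' /=; move: xE; rewrite ltnNge (ltnW kc') /= subr0 => xE.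
      have lt : t k + 1 < simple (t k) x by rewrite xE tkE; have := hmono _ _ kc'; lia.
      by move: lt xE; case: (simpleP (t k) x) => *; lia.
    - rewrite c'k ltnSn; move: xE; rewrite c'k ltnn subr0 => xE.
      by move: xE; case: (simpleP (t k) x) => *; lia.
  exists c'; move: xE; have [c'k|kc'|->] := ltngtP c' k.
  - rewrite ltnS (ltnW c'k) => ->; rewrite simpleD //; have := hmono _ _ c'k; lia.
  - rewrite ltnS leqNgt kc' /= subr0 => ->; rewrite simpleD //; have := hmono _ _ kc'; lia.
  - by rewrite ltnSn => ->; rewrite -tkE simpleL; lia.
(* A letter acting trivially would sit at a hole. For [k < b'] this contradicts [t k < h k], and
   from [b'] on its neighbour [t k + 1] would be a hole too. *)
case/hk: a1 => c tc; exfalso.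
have kc : (k <= c)%N.
  rewrite leqNgt; apply/negP => ck; move: tc; rewrite ck -tk //.
  by have := tmono c k; rewrite ck kb => /(_ isT); lia.
have {tc} tc : t k = h c by rewrite tc ltnNge kc subr0.
have [kb'|b'k] := ltnP k b'.
  by have := th k kb' kb; have := hle _ _ kc; lia.
have /hk : exists c', t k + 1 = h c' - (c' < k)%N%:Z.
  exists c.+1; rewrite (_ : (c.+1 < k)%N = false) ?subr0; last by lia.
  by rewrite tc !hout; lia.
by rewrite ltNge a2.
Qed.

Lemma count_initial (P : pred nat) m : (forall r r', (r <= r')%N -> P r' -> P r) ->
  (forall r, P r -> (r < m)%N) -> forall r, P r = (r < count P (iota 0 m))%N.
Proof.
elim: m => [|m IH] Pdec Pm r; first by apply/negbTE/negP => /Pm.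
have -> : iota 0 m.+1 = iota 0 m ++ [:: m] by rewrite -addn1 iotaD.
rewrite count_cat /= addn0.
have [Pm'|nPm] := boolP (P m).
  have -> : count P (iota 0 m) = m.
    rewrite -[RHS](size_iota 0); apply/eqP; rewrite -all_count; apply/allP => i.
    by rewrite mem_iota => im; apply: Pdec Pm'; lia.
  by apply/idP/idP => [/Pm|rm]; [lia|apply: Pdec Pm'; lia].
rewrite addn0; apply: IH => // i Pi.
have := Pm i Pi; rewrite ltnS leq_eqVlt => /orP[/eqP im|//].
by rewrite -im Pi in nPm.
Qed.

(** * Column lengths and uniqueness of the straight tableau *)

Definition column_length (nu : young) (r c : nat) : nat :=
  count (fun r' => (c < row_length nu r')%N) (iota r (size nu - r)).

Lemma column_lengthS (nu : young) r c : (r < size nu)%N ->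
  column_length nu r c = ((c < row_length nu r) + column_length nu r.+1 c)%N.
Proof.
by move=> rn; rewrite /column_length (_ : size nu - r = (size nu - r.+1).+1)%N //; lia.
Qed.

Lemma column_length_le (nu : young) r c c' : (c <= c')%N -> (column_length nu r c' <= column_length nu r c)%N.
Proof. by move=> cc'; apply: sub_count => r' /=; exact: leq_ltn_trans. Qed.

Lemma column_length0 (nu : young) r c : (row_length nu r <= c)%N -> column_length nu r c = 0%N.
Proof.
move=> rc; apply/eqP; rewrite -leqn0 leqNgt -has_count; apply/hasPn => r'.
by rewrite mem_iota -leqNgt => /andP[/(row_length_le nu)/leq_trans h _]; exact: h.
Qed.

Lemma column_lengthP (nu : young) c r : (c < row_length nu r)%N = (r < column_length nu 0 c)%N.
Proof.
rewrite /column_length subn0.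
apply: (count_initial (P := fun r => (c < row_length nu r)%N)) => [r1 r2 r12|r1 cr].
  by move/leq_trans; apply; exact: row_length_le.
by rewrite -row_length_gt0; exact: leq_ltn_trans cr.
Qed.

Lemma column_length_size (nu : young) r c : (column_length nu r c <= size nu)%N.
Proof. by rewrite (leq_trans (count_size _ _)) // size_iota leq_subr. Qed.

Definition young0 : young := @MkYoung [::] isT.

Lemma in_skew0 (nu : young) r c : in_skew nu young0 (r, c) = (c < row_length nu r)%N.
Proof. by rewrite in_skewE /row_length /= nth_nil. Qed.

Lemma row_word0 (nu : young) T : row_word nu young0 T =
  flatten [seq [seq T (r, c) | c <- iota 0 (row_length nu r)] | r <- rev (iota 0 (size nu))].
Proof.
rewrite /row_word; congr flatten; apply: eq_map => r; congr map.
rewrite -[RHS](filter_predT) ; apply/eq_in_filter => c.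
by rewrite mem_iota in_skew0.
Qed.

(** Position of the hole of column [c] once the rows from [r] on have been read: it starts at
    [l + c + 1] and moves down by one for each box. If row [r] has a box in this column, it is also
    the entry there. *)
Definition column_holes (l : int) (nu : young) (r c : nat) : int :=
  l + c.+1%:Z - (column_length nu r c)%:Z.

Lemma column_holes_mono l nu r : {homo column_holes l nu r : c c' / (c < c')%N >-> c < c'}.
Proof.
move=> c c' cc'; rewrite /column_holes.
have := column_length_le nu r (ltnW cc'); lia.
Qed.

(** The row word starts with the bottom row, and all its prefixes are straddling. The entries of the
    row just read are holes, so column strictness provides the bound needed in [holes_row], which
    forces the next row. *)
Lemma straight_tableau l v (nu : young) T : straddling l v -> increasing_tableau nu young0 T ->
  hecke_perm nu young0 T = v ->
  (forall r c, (c < row_length nu r)%N -> T (r, c) = column_holes l nu r c) /\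
  holes l v (column_holes l nu 0).
Proof.
move=> sv [_ _ Trow Tcol]; rewrite /hecke_perm row_word0 => Tv.
pose rowT r := [seq T (r, c) | c <- iota 0 (row_length nu r)].
pose W k := flatten [seq rowT r | r <- rev (iota (size nu - k) k)].
have WS k : (k < size nu)%N -> W k.+1 = W k ++ rowT (size nu - k.+1)%N.
  move=> kn; rewrite /W /= (_ : (size nu - k.+1).+1 = size nu - k)%N; last by lia.
  by rewrite rev_cons map_rcons flatten_rcons.
have Wpre k d : (k + d <= size nu)%N -> straddling l (hecke_prod (W (k + d)%N)) ->
    straddling l (hecke_prod (W k)).
  elim: d => [|d IH]; first by rewrite addn0.
  rewrite addnS => kd; rewrite WS // /hecke_prod foldl_cat => /straddling_prefix.
  by apply: IH; exact: ltnW.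
have Wst k : (k <= size nu)%N -> straddling l (hecke_prod (W k)).
  move=> kn; apply: (Wpre k (size nu - k)%N); rewrite subnKC //.
  by rewrite /W subnn -/rowT Tv.
suff H k : (k <= size nu)%N ->
    (forall r c, (size nu - k <= r)%N -> (c < row_length nu r)%N -> T (r, c) = column_holes l nu r c) /\
    holes l (hecke_prod (W k)) (column_holes l nu (size nu - k)).
  have WT : hecke_prod (W (size nu)) = v by rewrite /W subnn.
  by have [] := H _ (leqnn _); rewrite subnn WT => h1 h2; split=> // r c; exact: h1.
elim: k => [_|k IH kn].
  rewrite subn0; split=> [r c nr|x].
    by rewrite row_length_out.
  rewrite /W /hecke_prod /= sigma_oneE; split=> [lx|[c ->]].
    exists (absz (x - l - 1)%R); rewrite /column_holes column_length0 ?row_length_out //; lia.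
  by rewrite /column_holes column_length0 ?row_length_out //; lia.
have [IH1 IH2] := IH (ltnW kn); set r := (size nu - k.+1)%N.
have rS : (size nu - k = r.+1)%N by rewrite /r; lia.
have rn : (r < size nu)%N by rewrite /r; lia.
rewrite rS in IH1 IH2; have st := Wst _ kn; move: st; rewrite WS // -/r /hecke_prod foldl_cat => st.
have hout c : (row_length nu r.+1 <= c)%N -> column_holes l nu r.+1 c = l + c.+1%:Z.
  by move=> rc; rewrite /column_holes column_length0 // subr0.
have tmono c c' : (c < c' < row_length nu r)%N -> T (r, c) < T (r, c').
  by move=> /andP[cc' c'n]; apply: Trow; rewrite ?in_skew0 //; exact: ltn_trans cc' c'n.
have tlt c : (c < row_length nu r.+1)%N -> (c < row_length nu r)%N -> T (r, c) < column_holes l nu r.+1 c.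
  by move=> h1 h2; rewrite -IH1 //; apply: Tcol; rewrite ?in_skew0.
have [t1 t2] := holes_row (@column_holes_mono l nu r.+1) IH2 hout tmono tlt st.
have holesE c : column_holes l nu r c = column_holes l nu r.+1 c - (c < row_length nu r)%N%:Z.
  by rewrite /column_holes (column_lengthS _ rn); lia.
split=> [r' c|x].
  rewrite leq_eqVlt => /orP[/eqP <- cr|]; last exact: IH1.
  by rewrite t1 // holesE cr.
by rewrite t2; split=> -[c ->]; exists c; rewrite holesE.
Qed.

(** The index map [s] is strictly increasing and is the identity from [m] on, whence [c <= s c] and
    [s c + m <= s (c + m) = c + m]. *)
Lemma increasing_seq_eq (f g : nat -> int) (m : nat) :
  {homo f : c c' / (c < c')%N >-> c < c'} -> {homo g : c c' / (c < c')%N >-> c < c'} ->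
  (forall c, (m <= c)%N -> f c = g c) -> (forall c, exists c', f c = g c') -> f =1 g.
Proof.
move=> fm gm fg fsub; have [s sP] := choice fsub.
have gle c c' : (c <= c')%N -> g c <= g c'.
  by rewrite leq_eqVlt => /orP[/eqP->//|/gm/ltW].
have gI c c' : g c < g c' -> (c < c')%N by apply: contraTT; rewrite -leqNgt -leNgt; exact: gle.
have sm c c' : (c < c')%N -> (s c < s c')%N by move=> /fm; rewrite !sP; exact: gI.
have sge c : (c <= s c)%N by elim: c => // c IH; apply: leq_ltn_trans IH (sm _ _ _).
have sadd c k : (s c + k <= s (c + k))%N.
  elim: k => [|k IH]; first by rewrite !addn0.
  by rewrite !addnS; apply: leq_ltn_trans IH (sm _ _ _).
have sbig c : (m <= c)%N -> s c = c.
  move=> mc; apply/eqP; rewrite eqn_leq sge andbT leqNgt; apply/negP => cs.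
  by have := gm _ _ cs; rewrite -sP fg // ltxx.
move=> c; rewrite sP; congr g; apply/eqP; rewrite eqn_leq sge andbT.
by have := sadd c m; rewrite (sbig (c + m)%N) ?leq_addl // leq_add2r.
Qed.

Section Grassmannian.

Variables (la : young) (w : Sigma).
Hypothesis wla : is_grassmannian la w.
Let l := (size la)%:Z.

Lemma grassmannian_mono (x : int) (k : nat) : (x + k.+1%:Z <= l) || (l < x) ->
  w x < w (x + k.+1%:Z).
Proof.
have [_ _ winc] := wla; elim: k => [|k IH] h; first by apply: winc; lia.
have := winc (x + k.+1%:Z) ltac:(lia).
by rewrite (_ : x + k.+1%:Z + 1 = x + k.+2%:Z); [apply: lt_trans; apply: IH|]; lia.
Qed.

Lemma straddling_grassmannian : straddling l w^-1%g.
Proof.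
move=> x y xy; set p := (w^-1)%g y; set q := (w^-1)%g x => pq.
have wp : w p = y by rewrite sigmaVK.
have wq : w q = x by rewrite sigmaVK.
have := @grassmannian_mono p (absz (q - p - 1)%R).
rewrite (_ : p + (absz (q - p - 1)%R).+1%:Z = q); last by lia.
rewrite wp wq => h; apply: contraT => nh.
by have := h ltac:(lia); lia.
Qed.

(** With [la'] the conjugate partition, the positions [l + c + 1 - la'_c] avoid the values of [w] on
    [1..l]: a coincidence with row [r] would contradict the equivalence of [c < la_r] and
    [r < la'_c]. They are positive, so they also avoid the values at points up to 0. *)
Lemma grassmannian_hole c : l < (w^-1)%g (column_holes l la 0 c).
Proof.
rewrite ltNge; apply/negP; set p := (w^-1)%g _ => pl.
have wp : w p = column_holes l la 0 c by rewrite sigmaVK.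
have := column_length_size la 0 c; have [wrow w0 _] := wla.
have [p0|p0] := lerP p 0.
  have wp0 : w p <= 0.
    have [->|pn0] := eqVneq p 0; first by rewrite w0.
    have := @grassmannian_mono p (absz p).-1.
    by rewrite (_ : p + (absz p).-1.+1%:Z = 0) ?w0; lia.
  by move: wp0; rewrite wp /column_holes /l; lia.
have := wrow (absz p) ltac:(lia); rewrite (_ : (absz p)%:Z = p) ?wp; last by lia.
rewrite /column_holes; set r := (size la - absz p)%N => E _.
have := column_lengthP la c r; case: ltnP; case: ltnP => //; lia.
Qed.

(** The holes of [w^-1] are known from the tableau and from [la]. The two increasing enumerations
    agree far out, hence everywhere, and so [nu] and [la] have the same column lengths. *)
Lemma grassmannian_tableau (nu : young) T : tableaux w young0 nu T ->
  nu = la /\ forall r c, (c < row_length nu r)%N -> T (r, c) = column_holes l nu r c.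
Proof.
move=> [Tinc Tw]; have [T1 T2] := straight_tableau straddling_grassmannian Tinc Tw.
split=> //; have E : column_holes l la 0 =1 column_holes l nu 0.
  apply: (@increasing_seq_eq _ _ (row_length la 0 + row_length nu 0)).
  - exact: column_holes_mono.
  - exact: column_holes_mono.
  - by move=> c mc; rewrite /column_holes !column_length0 //; lia.
  by move=> c; apply/T2/grassmannian_hole.
apply: young_eq => r; apply/eqP; rewrite eqn_leq.
have cE c : column_length la 0 c = column_length nu 0 c by have := E c; rewrite /column_holes; lia.
have rE c : (c < row_length la r)%N = (c < row_length nu r)%N by rewrite !column_lengthP cE.
by apply/andP; split; rewrite leqNgt; apply/negP => h;
  [have := rE (row_length la r)|have := rE (row_length nu r)]; rewrite h ltnn.
Qed.

Lemma structure_constant_grassmannian nu :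
  (structure_constant w young0 nu <= (nu == la))%N.
Proof.
rewrite /structure_constant; have [nula|nula] := eqVneq nu la; last first.
  rewrite (_ : tableaux _ _ _ = set0) ?fset_set0 ?cardfs0 //.
  by apply/seteqP; split=> // T /grassmannian_tableau[/eqP]; rewrite (negPf nula).
have [[T Tt]|T0] := pselect (exists T, tableaux w young0 nu T); last first.
  rewrite (_ : tableaux _ _ _ = set0) ?fset_set0 ?cardfs0 //.
  by apply/seteqP; split=> // T Tt; apply: T0; exists T.
rewrite (_ : tableaux _ _ _ = [set T]) ?fset_set1 ?cardfs1 //.
apply/seteqP; split=> [T' T't|_ -> //]; apply/funext => -[r c].
have [_ T'E] := grassmannian_tableau T't; have [_ TE] := grassmannian_tableau Tt.
have [cr|cr] := ltnP c (row_length nu r); first by rewrite T'E ?TE.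
have [[_ out' _ _] _] := T't; have [[_ out _ _] _] := Tt.
by rewrite out ?out' // in_skew0 -leqNgt.
Qed.

End Grassmannian.

(** * The bialternant formula and the product *)

(** Induction on the number of boxes: remove the last box of the lowest nonempty row [r], and
    multiply the smaller permutation [w] on the left by [simple a] with [a = w (l - r)]. On [1..l],
    rows above [r] give values beyond [a + 1] and empty rows values below [a], so the order is
    kept. *)
Lemma grassmannian_shape_ex (l : nat) (mu : nat -> nat) :
  (forall r, (mu r.+1 <= mu r)%N) -> (forall r, (l <= r)%N -> mu r = 0%N) ->
  exists w : Sigma, [/\ forall i : nat, (1 <= i <= l)%N -> w i%:Z = i%:Z + (mu (l - i)%N)%:Z,
    w 0 = 0 & forall x : int, x <> l%:Z -> w x < w (x + 1)].
Proof.
have [k] := ubnP (\sum_(r < l) mu r)%N; elim: k mu => // k IH mu muk mudec mu0.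
have [pos|npos] := boolP [exists r : 'I_l, 0 < mu r]%N; last first.
  have z r : mu r = 0%N.
    have [rl|/mu0//] := ltnP r l.
    by move/existsPn: npos => /(_ (Ordinal rl)) /=; lia.
  by exists 1%g; split=> [i il|//|x _]; rewrite !sigma_oneE ?z; lia.
have /existsP[r1 r1p] := pos.
have [r [rl rp rmax]] : exists r : nat, [/\ (r < l)%N, (0 < mu r)%N &
    forall r' : nat, (r < r')%N -> mu r' = 0%N].
  case: (arg_maxnP (P := fun r : 'I_l => 0 < mu r)%N (fun r => r : nat) r1p) => r rp rmax.
  exists r; split=> // r' rr'; have [r'l|/mu0//] := ltnP r' l.
  apply/eqP; rewrite -leqn0 leqNgt; apply/negP => r'p.
  by have := rmax (Ordinal r'l) r'p; rewrite /= leqNgt rr'.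
pose mu' i := (mu i - (i == r :> nat))%N.
have mu'r : (mu' r).+1 = mu r by rewrite /mu' eqxx; lia.
have mu'n i : (i != r :> nat) -> mu' i = mu i by rewrite /mu' => /negPf ->; rewrite subn0.
have [||i|w [wrow w0 winc]] := IH mu'.
- have E : (\sum_(i < l) mu i = (\sum_(i < l) mu' i).+1)%N.
    rewrite (bigD1 (Ordinal rl)) //= [in RHS](bigD1 (Ordinal rl)) //= -addSn mu'r; congr (_ + _)%N.
    by apply: eq_bigr => i ir; rewrite mu'n.
  by rewrite E in muk.
- move=> i; have := mudec i; rewrite /mu'; case: eqP => [E|_]; case: eqP => [E'|_]; try lia.
  by move=> _; rewrite (rmax i.+1) ?E' //; lia.
- by move=> il; rewrite /mu' mu0.
clear IH muk pos r1 r1p; clearbody mu'.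
have [x0 x0E] : exists x0, x0 = (l - r)%N by exists (l - r)%N.
have mudec2 i j : (i <= j)%N -> (mu j <= mu i)%N.
  move=> /subnKC <-; elim: (j - i)%N => [|d]; first by rewrite addn0.
  by rewrite addnS => /(leq_trans (mudec _)).
have wx0 : w x0%:Z = x0%:Z + (mu' r)%:Z.
  rewrite wrow; last by lia.
  by congr (_ + (mu' _)%:Z); lia.
set a := w x0%:Z in wx0.
have far (i : nat) : (1 <= i <= l)%N -> i <> x0 -> w i%:Z < a \/ a + 1 < w i%:Z.
  move=> il ix; rewrite wx0 (wrow i il); have [ir|ri] := ltnP (l - i)%N r.
    right; rewrite (mu'n (l - i)%N); last by apply/eqP; lia.
    by have := mudec2 (l - i)%N r (ltnW ir); lia.
  left; rewrite (mu'n (l - i)%N); last by apply/eqP;  lia.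
  by rewrite (rmax (l - i)%N);  lia.
have a1 : 1 <= a by rewrite wx0; lia.
exists (simple a * w)%g; split.
- move=> i il; rewrite sigmaM; have [ix|/eqP ix] := eqVneq i x0.
    rewrite ix simpleL wx0 (_ : (l - x0)%N = r); last by lia.
    by lia.
  rewrite simpleD; [|by case: (far i il ix); lia|by case: (far i il ix); lia].
  by rewrite (wrow i il) mu'n //; apply/eqP;  lia.
- by rewrite sigmaM w0 simpleD; lia.
move=> x xl; rewrite !sigmaM simple_lt ?winc //; have wx := winc x xl; last first.
  by move=> [E1 E2]; move: wx; rewrite E1 E2; lia.
move=> [/sigma_inj E1 E2]; move: E2; rewrite E1.
have -> : x0%:Z + 1 = x0.+1%:Z by lia.
case: (far x0.+1); first by lia.
- by lia.
- by move=> h E; move: h; rewrite E; lia.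
- by move=> h E; move: h; rewrite E; lia.
Qed.

Lemma grassmannianP (la : young) : is_grassmannian la (grassmannian la).
Proof.
rewrite /grassmannian; case: xgetP => [w _ //|nw].
have [w [w1 w2 w3]] := @grassmannian_shape_ex (size la) (row_length la)
  (fun r => row_length_le la (leqnSn r)) (@row_length_out la).
by case: (nw w).
Qed.

Section BialternantNonzero.

Variable n : nat.

(** The factors [1 + 'X_i] have constant term 1, so the lowest-degree part is a Vandermonde
    determinant, and the staircase monomial has coefficient 1. *)
Lemma bialternant0_neq0 : bialternant (fun _ : 'I_n => 0%N) != 0.
Proof.
pose delta : 'X_{1..n} := [multinom (n - i.+1)%N | i < n].
pose g : {mpoly int[n]} := \prod_(i < n) (1 + 'X_i) ^+ i.
have fE : shape_mon (fun _ : 'I_n => 0%N) = g * 'X_[delta] :> {mpoly int[n]}.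
  rewrite mulrC mpolyXE_id /shape_mon /gen_mon big_split /=; congr (_ * _).
  by apply: eq_bigr => i _; rewrite addn0 mnmE.
have g0 : g@_0%MM = 1.
  rewrite /g rmorph_prod big1 //= => i _; rewrite rmorphXn rmorphD rmorph1 /=.
  rewrite mcoeffX (_ : (U_(i)%MM == 0%MM) = false) ?addr0 ?expr1n //.
  by apply/eqP => /mnmP/(_ i); rewrite !mnmE eqxx.
apply/eqP => /(congr1 (mcoeff delta)); rewrite mcoeff0 /bialternant /alternate raddf_sum /=.
rewrite (bigD1 1%g) //= perm.odd_perm1 expr0 mul1r msym1m big1 => [|s s1].
  by rewrite fE -[delta in mcoeff delta]addm0 mcoeffMX g0.
rewrite -signr_odd -[(-1) ^+ _]mulr1 -mulrA mul1r.
have -> : (-1) ^+ odd s * msym s (shape_mon (fun _ : 'I_n => 0%N)) =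
    (-1) ^+ odd s *: msym s (shape_mon (fun _ : 'I_n => 0%N)) :> {mpoly int[n]}.
  by case: (odd s); rewrite ?expr1 ?expr0 ?mulN1r ?scaleN1r ?mul1r ?scale1r.
rewrite mcoeffZ mcoeff_sym fE (_ : (_ * _)@__ = 0) ?mulr0 //.
(* Otherwise the permuted staircase is [delta] plus an exponent of degree 0, and since the entries
   of [delta] are distinct, [s = 1]. *)
apply/eqP; apply: contraNT s1; rewrite -mcoeff_msupp (perm_mem (msuppMX _ _)) => /mapP[m' _ E].
have m'0 : m' = 0%MM.
  by apply/eqP; rewrite -mdeg_eq0 -(eqn_add2l (mdeg delta)) -mdegD -E mdeg_mperm addn0.
move: E; rewrite m'0 addm0 => /mnmP E; apply/eqP/permP => i; rewrite perm.perm1.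
apply/val_inj; have := E i; rewrite !mnmE; have := ltn_ord i; have := ltn_ord (s i).
by move=> h1 h2 h3; rewrite /=; lia.
Qed.

End BialternantNonzero.

Lemma factorizations_cat0 (T : Type) (ks : seq (nat * seq T)) m s :
  factorizations (ks ++ nseq m (0%N, s)) = factorizations ks.
Proof.
elim: ks => [|[k s'] ks /= ->] //=.
by elim: m => //= m ->; rewrite subwords0.
Qed.

Lemma mem_factorizations (T : eqType) (t s : seq T) n : all (mem s) t -> (size t <= n)%N ->
  t \in factorizations [seq (((i < size t)%N : nat), s) | i <- iota 0 n].
Proof.
move=> ts tn; pose F i : nat * seq T := (((i < size t)%N : nat), s).
have e1 : [seq F i | i <- iota 0 (size t)] = nseq (size t) (1%N, s).
  rewrite -[in RHS](size_iota 0 (size t)) -(size_map F); apply/all_pred1P.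
  by rewrite all_map; apply/allP => i; rewrite mem_iota /= add0n /F => ->.
have e2 m : [seq F i | i <- iota (size t) m] = nseq m (0%N, s).
  rewrite -[in RHS](size_iota (size t) m) -(size_map F); apply/all_pred1P.
  by rewrite all_map; apply/allP => i; rewrite mem_iota /= /F => /andP[h _]; rewrite ltnNge h.
rewrite -(subnKC tn) iotaD map_cat add0n e1 e2 factorizations_cat0.
elim: t ts {tn F e1 e2} => //= a t IH /andP[sa st].
apply/allpairsP; exists ([:: a], t); split=> //=; last exact: IH.
elim: s sa {IH st} => //= b s IH; rewrite inE mem_cat => /orP[/eqP ->|/IH ->].
  by rewrite subwords0 mem_head.
by rewrite orbT.
Qed.

(** A Hecke word of [w], taken with one letter in each of the first [size t] variables, contributes
    to a squarefree monomial; coefficients are counts, so nothing cancels. *)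
Lemma stable_poly_neq0 (w : Sigma) t n off N :
  supported (off - 1) (off + N%:Z) w -> hecke_prod t = w -> (size t <= n)%N ->
  stable_poly n off N w != 0.
Proof.
move=> ws tw tn; pose m : 'X_{1..n} := [multinom ((i < size t)%N : nat) | i < n].
apply/eqP => /(congr1 (mcoeff m)); rewrite coef_dprod mcoeff0.
rewrite (_ : [seq _ | i <- enum 'I_n] =
    [seq (((i < size t)%N : nat), letters off 0 N) | i <- iota 0 n]); last first.
  by rewrite -val_enum_ord -[RHS]map_comp; apply: eq_map => i; rewrite /= mnmE.
have tin : t \in factorizations [seq (((i < size t)%N : nat), letters off 0 N) | i <- iota 0 n].
  apply: mem_factorizations => //; apply: sub_all (hecke_letters ws tw) => a /=.
  by rewrite mem_letters; lia.
rewrite /factor_count => -[/eqP]; rewrite -leqn0 leqNgt -has_count => /hasP[].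
by exists t => //=; rewrite tw.
Qed.

Lemma supported_window (s : seq Sigma) : exists off N, forall w, w \in s ->
  supported (off - 1) (off + N%:Z) w.
Proof.
elim: s => [|w s [off [N IH]]]; first by exists 0, 0%N.
have [M wM] := supported_ex w.
exists (Num.min off (- M%:Z)), (absz off + N + M + M)%N => v; rewrite inE => /orP[/eqP ->|/IH vs].
  by apply: wM; lia.
by apply: supported_le vs _ _; lia.
Qed.

Definition monomial_of n (m : 'X_{1..n}) : monomial :=
  [fsfun i in [fset x in iota 0 n]%fset => if insub i is Some j then m j else 0%N].

Lemma monomial_of_out n (m : 'X_{1..n}) i : (n <= i)%N -> monomial_of m i = 0%N.
Proof.
by move=> ni; rewrite fsfunE; case: ifP => // _; rewrite insubF // ltnNge ni.
Qed.

Lemma monomial_ofE n (m : 'X_{1..n}) (i : 'I_n) : monomial_of m i = m i.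
Proof. by rewrite fsfunE !inE mem_iota ltn_ord /= valK. Qed.

Lemma multinom_monomial n (m : 'X_{1..n}) : [multinom monomial_of m (i : nat) | i < n] = m.
Proof. by apply/mnmP => i; rewrite mnmE monomial_ofE. Qed.

Lemma monomial_multinom n (k : monomial) : (forall i, (n <= i)%N -> k i = 0%N) ->
  monomial_of [multinom k (i : nat) | i < n] = k.
Proof.
move=> k0; apply/fsfunP => i; have [li|ni] := ltnP i n.
  by rewrite -[i]/(Ordinal li : nat) monomial_ofE mnmE.
by rewrite monomial_of_out // k0.
Qed.

Lemma supported_size (la : young) w off N n : supported (off - 1) (off + N%:Z) w ->
  (size la + N <= n)%N -> forall nu T, tableaux w la nu T -> (size nu <= n)%N.
Proof. by move=> ws lan nu T /(tableau_size ws) nun; exact: leq_trans nun lan. Qed.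

Local Notation rl n nu := (fun i : 'I_n => row_length nu i).

Lemma bialternant_young0 n : bialternant (rl n young0) = bialternant (fun _ : 'I_n => 0%N).
Proof. by congr bialternant; apply/funext => i; rewrite /row_length nth_nil. Qed.

Lemma young0_expansion (la : young) w off N n : is_grassmannian la w ->
  supported (off - 1) (off + N%:Z) w -> (size la <= n)%N ->
  bialternant (fun _ : 'I_n => 0%N) * stable_poly n off N w =
  bialternant (rl n la) *+ structure_constant w young0 la.
Proof.
move=> wla ws lan; rewrite -bialternant_young0.
have small nu T : tableaux w young0 nu T -> (size nu <= n)%N.
  by move=> /(grassmannian_tableau wla)[-> _].
have [Y [uY _ Ysc ->]] := @tableau_expansion n off N w young0 ws (leq0n n) small.
have c0 nu : nu != la -> structure_constant w young0 nu = 0%N.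
  by move=> /negPf nula; have := structure_constant_grassmannian wla nu; rewrite nula leqn0 => /eqP.
have [laY|laY] := boolP (la \in Y).
  rewrite (bigD1_seq la) //= big1 ?addr0 // => nu /c0 ->.
  by rewrite mulr0n.
rewrite big1_seq; last first.
  move=> nu /= nuY; rewrite c0 ?mulr0n //; by apply: contraNneq laY => <-.
suff -> : structure_constant w young0 la = 0%N by rewrite mulr0n.
by apply: contrapT => /Ysc; rewrite (negPf laY).
Qed.

(** Without a tableau [a_0 G_w] would be zero, although neither factor is; the number of variables
    is taken large enough to see a word of [w]. *)
Lemma structure_constant_young0 (la : young) w : is_grassmannian la w ->
  structure_constant w young0 la = 1%N.
Proof.
move=> wla; have [off [N /(_ w)]] := supported_window [:: w]; rewrite mem_head => /(_ isT) ws.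
have [t tw] := hecke_word_ex w.
have := structure_constant_grassmannian wla la; rewrite eqxx leq_eqVlt => /orP[/eqP//|].
rewrite ltnS leqn0 => /eqP c0.
have := young0_expansion wla ws (leq_addl (size t) (size la)).
rewrite c0 mulr0n => /eqP; rewrite mulf_eq0 (negPf (bialternant0_neq0 _)) /=.
by rewrite (negPf (stable_poly_neq0 ws tw _)) // leq_addr.
Qed.

Lemma grassmannian_bialternant (la : young) w off N n : is_grassmannian la w ->
  supported (off - 1) (off + N%:Z) w -> (size la <= n)%N ->
  bialternant (fun _ : 'I_n => 0%N) * stable_poly n off N w = bialternant (rl n la).
Proof. by move=> wla ws lan; rewrite (young0_expansion wla) // structure_constant_young0. Qed.

(** After multiplication by [a_0] both sides are combinations of alternants. The second window is
    quantified after [Y], as it has to contain the letters of all Grassmannian permutations of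
    [Y]. *)
Lemma stable_product (w : Sigma) (la : young) off N n :
  supported (off - 1) (off + N%:Z) w -> (size la + N <= n)%N ->
  exists Y : seq young, [/\ uniq Y,
    forall nu, structure_constant w la nu <> 0%N -> nu \in Y &
    forall off' N', (forall nu, nu \in la :: Y -> supported (off' - 1) (off' + N'%:Z) (grassmannian nu)) ->
      stable_poly n off N w * stable_poly n off' N' (grassmannian la) =
      \sum_(nu <- Y) stable_poly n off' N' (grassmannian nu) *+ structure_constant w la nu].
Proof.
move=> ws lan; have lan' : (size la <= n)%N by rewrite (leq_trans _ lan) // leq_addr.
have [Y [uY Yn Ysc E]] := tableau_expansion ws lan' (supported_size ws lan).
exists Y; split=> // off' N' win.
have gb (nu : young) : (size nu <= n)%N -> nu \in la :: Y ->
    bialternant (fun _ : 'I_n => 0%N) * stable_poly n off' N' (grassmannian nu) = bialternant (rl n nu).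
  by move=> nun nuY; apply: grassmannian_bialternant => //; [exact: grassmannianP|exact: win].
apply: (mulfI (bialternant0_neq0 n)).
rewrite mulrCA gb ?mem_head // mulrC E mulr_sumr; apply: eq_big_seq => nu nuY.
by rewrite mulrnAr gb ?Yn // inE nuY orbT.
Qed.

(** Two exponent functions adding up to [k] vanish wherever [k] does, so the convolution is that of
    polynomials in [n] variables. *)
Lemma psmul_coef n (f g : pseries) (p q : {mpoly int[n]}) (k : monomial) :
  (forall i, (n <= i)%N -> k i = 0%N) ->
  (forall m, p@_m = f (monomial_of m)) -> (forall m, q@_m = g (monomial_of m)) ->
  psmul f g k = (p * q)@_[multinom k (i : nat) | i < n].
Proof.
move=> k0 pf qg; set m := [multinom _ | i < n]; rewrite mcoeffM.
pose phi (b : 'X_{1..n < (mdeg m).+1, (mdeg m).+1}) : monomial * monomial :=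
  (monomial_of b.1, monomial_of b.2).
have phi_inj : injective phi.
  move=> [[m1 h1] [m2 h2]] [[m3 h3] [m4 h4]] [/= e1 e2].
  have E1 : m1 = m3 by rewrite -[m1]multinom_monomial e1 multinom_monomial.
  have E2 : m2 = m4 by rewrite -[m2]multinom_monomial e2 multinom_monomial.
  by congr (_, _); apply/val_inj.
pose r := [seq phi b | b <- enum [pred b : 'X_{1..n < (mdeg m).+1, (mdeg m).+1} | m == (b.1 + b.2)%MM]].
have ur : uniq r by rewrite map_inj_uniq // enum_uniq.
rewrite /psmul (_ : [set ab | _] = [set` r]); last first.
  apply/seteqP; split=> [[a b] /= abk|_ /mapP[b bm ->]] /=; last first.
    move: bm; rewrite mem_enum inE => /eqP mE i; have [li|ni] := ltnP i n.
      rewrite -[i]/(Ordinal li : nat) !monomial_ofE.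
      by have := congr1 (fun m : 'X_{1..n} => m (Ordinal li)) mE; rewrite /m !mnmE.
    by rewrite !monomial_of_out // k0.
  have a0 i : (n <= i)%N -> a i = 0%N by move=> /k0; have := abk i; lia.
  have b0 i : (n <= i)%N -> b i = 0%N by move=> /k0; have := abk i; lia.
  pose ma : 'X_{1..n} := [multinom a (i : nat) | i < n].
  pose mb : 'X_{1..n} := [multinom b (i : nat) | i < n].
  have mE : m = (ma + mb)%MM by apply/mnmP => i; rewrite !mnmE abk.
  have la : (mdeg ma < (mdeg m).+1)%N by rewrite mE mdegD ltnS leq_addr.
  have lb : (mdeg mb < (mdeg m).+1)%N by rewrite mE mdegD ltnS leq_addl.
  apply/mapP; exists (BMultinom la, BMultinom lb).
    by rewrite mem_enum inE /= -mE.
  by rewrite /phi /= !monomial_multinom.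
rewrite -(fsbig_seq _ _ ur) /r big_map big_enum /=.
by apply: eq_bigr => b _; rewrite pf qg.
Qed.

(** The finiteness claims give the identity its meaning: [fset_set] is empty on infinite sets, and
    the sum over all diagrams is taken over a finite support. *)
Theorem corollary6p12 (w : Sigma) (la : young) :
  [/\ forall nu : young, finite_set (tableaux w la nu),
      finite_set [set nu : young | structure_constant w la nu <> 0%N]
    & psmul (stable_grothendieck w) (stable_grothendieck_young la) =
      \sum_(nu \in [set: young])
        stable_grothendieck_young nu *+ structure_constant w la nu].
Proof.
have [off [N /(_ w)]] := supported_window [:: w]; rewrite mem_head => /(_ isT) ws.
have fin nu : finite_set (tableaux w la nu).
  apply: (@finite_tableaux (size la + N) off N w la ws (leq_addr _ _)).
  exact: (supported_size ws (leqnn _)).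
split=> //.
  have [Y [_ Ysc _]] := @stable_product w la off N _ ws (leqnn _).
  by apply: sub_finite_set (finite_seq Y) => nu /Ysc.
apply/funext => k; have [n0 k0] := monomial_bound k.
(* Enough variables for the rows of every tableau and for those occurring in [k]. *)
pose n := (size la + N + n0)%N.
have {}k0 i : (n <= i)%N -> k i = 0%N by move=> ni; apply: k0; rewrite /n in ni; lia.
have [Y [uY Ysc prod]] := @stable_product w la off N n ws (leq_addr _ _).
have [off' [N' win]] := supported_window [seq grassmannian nu | nu <- la :: Y].
have {}win nu : nu \in la :: Y -> supported (off' - 1) (off' + N'%:Z) (grassmannian nu).
  by move=> nuY; apply: win; exact: map_f.
have coefE v o M m : supported (o - 1) (o + M%:Z) v ->
    (stable_poly n o M v)@_m = stable_grothendieck v (monomial_of m).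
  move=> vs; rewrite -{1}(multinom_monomial m) stable_poly_coef // => i.
  exact: monomial_of_out.
rewrite (psmul_coef k0 (fun m => coefE w off N m ws)
  (fun m => coefE _ off' N' m (win _ (mem_head _ _)))) (prod _ _ win) raddf_sum /=.
have -> : \sum_(nu \in [set: young]) stable_grothendieck_young nu *+ structure_constant w la nu =
    \sum_(nu <- Y) stable_grothendieck_young nu *+ structure_constant w la nu.
  rewrite (@fsbigE _ _ _ _ _ Y) //; first by apply: eq_bigl => nu; rewrite in_setT.
  move=> nu _ nuY; rewrite (_ : structure_constant w la nu = 0%N) ?mulr0n //.
  by apply: contrapT => /Ysc; rewrite (negPf nuY).
rewrite fct_sumE; apply: eq_big_seq => nu nuY.
rewrite mcoeffMn stable_poly_coef //; last by apply: win; rewrite inE nuY orbT.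
by rewrite natmulfctE.
Qed.
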